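(* Let $(\mu_t)_{t\in[0,1]}$ be an $\mathsf{HK}$ geodesic in the finite nonnegative Borel measures on $\mathbb R^d$, and let $\boldsymbol T_{s\to t},q_{s\to t}$ be the maps associated with a tight optimal pair of potentials for $(\mu_0,\mu_1)$. For a given $s\in(0,1)$ let $\nu_s$ be a finite nonnegative Borel measure with $\operatorname{supp}(\nu_s)\subset\operatorname{supp}(\mu_s)$. Then the curve $[0,1]\ni t\mapsto\nu_t:=(\boldsymbol T_{s\to t},q_{s\to t})_\star\nu_s$ is also an $\mathsf{HK}$ geodesic. If in addition $\nu_s=\varrho_s\mu_s$ for some Borel function $\varrho_s:\operatorname{supp}(\mu_s)\to[0,+\infty]$, then $\nu_t=\varrho_t\mu_t$ with $\varrho_t(y)=\varrho_s(\boldsymbol T_{t\to s}(y))$ for every $t\in(0,1)$.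
   Context: $\mathsf{HK}(\mu_0,\mu_1)^2=\min_{\boldsymbol\eta}\{\int F(\sigma_0)\mathrm d\mu_0+\int F(\sigma_1)\mathrm d\mu_1+\iint 2\mathrm L_1(x_0-x_1)\mathrm d\boldsymbol\eta\}$, where $\boldsymbol\eta$ ranges over finite nonnegative Borel measures on $\mathbb R^d\times\mathbb R^d$ with marginals $\sigma_i\mu_i$, $F(s)=s\log s-s+1$, $F(0)=1$, $\mathrm L_1(z)=-\log\cos|z|$ for $|z|<\pi/2$ and $+\infty$ otherwise. A geodesic is a curve with $\mathsf{HK}(\mu_s,\mu_t)=|s-t|\,\mathsf{HK}(\mu_0,\mu_1)$ for all $s,t\in[0,1]$. The action of a pair is $(\boldsymbol T,q)_\star\nu:=\boldsymbol T_\sharp(q^2\nu)$. Tight optimal pair for $(\mu_0,\mu_1)$: $\varphi_0,\varphi_1:\mathbb R^d\to[-\infty,+\infty]$, $\varphi_0$ l.s.c., $\varphi_1$ u.s.c., with $\varphi_0(x_0)=\sup_{|x_1-x_0|<\pi/2}\varphi_1(x_1)-\mathrm L_1(x_1-x_0)$ and $\varphi_1(x_1)=\inf_{|x_0-x_1|<\pi/2}\varphi_0(x_0)+\mathrm L_1(x_1-x_0)$ on $\mathbb R^d$, $\int e^{2\varphi_0}\mathrm d\mu_0<\infty$, $\int e^{-2\varphi_1}\mathrm d\mu_1<\infty$, and $\frac12\mathsf{HK}(\mu_0,\mu_1)^2=\int\frac12(1-e^{-2\varphi_1})\mathrm d\mu_1-\int\frac12(e^{2\varphi_0}-1)\mathrm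 d\mu_0$. Associated objects: $\xi_0=\frac12(e^{2\varphi_0}-1)$, $\bar\xi_1=\frac12(1-e^{-2\varphi_1})$, and for $t\in(0,1)$ $$\xi_t(x)=\inf_{|y-x|<\pi/2}\tfrac1{2t}\Big(1-\tfrac{\cos^2(|x-y|)}{1+2t\xi_0(y)}\Big),\qquad \bar\xi_t(x)=\sup_{|y-x|<\pi/2}\tfrac1{2(1-t)}\Big(\tfrac{\cos^2(|x-y|)}{1-2(1-t)\bar\xi_1(y)}-1\Big),$$ with $c/0=+\infty$, $c/(+\infty)=0$ for $c>0$; $\Xi_t=\{\xi_t=\bar\xi_t\}$, which contains $\operatorname{supp}(\mu_t)$. For $s\in(0,1)$, $\xi_s$ is differentiable at every point of $\Xi_s$. For $x\in\Xi_s$, $t\in[0,1]$, $\tau=t-s$: $\boldsymbol T_{s\to t}(x)=x+\boldsymbol{\arctan}\big(\frac{\tau\nabla\xi_s(x)}{1+2\tau\xi_s(x)}\big)$ if $1+2\tau\xi_s(x)>0$, $\boldsymbol T_{s\to t}(x)=x$ if $1+2\tau\xi_s(x)=0$ (no other case occurs); $q_{s\to t}(x)=\big((1+2\tau\xi_s(x))^2+\tau^2|\nabla\xi_s(x)|^2\big)^{1/2}$; here $\boldsymbol{\arctan}(w)=\arctan(|w|)\frac w{|w|}$, $\boldsymbol{\arctan}(0)=0$. *)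

(* Defs.v *)
From HB Require Import structures.
From mathcomp Require Import all_boot all_order all_algebra.
From mathcomp Require Import all_classical all_reals all_analysis.
From mathcomp Require Import measurable_realfun.

Set Implicit Arguments.
Unset Strict Implicit.
Unset Printing Implicit Defensive.

Import Order.TTheory GRing.Theory Num.Theory.
Import numFieldNormedType.Exports.

Local Open Scope classical_set_scope.
Local Open Scope ring_scope.

(* ['rV[R]_d] with its Borel sigma-algebra. The library norm on ['rV[R]_d] is the
   max norm, which induces the usual topology; distances below are Euclidean. The
   product [Rd R d * Rd R d] carries the product sigma-algebra, which is the Borel
   one by second countability. *)
Notation Rd R d := (g_sigma_algebraType (@open 'rV[R%type]_d)).

Notation fmeas R d := {finite_measure set (Rd R d) -> \bar (R%type)}.

Section euclidean.
Context {R : realType} {d : nat}.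
Implicit Types (x z w : 'rV[R]_d).

Definition enorm z : R := Num.sqrt (\sum_(i < d) z 0 i ^+ 2).

Definition eball x (r : R) : set 'rV[R]_d := [set y | enorm (y - x) < r].

Definition grad (f : 'rV[R]_d -> R) x : 'rV[R]_d :=
  \row_(i < d) 'D_(delta_mx 0 i) f x.

(* Since [0^-1 = 0], this is [0] at [w = 0]. *)
Definition vatan w : 'rV[R]_d := (atan (enorm w) / enorm w) *: w.

Definition supp (mu : fmeas R d) : set 'rV[R]_d :=
  [set x | forall U : set 'rV[R]_d, open U -> U x -> (0 < mu U)%E].

Definition upper_semicontinuous (f : 'rV[R]_d -> \bar R) :=
  lower_semicontinuous (fun x => (- f x)%E).

End euclidean.

Section hellinger_kantorovich.
Context {R : realType} {d : nat}.
Implicit Types (mu : fmeas R d).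

(* [F 0 = 1] since [0 * ln 0 = 0]. *)
Definition F (s : R) : R := s * ln s - s + 1.

Definition L1 (z : 'rV[R]_d) : \bar R :=
  if enorm z < pi / 2 then (- ln (cos (enorm z)))%:E else +oo%E.

(* [nu = rho mu] for a real-valued density on the whole space. *)
Definition marginal_density mu (rho : 'rV[R]_d -> R) (nu : set (Rd R d) -> \bar R) :=
  [/\ measurable_fun [set: Rd R d] rho, (forall x, 0 <= rho x) &
      forall A : set (Rd R d), measurable A ->
        nu A = (\int[mu]_(x in A) (rho x)%:E)%E].

Definition HKsq mu0 mu1 : \bar R :=
  ereal_inf [set c : \bar R |
    exists (eta : {finite_measure set (Rd R d * Rd R d)%type -> \bar R})
           (s0 s1 : 'rV[R]_d -> R),
      [/\ marginal_density mu0 s0 (fun A => eta (A `*` setT)),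
          marginal_density mu1 s1 (fun A => eta (setT `*` A)) &
          c = (\int[mu0]_x (F (s0 x))%:E + \int[mu1]_x (F (s1 x))%:E
               + \int[eta]_z (2%:E * L1 (z.1 - z.2)%R))%E]].

(* [HKsq] is always finite: [eta = 0] is admissible. *)
Definition HK mu0 mu1 : R := Num.sqrt (fine (HKsq mu0 mu1)).

(* Only the values of the curve on [0, 1] matter. *)
Definition HK_geodesic (mu : R -> fmeas R d) : Prop :=
  forall s t : R, 0 <= s <= 1 -> 0 <= t <= 1 ->
    HK (mu s) (mu t) = `|s - t| * HK (mu 0) (mu 1).

End hellinger_kantorovich.

Section potentials.
Context {R : realType} {d : nat}.
Implicit Types (x y : 'rV[R]_d) (s t : R).

Local Open Scope ereal_scope.

Definition xi0 (phi0 : 'rV[R]_d -> \bar R) x : \bar R :=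
  (2^-1)%:E * (expeR (2%:E * phi0 x) - 1).

Definition xibar1 (phi1 : 'rV[R]_d -> \bar R) x : \bar R :=
  (2^-1)%:E * (1 - expeR (- (2%:E * phi1 x))).

Definition tight_optimal_pair (mu0 mu1 : fmeas R d)
    (phi0 phi1 : 'rV[R]_d -> \bar R) : Prop :=
  [/\ lower_semicontinuous phi0 /\ upper_semicontinuous phi1,
      forall x0, phi0 x0 =
        ereal_sup [set phi1 x1 - L1 (x1 - x0)%R | x1 in eball x0 (pi / 2)],
      forall x1, phi1 x1 =
        ereal_inf [set phi0 x0 + L1 (x1 - x0)%R | x0 in eball x1 (pi / 2)],
      \int[mu0]_x expeR (2%:E * phi0 x) < +oo /\
      \int[mu1]_x expeR (- (2%:E * phi1 x)) < +oo &
      (2^-1 * HK mu0 mu1 ^+ 2)%:E =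
        \int[mu1]_x xibar1 phi1 x - \int[mu0]_x xi0 phi0 x].

(* The potentials [xi_t] and [xibar_t] are meant for [0 < t < 1]. The library's
   division on extended reals satisfies [c / 0 = +oo] and [c / +oo = 0] for
   [0 < c]. *)
Definition xi (phi0 : 'rV[R]_d -> \bar R) t x : \bar R :=
  ereal_inf [set ((2 * t)^-1)%:E *
                 (1 - (cos (enorm (x - y)%R) ^+ 2)%:E
                        / (1 + (2 * t)%:E * xi0 phi0 y))
            | y in eball x (pi / 2)].

Definition xibar (phi1 : 'rV[R]_d -> \bar R) t x : \bar R :=
  ereal_sup [set ((2 * (1 - t))^-1)%:E *
                 ((cos (enorm (x - y)%R) ^+ 2)%:E
                        / (1 - (2 * (1 - t))%:E * xibar1 phi1 y) - 1)
            | y in eball x (pi / 2)].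

Definition Xi (phi0 phi1 : 'rV[R]_d -> \bar R) t : set 'rV[R]_d :=
  [set x | xi phi0 t x = xibar phi1 t x].

Local Close Scope ereal_scope.

(* [xi phi0 s] is finite everywhere for [0 < s < 1], so [fine] loses nothing. *)
Definition xir (phi0 : 'rV[R]_d -> \bar R) s x : R := fine (xi phi0 s x).

(* Meaningful for [0 < s < 1], [0 <= t <= 1] and [x] in [Xi phi0 phi1 s]. *)
Definition transport (phi0 : 'rV[R]_d -> \bar R) s t x : 'rV[R]_d :=
  let tau := t - s in
  let a := 1 + 2 * tau * xir phi0 s x in
  if 0 < a then x + vatan ((tau / a) *: grad (xir phi0 s) x) else x.

Definition growth (phi0 : 'rV[R]_d -> \bar R) s t x : R :=
  let tau := t - s in
  Num.sqrt ((1 + 2 * tau * xir phi0 s x) ^+ 2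
            + tau ^+ 2 * enorm (grad (xir phi0 s) x) ^+ 2).

End potentials.

Section transforms.
Context {R : realType} {d : nat}.
Implicit Types (mu nu : fmeas R d).

(* [nu' = (T, q)_* nu] for maps [T], [q] defined on [D] (a set of full
   [nu]-measure); their values outside [D] are ignored. *)
Definition is_action (D : set 'rV[R]_d) (T : 'rV[R]_d -> 'rV[R]_d)
    (q : 'rV[R]_d -> R) nu nu' : Prop :=
  [/\ measurable_fun (D : set (Rd R d)) (T : Rd R d -> Rd R d),
      measurable_fun (D : set (Rd R d)) q &
      forall A : set (Rd R d), measurable A ->
        nu' A = (\int[nu]_(x in D `&` T @^-1` A) (q x ^+ 2)%:E)%E].

(* [nu = rho mu] for a Borel function [rho : supp mu -> [0, +oo]]; the values of
   [rho] outside [supp mu] are ignored. *)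
Definition is_density mu (rho : 'rV[R]_d -> \bar R) nu : Prop :=
  [/\ measurable_fun (supp mu : set (Rd R d)) rho,
      (forall x, supp mu x -> (0 <= rho x)%E) &
      forall A : set (Rd R d), measurable A ->
        nu A = (\int[mu]_(x in supp mu `&` A) rho x)%E].

End transforms.

(* Main.v *)
(* Put [U = 1 - 2 s xi_s] and [V = 1 + 2 (1 - s) xibar_s].  Always [(1 - s) U + s V <= 1],
   with equality exactly on [Xi_s].  Weak duality along [0 -> s -> 1], compared with the
   tight optimal pair for [(mu_0, mu_1)], forces equality [mu_s]-almost everywhere, so
   [supp mu_s] lies in the closed set [Xi_s].  There [xi_s] has two-sided quadratic
   expansions; with [p] its gradient, [z_t = ((1 - t) U + t V, (t - s) p)] is a straight
   line on the cone over each point, [q_{s->t} ^ 2 = |z_t| ^ 2], and the angle between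
   [T_{s->r} x] and [T_{s->t} x] is the one between [z_r] and [z_t].

   No optimal plan for [(mu_s, mu_t)] is needed to show [mu_t = (T, q)_* mu_s]:
   [1 + 2 (t - s) xi_s] and [1 - 2 (t - s) xibar_t] are optimal in the dual problem for
   [(mu_s, mu_t)], and perturbing them by a Lipschitz test function [g] stays admissible up
   to second order, so the first-order term [int g dmu_t - int g(T) q ^ 2 dmu_s] vanishes.

   For an arbitrary [nu_s] carried by [Xi_s], the plan [(T_{s->r}, T_{s->t})_* (z_r . z_t) nu_s]
   and the same dual potentials give the same value [(t - r) ^ 2 int (V - U) ^ 2 + |p| ^ 2 dnu_s]
   for [HK(nu_r, nu_t) ^ 2].  Densities are transported because [T_{s->t}] and [T_{t->s}]
   are mutually inverse on [Xi_s] and [Xi_t]. *)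

(* Everything is written for [a = exp (2 phi0)] and [b = exp (- 2 phi1)]. The dual constraint then
   becomes the product inequality [cos2 (x - y) <= a x * b y] with [cos2 = exp (- 2 L1)], the
   Hopf-Lax formulas become suprema of products, and comparing two times is an inequality between
   vectors in a plane. Exchanging [(a, b)] at times [s, t] with [(b, a)] at [1 - s, 1 - t] turns
   forward statements into backward ones.

   The obstacle is the lack of regularity at the end times: [phi0] and [phi1] are only
   semicontinuous and may be infinite, and for [t = 0] or [t = 1] the factor [1 + 2 (t - s) xi_s]
   may vanish. At interior times the suprema are bounded, Lipschitz and quadratically bounded on one
   side. Stationarity and the inverse maps are therefore used only between interior times. The end
   times enter through weak duality, where [+oo] is an admissible value, and through explicit images
   in which an infinite factor only ever meets zero mass. *)
Require Import Defs.
From HB Require Import structures.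
From mathcomp Require Import all_boot all_order all_algebra.
From mathcomp Require Import all_classical all_reals all_analysis.
From mathcomp Require Import measurable_realfun.
From mathcomp Require Import ring lra.

Set Implicit Arguments.
Unset Strict Implicit.
Unset Printing Implicit Defensive.

Import Order.TTheory GRing.Theory Num.Theory.
Import numFieldNormedType.Exports.

Local Open Scope classical_set_scope.
Local Open Scope ring_scope.

(** * Trigonometry and Euclidean geometry *)

Section trigonometry.
Context {R : realType}.
Implicit Types x y a b c : R.

Lemma mean_value (f df : R -> R) a b :
    (forall x, is_derive x 1 f (df x)) ->
  exists2 c, `|c - a| <= `|b - a| & f b - f a = df c * (b - a).
Proof.
move=> fdf; have cf : continuous f.
  by move=> x; apply/differentiable_continuous/derivable1_diffP; apply: ex_derive.
have [ab|/ltW ba] := leP a b.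
  have [|c cab fE] := MVT_segment ab (fun x _ => fdf x).
    exact: continuous_subspaceT.
  exists c => //; move: cab; rewrite in_itv/= => /andP[ac cb].
  by rewrite !ger0_norm ?subr_ge0// lerB.
have [|c cab fE] := MVT_segment ba (fun x _ => fdf x).
  exact: continuous_subspaceT.
exists c; last by rewrite -opprB fE -mulrN opprB.
move: cab; rewrite in_itv/= => /andP[ac cb].
by rewrite ler0_norm ?subr_le0// ler0_norm ?subr_le0// !opprB lerB.
Qed.

Lemma sin_lipschitz a b : `|sin b - sin a| <= `|b - a|.
Proof.
have [c _ ->] := mean_value a b (@is_derive_sin R).
by rewrite normrM ler_piMl// cos_max.
Qed.

Lemma cos_nincr a b : 0 <= a -> a <= b -> b <= pi -> cos b <= cos a.
Proof.
move=> a0 ab bpi; rewrite leNgt ltr_cos -?leNgt// in_itv/= ?a0 ?bpi ?andbT.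
  by rewrite (le_trans a0).
by rewrite (le_trans ab).
Qed.

Lemma sin_le_id x : 0 <= x -> sin x <= x.
Proof.
move=> x0; apply: le_trans (ler_norm _) _.
by have := sin_lipschitz 0 x; rewrite sin0 !subr0 (ger0_norm x0).
Qed.

Lemma sqr_cos_lipschitz a b : `|cos b ^+ 2 - cos a ^+ 2| <= `|b - a|.
Proof.
have -> : cos b ^+ 2 - cos a ^+ 2 = - (sin (b - a) * sin (b + a)).
  rewrite sinB sinD.
  transitivity (cos b ^+ 2 * (cos a ^+ 2 + sin a ^+ 2) - cos a ^+ 2 * (cos b ^+ 2 + sin b ^+ 2)); first by rewrite !cos2Dsin2 !mulr1.
  by ring.
rewrite normrN normrM; apply: le_trans (_ : `|sin (b - a)| * 1 <= _).
  by rewrite ler_wpM2l// sin_max.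
by rewrite mulr1; have := sin_lipschitz 0 (b - a); rewrite sin0 !subr0.
Qed.

(** The derivative [- sin (2 x)] of the squared cosine is 2-Lipschitz, and the mean value point is
    no farther from [a] than [b] is. *)
Lemma sqr_cos_taylor a b :
  cos a ^+ 2 - 2 * sin a * cos a * (b - a) - 2 * (b - a) ^+ 2 <= cos b ^+ 2.
Proof.
have dc x : is_derive x 1 (fun y : R => cos y ^+ 2) (- (2 * sin x * cos x)).
  by apply: is_derive_eq; rewrite /GRing.scale/=; ring.
have [c cab fE] := mean_value a b dc.
rewrite -subr_ge0 (_ : _ - _ = cos b ^+ 2 - cos a ^+ 2
  + 2 * sin a * cos a * (b - a) + 2 * (b - a) ^+ 2); last by ring.
rewrite fE -mulrDl.
have -> : - (2 * sin c * cos c) + 2 * sin a * cos a = - (sin (c *+ 2) - sin (a *+ 2)).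
  by rewrite !sin_mulr2n !mulr2n; ring.
have := sin_lipschitz (a *+ 2) (c *+ 2).
rewrite -mulrnBl normrMn => h.
have h2 : `|(sin (c *+ 2) - sin (a *+ 2)) * (b - a)| <= 2 * (b - a) ^+ 2.
  rewrite normrM -[(b - a) ^+ 2]real_normK ?num_real// expr2 mulrA ler_wpM2r//.
  by rewrite (le_trans h)// -[leLHS]mulr_natl ler_wpM2l.
rewrite mulNr -subr_le0 in h2 *.
have := ler_norm ((sin (c *+ 2) - sin (a *+ 2)) * (b - a)).
by move: h2; set u := (_ - _) * _; set v := `|u|; lra.
Qed.

Lemma cos_atan_sqr x : cos (atan x) ^+ 2 = (1 + x ^+ 2)^-1.
Proof. by rewrite cos_atan exprVn sqr_sqrtr// addr_ge0// sqr_ge0. Qed.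

Lemma sin_atan x : sin (atan x) = x * cos (atan x).
Proof.
have h : cos (atan x) != 0.
  by rewrite cos_atan invr_neq0// sqrtr_eq0 -ltNge ltr_wpDr// sqr_ge0.
by rewrite -{2}(atanK x) /tan mulrAC -mulrA mulfV ?mulr1.
Qed.

Lemma cos_atan_gt0 x : 0 < cos (atan x).
Proof. by apply: cos_gt0_pihalf; rewrite atan_gtNpi2 atan_ltpi2. Qed.

Lemma atan_lipschitz a b : `|atan b - atan a| <= `|b - a|.
Proof.
have [c _ ->] := mean_value a b (@is_derive1_atan R).
rewrite normrM ler_piMl// ger0_norm ?invr_ge0 ?addr_ge0 ?sqr_ge0//.
by rewrite invf_le1 ?ltr_wpDr ?sqr_ge0// lerDl sqr_ge0.
Qed.

Lemma atan_ge0 x : 0 <= x -> 0 <= atan x.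
Proof. by move=> x0; rewrite -(atan0 R) le_atan. Qed.

Lemma atan_le_id x : 0 <= x -> atan x <= x.
Proof.
move=> x0; apply: le_trans (ler_norm _) _.
by have := atan_lipschitz 0 x; rewrite atan0 !subr0 (ger0_norm x0).
Qed.

(* The matrix [P v v^T + Q w w^T], for unit vectors [v] and [w] making the angle
   [a + b], has both eigenvalues at most 1 by the hypotheses on its trace and
   determinant; the conclusion tests it against the unit vector between. *)
Lemma cone_midpoint (P Q a b m : R) : 0 <= P <= 1 -> 0 <= Q <= 1 -> 0 <= m ->
    cos a * cos b - sin a * sin b <= m ->
    0 <= cos a * cos b -> 0 <= sin a * sin b ->
    P * Q * m ^+ 2 <= (1 - P) * (1 - Q) ->
  P * cos a ^+ 2 + Q * cos b ^+ 2 <= 1.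
Proof.
move=> /andP[P0 P1] /andP[Q0 Q1] m0 mab cab0 sab0 PQ.
have ha := cos2Dsin2 a; have hb := cos2Dsin2 b.
(* If [cos (a + b) <= 0], the two squared cosines already sum to at most 1; only in the other case
   can the bound by [m] be squared. *)
have [cs|sc] := leP (cos a * cos b) (sin a * sin b).
  have : (cos a * cos b) ^+ 2 <= (sin a * sin b) ^+ 2.
    by rewrite ler_sqr ?nnegrE.
  rewrite !exprMn [sin a ^+ 2]sin2cos2 [sin b ^+ 2]sin2cos2 => h.
  have : P * cos a ^+ 2 <= cos a ^+ 2 by rewrite ler_piMl ?sqr_ge0.
  have : Q * cos b ^+ 2 <= cos b ^+ 2 by rewrite ler_piMl ?sqr_ge0.
  nra.
have m2 : (cos a * cos b - sin a * sin b) ^+ 2 <= m ^+ 2.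
  by rewrite ler_sqr ?nnegrE ?subr_ge0 ?(ltW sc).
have PQ2 : P * Q * (cos a * cos b - sin a * sin b) ^+ 2 <= (1 - P) * (1 - Q).
  by apply: le_trans PQ; rewrite ler_wpM2l// mulr_ge0.
(* [x] and [y] are the diagonal entries of the identity minus the matrix, in the frame of the vector
   between. Their product is the determinant plus the square of the off-diagonal entry. *)
set x := 1 - P * cos a ^+ 2 - Q * cos b ^+ 2.
set y := 1 - P * sin a ^+ 2 - Q * sin b ^+ 2.
have xy : 0 <= x * y.
  have -> : x * y = (P * cos a * sin a - Q * cos b * sin b) ^+ 2 +
      ((1 - P) * (1 - Q) - P * Q * (cos a * cos b - sin a * sin b) ^+ 2).
    rewrite /x /y; move: ha hb => /(canRL (addrK _)) ha /(canRL (addrK _)) hb.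
    have -> : sin a ^+ 2 = 1 - cos a ^+ 2 by rewrite sin2cos2.
    have -> : sin b ^+ 2 = 1 - cos b ^+ 2 by rewrite sin2cos2.
    rewrite !sqrrB !exprMn [sin a ^+ 2]sin2cos2 [sin b ^+ 2]sin2cos2; ring.
  by rewrite addr_ge0 ?sqr_ge0 ?subr_ge0.
have xDy : 0 <= x + y.
  have -> : x + y = 2 - P * (cos a ^+ 2 + sin a ^+ 2)
                      - Q * (cos b ^+ 2 + sin b ^+ 2) by rewrite /x /y; ring.
  by rewrite ha hb; lra.
suff : 0 <= x by rewrite /x; lra.
rewrite leNgt; apply/negP => x0.
have : y <= 0 by rewrite -(nmulr_rge0 _ x0).
by lra.
Qed.

End trigonometry.

Section euclidean_space.
Context {R : realType} {d : nat}.
Implicit Types (x y z u v w p h : 'rV[R]_d) (k : R).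

Definition dot u v : R := \sum_(i < d) u 0 i * v 0 i.

Lemma dotC u v : dot u v = dot v u.
Proof. by apply: eq_bigr => i _; rewrite mulrC. Qed.

Lemma dotDl u v w : dot (u + v) w = dot u w + dot v w.
Proof. by rewrite -big_split/=; apply: eq_bigr => i _; rewrite mxE mulrDl. Qed.

Lemma dotZl k u v : dot (k *: u) v = k * dot u v.
Proof. by rewrite mulr_sumr; apply: eq_bigr => i _; rewrite mxE mulrA. Qed.

Lemma dotNl u v : dot (- u) v = - dot u v.
Proof. by rewrite -scaleN1r dotZl mulN1r. Qed.

Lemma dotBl u v w : dot (u - v) w = dot u w - dot v w.
Proof. by rewrite dotDl dotNl. Qed.

Lemma dotDr u v w : dot u (v + w) = dot u v + dot u w.
Proof. by rewrite dotC dotDl !(dotC u). Qed.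

Lemma dotZr k u v : dot u (k *: v) = k * dot u v.
Proof. by rewrite dotC dotZl dotC. Qed.

Lemma dotNr u v : dot u (- v) = - dot u v.
Proof. by rewrite dotC dotNl dotC. Qed.

Lemma dotBr u v w : dot u (v - w) = dot u v - dot u w.
Proof. by rewrite dotDr dotNr. Qed.

Lemma dot0l u : dot 0 u = 0.
Proof. by rewrite -(scale0r 0) dotZl mul0r. Qed.

Lemma dot_delta u (i : 'I_d) : dot u (delta_mx 0 i) = u 0 i.
Proof.
rewrite /dot (bigD1 i)//= mxE !eqxx mulr1 big1 ?addr0// => j ji.
by rewrite mxE (negbTE ji) andbF mulr0.
Qed.

Lemma enorm_ge0 z : 0 <= enorm z. Proof. exact: sqrtr_ge0. Qed.

Lemma sqr_enorm z : enorm z ^+ 2 = dot z z.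
Proof. by rewrite sqr_sqrtr// sumr_ge0// => i _; rewrite sqr_ge0. Qed.

Lemma dot_ge0 z : 0 <= dot z z. Proof. by rewrite -sqr_enorm sqr_ge0. Qed.

Lemma enorm0 : enorm (0 : 'rV[R]_d) = 0.
Proof. by rewrite /enorm big1 ?sqrtr0// => i _; rewrite mxE expr0n. Qed.

Lemma enorm_eq0 z : (enorm z == 0) = (z == 0).
Proof.
apply/idP/eqP => [|->]; last by rewrite enorm0.
rewrite -sqrf_eq0 sqr_enorm psumr_eq0 => [/allP zE|i _]; last by rewrite -expr2 sqr_ge0.
apply/rowP => i; rewrite mxE; have := zE i (mem_index_enum _).
by rewrite mulf_eq0 orbb => /eqP.
Qed.

Lemma enorm_gt0 z : (0 < enorm z) = (z != 0).
Proof. by rewrite lt0r enorm_ge0 andbT enorm_eq0. Qed.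

Lemma enormZ k z : enorm (k *: z) = `|k| * enorm z.
Proof.
apply/eqP; rewrite -(@eqrXn2 _ 2) ?enorm_ge0 ?mulr_ge0 ?enorm_ge0//.
by rewrite exprMn !sqr_enorm dotZl dotZr real_normK ?num_real// mulrA expr2.
Qed.

Lemma enormN z : enorm (- z) = enorm z.
Proof. by rewrite -scaleN1r enormZ normrN1 mul1r. Qed.

Lemma enormBC x y : enorm (x - y) = enorm (y - x).
Proof. by rewrite -enormN opprB. Qed.

Lemma cauchy_schwarz u v : `|dot u v| <= enorm u * enorm v.
Proof.
have [->|v0] := eqVneq v 0; first by rewrite dotC dot0l enorm0 mulr0 normr0.
rewrite -(@ler_pXn2r _ 2) ?nnegrE ?mulr_ge0 ?enorm_ge0// exprMn.
rewrite real_normK ?num_real// !sqr_enorm.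
have vv : 0 < dot v v by rewrite -sqr_enorm exprn_gt0// enorm_gt0.
have := dot_ge0 (dot v v *: u - dot u v *: v).
rewrite !(dotBl, dotBr, dotZl, dotZr) (dotC v u).
rewrite (_ : _ - _ = dot v v * (dot u u * dot v v - dot u v ^+ 2)).
  by rewrite pmulr_rge0// subr_ge0.
by ring.
Qed.

Lemma dot_le u v : dot u v <= enorm u * enorm v.
Proof. exact: le_trans (ler_norm _) (cauchy_schwarz _ _). Qed.

Lemma enormD u v : enorm (u + v) <= enorm u + enorm v.
Proof.
rewrite -(@ler_pXn2r _ 2) ?nnegrE ?addr_ge0 ?enorm_ge0//.
rewrite sqr_enorm dotDl !dotDr (dotC v u) sqrrD -!sqr_enorm.
by have := dot_le u v; lra.
Qed.

Lemma enormB_triangle x y z : enorm (x - z) <= enorm (x - y) + enorm (y - z).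
Proof. by apply: le_trans (enormD _ _); rewrite addrA subrK. Qed.

Lemma enorm_lipschitz x y : `|enorm x - enorm y| <= enorm (x - y).
Proof.
rewrite ler_norml lerBDl lerBlDl; apply/andP; split.
  by have := enormB_triangle y x 0; rewrite !subr0 enormBC; lra.
by have := enormB_triangle x y 0; rewrite !subr0; lra.
Qed.

Lemma coord_le_enorm z (i : 'I_d) : `|z 0 i| <= enorm z.
Proof.
rewrite -(@ler_pXn2r _ 2) ?nnegrE ?enorm_ge0// real_normK ?num_real//.
rewrite sqr_enorm /dot (bigD1 i)//= -expr2 lerDl sumr_ge0// => j _.
by rewrite -expr2 sqr_ge0.
Qed.

Lemma norm_le_enorm z : `|z| <= enorm z.
Proof.
rewrite [leLHS]/Num.norm/= mx_normrE; apply/bigmax_leP; split=> [|[i j] _/=].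
  exact: enorm_ge0.
by rewrite (ord1 i) coord_le_enorm.
Qed.

Lemma enorm_le_norm z : enorm z <= d%:R * `|z|.
Proof.
have zi i : `|z 0 i| <= `|z|.
  rewrite [leRHS]/Num.norm/= mx_normrE; apply/bigmax_geP; right.
  by exists (0, i).
rewrite -(@ler_pXn2r _ 2) ?nnegrE ?mulr_ge0 ?enorm_ge0//.
rewrite sqr_enorm exprMn; apply: le_trans (_ : \sum_(i < d) `|z| ^+ 2 <= _).
  apply: ler_sum => i _.
  by rewrite -expr2 -[leLHS]real_normK ?num_real// ler_sqr ?nnegrE.
rewrite sumr_const card_ord -[leLHS]mulr_natl ler_wpM2r ?sqr_ge0//.
by rewrite -natrX ler_nat; case: d => // n; rewrite expnS expn1 leq_pmulr.
Qed.

Lemma enorm_pos_bound : exists2 k, 0 < k & forall z, enorm z <= k * `|z|.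
Proof.
exists (d%:R + 1); first by rewrite ltr_wpDl.
move=> z; apply: le_trans (enorm_le_norm z) _.
by rewrite ler_wpM2r// lerDl.
Qed.

Lemma nbhs_enorm x (A : set 'rV[R]_d) :
  nbhs x A <-> exists2 e, 0 < e & forall y, enorm (y - x) < e -> A y.
Proof.
split=> [/nbhs_ballP[e /= e0 eA]|[e e0 eA]].
  exists e => // y yx; apply: eA; rewrite -ball_normE/=.
  by rewrite distrC (le_lt_trans (norm_le_enorm _)).
have [k k0 kP] := enorm_pos_bound.
apply/nbhs_ballP; exists (e / k) => /=; first by rewrite divr_gt0.
move=> y; rewrite -ball_normE/= distrC => xy; apply: eA.
by rewrite (le_lt_trans (kP _))// mulrC -ltr_pdivlMr.
Qed.

Lemma enorm_lipschitz_continuous (f : 'rV[R]_d -> R) k :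
  (forall x y, `|f x - f y| <= k * enorm (x - y)) -> continuous f.
Proof.
move=> fk x; apply/(@cvgrPdist_lt _ _ _ (nbhs x)) => e e0.
have k0 : 0 < `|k| + 1 by rewrite ltr_wpDl.
apply/nbhs_enorm; exists (e / (`|k| + 1)); first by rewrite divr_gt0.
move=> y; rewrite ltr_pdivlMr// => yx; apply: le_lt_trans (fk _ _) _.
rewrite enormBC mulrC; apply: le_lt_trans yx.
by rewrite ler_wpM2l ?enorm_ge0//; have := ler_norm k; lra.
Qed.

Lemma enorm_lipschitz_continuous_rV (f : 'rV[R]_d -> 'rV[R]_d) k (D : set 'rV[R]_d) :
    (forall x y, D x -> D y -> enorm (f x - f y) <= k * enorm (x - y)) ->
  {within D, continuous f}.
Proof.
move=> fk; apply/subspace_continuousP => x Dx A /nbhs_enorm[e e0 eA].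
have k0 : 0 < `|k| + 1 by rewrite ltr_wpDl.
rewrite nbhs_simpl/= /within/=; apply/nbhs_enorm.
exists (e / (`|k| + 1)); first by rewrite divr_gt0.
move=> y; rewrite ltr_pdivlMr// => yx Dy; apply: eA.
apply: le_lt_trans (fk _ _ Dy Dx) _.
rewrite mulrC; apply: le_lt_trans yx.
by rewrite ler_wpM2l ?enorm_ge0//; have := ler_norm k; lra.
Qed.

Lemma continuous_enorm : continuous (@enorm R d).
Proof.
apply: (@enorm_lipschitz_continuous _ 1) => x y.
by rewrite mul1r enorm_lipschitz.
Qed.

Lemma eball_compact x k : compact [set y | enorm (y - x) <= k].
Proof.
apply: bounded_closed_compact.
  exists (k + enorm x); split; first exact: num_real.
  move=> M kM y /= yx; apply: le_trans (norm_le_enorm _) _.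
  by have := enormB_triangle y x 0; rewrite !subr0; lra.
apply: (@closed_comp _ _ (fun y => enorm (y - x)) [set r : R | r <= k]); last exact: closed_le.
move=> y _; apply: (@enorm_lipschitz_continuous (fun y => enorm (y - x)) 1).
move=> u v; rewrite mul1r; apply: le_trans (enorm_lipschitz _ _) _.
by rewrite opprB addrA subrK.
Qed.

Definition angle z : R := Num.min (enorm z) (pi / 2).

(** This is [exp (- 2 L1)], with value 0 where [L1 = +oo]. Truncating the angle makes it globally
    Lipschitz, since the squared cosine reaches 0 at the cutoff. *)
Definition cos2 z : R := cos (angle z) ^+ 2.

Lemma angle_ge0 z : 0 <= angle z.
Proof. by rewrite le_min enorm_ge0 divr_ge0 ?pi_ge0. Qed.

Lemma angle_le z : angle z <= pi / 2. Proof. by rewrite ge_min lexx orbT. Qed.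

Lemma angleN z : angle (- z) = angle z. Proof. by rewrite /angle enormN. Qed.

Lemma cos_angle_ge0 z : 0 <= cos (angle z).
Proof.
apply: cos_ge0_pihalf; rewrite angle_le andbT (le_trans _ (angle_ge0 _))//.
by rewrite oppr_le0 divr_ge0 ?pi_ge0.
Qed.

Lemma sin_angle_ge0 z : 0 <= sin (angle z).
Proof.
apply: sin_ge0_pi; rewrite angle_ge0 (le_trans (angle_le _))//.
by have := @pi_ge0 R; lra.
Qed.

Lemma angle_triangle x y z : angle (x - z) <= angle (x - y) + angle (y - z).
Proof.
have := enormB_triangle x y z; have := enorm_ge0 (x - y).
have := enorm_ge0 (y - z); have := @pi_ge0 R.
rewrite /angle.
by case: (leP (enorm (x - z)) (pi / 2)); case: (leP (enorm (x - y)) (pi / 2)); case: (leP (enorm (y - z)) (pi / 2)); lra.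
Qed.

Lemma cos_angle_triangle x y z :
  cos (angle (x - y)) * cos (angle (y - z)) - sin (angle (x - y)) * sin (angle (y - z))
    <= cos (angle (x - z)).
Proof.
rewrite -cosD; apply: cos_nincr; rewrite ?angle_ge0 ?angle_triangle//.
by have := angle_le (x - y); have := angle_le (y - z); lra.
Qed.

Lemma cos2N z : cos2 (- z) = cos2 z. Proof. by rewrite /cos2 angleN. Qed.

Lemma cos2BC x y : cos2 (x - y) = cos2 (y - x).
Proof. by rewrite -cos2N opprB. Qed.

Lemma cos2_ge0 z : 0 <= cos2 z. Proof. exact: sqr_ge0. Qed.

Lemma cos2_le1 z : cos2 z <= 1.
Proof. by rewrite expr_le1// ?cos_le1// cos_angle_ge0. Qed.

Lemma cos2_near z : enorm z < pi / 2 -> cos2 z = cos (enorm z) ^+ 2.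
Proof. by move=> z2; rewrite /cos2 /angle min_l// ltW. Qed.

Lemma cos2_far z : pi / 2 <= enorm z -> cos2 z = 0.
Proof. by move=> z2; rewrite /cos2 /angle min_r// cos_pihalf expr0n. Qed.

Lemma cos2_gt0 z : enorm z < pi / 2 -> 0 < cos2 z.
Proof.
move=> z2; rewrite cos2_near// exprn_gt0// cos_gt0_pihalf// z2 andbT.
by rewrite (lt_le_trans _ (enorm_ge0 _))// oppr_lt0 divr_gt0 ?pi_gt0.
Qed.

Lemma cos2_lipschitz z w : `|cos2 z - cos2 w| <= enorm (z - w).
Proof.
apply: le_trans (sqr_cos_lipschitz _ _) (le_trans _ (enorm_lipschitz z w)).
rewrite /angle !ler_norml.
have [zw|zw] := leP (enorm w) (enorm z).
  by rewrite ger0_norm ?subr_ge0//; case: (leP (enorm z) (pi / 2)) => ?; case: (leP (enorm w) (pi / 2)) => ?; apply/andP; split; lra.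
by rewrite ltr0_norm ?subr_lt0//; case: (leP (enorm z) (pi / 2)) => ?; case: (leP (enorm w) (pi / 2)) => ?; apply/andP; split; lra.
Qed.

(** Inside the ball of radius [pi / 2] the gradient of [cos2] is [- 2 *: sincos]. *)
Definition sincos z : 'rV[R]_d := (sin (enorm z) * cos (enorm z) / enorm z) *: z.

Lemma enorm_second_order z h : z != 0 ->
  enorm (z + h) <= enorm z + dot z h / enorm z + enorm h ^+ 2 / (2 * enorm z).
Proof.
rewrite -enorm_gt0 => z0.
rewrite -(@ler_pM2l _ (2 * enorm z)) ?mulr_gt0//.
rewrite (_ : 2 * enorm z * (_ + _ + _) =
    2 * enorm z ^+ 2 + 2 * dot z h + enorm h ^+ 2); last first.
  by field; rewrite gt_eqF.
have : enorm (z + h) ^+ 2 = enorm z ^+ 2 + 2 * dot z h + enorm h ^+ 2.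
  by rewrite !sqr_enorm dotDl !dotDr (dotC h z); ring.
have := sqr_ge0 (enorm (z + h) - enorm z); rewrite sqrrB; lra.
Qed.

(** Only a lower bound is needed, so an upper second-order bound for the norm suffices. The constant
    4 is 2 from the squared cosine plus 2 from the curvature of the norm. *)
Lemma cos2_taylor z h : enorm z < pi / 2 ->
  cos2 z - 2 * dot (sincos z) h - 4 * enorm h ^+ 2 <= cos2 (z + h).
Proof.
move=> z2; rewrite (cos2_near z2).
set r := enorm z; set r' := enorm (z + h).
have r0 : 0 <= r by exact: enorm_ge0.
have sr : 0 <= sin r * cos r.
  rewrite mulr_ge0//; first by apply: sin_ge0_pi; have := @pi_ge0 R; rewrite r0 /r/=; lra.
  apply: cos_ge0_pihalf; rewrite (ltW z2) andbT (le_trans _ r0)// oppr_le0.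
  by rewrite divr_ge0 ?pi_ge0.
have rr : `|r' - r| <= enorm h.
  by have := enorm_lipschitz (z + h) z; rewrite addrAC subrr add0r.
have rr2 : (r' - r) ^+ 2 <= enorm h ^+ 2.
  by rewrite -[leLHS]real_normK ?num_real// ler_sqr ?nnegrE ?enorm_ge0.
have key : sin r * cos r * (r' - r) <= dot (sincos z) h + enorm h ^+ 2.
  have [z0|z0] := eqVneq z 0.
    rewrite /r z0 enorm0 sin0 !mul0r /sincos enorm0 invr0 mulr0 scale0r dot0l.
    by rewrite add0r sqr_ge0.
  rewrite dotZl -/r.
  have rgt0 : 0 < r by rewrite enorm_gt0.
  have /= h1 := enorm_second_order h z0; rewrite -/r -/r' in h1.
  apply: le_trans (_ : sin r * cos r * (dot z h / r + enorm h ^+ 2 / (2 * r)) <= _).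
    by rewrite ler_wpM2l//; lra.
  rewrite mulrDr mulrA mulrAC lerD2l.
  (* The curvature of the norm is singular like [1 / r]; the factor [sin r <= r] absorbs it. *)
  rewrite mulrA ler_pdivrMr ?mulr_gt0// mulrC ler_wpM2l ?sqr_ge0//.
  apply: le_trans (_ : r * 1 <= _); last by lra.
  by apply: ler_pM => //; rewrite ?sin_le_id ?cos_le1//;
    [apply: sin_ge0_pi; have := @pi_ge0 R; rewrite r0 /r/=; lra|
     apply: cos_ge0_pihalf; have := @pi_ge0 R; rewrite /r; move: z2 r0; rewrite /r; lra].
have taylor := sqr_cos_taylor r r'.
have [r'2|r'2] := ltP r' (pi / 2).
  rewrite (cos2_near r'2) -/r'; apply: le_trans taylor.
  by move: key rr2; rewrite -!mulrA; lra.
(* Beyond the cutoff the expansion is taken at [pi / 2], where the value is also 0; replacing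
   [pi / 2] by the larger [r'] only lowers the bound. *)
rewrite (cos2_far r'2).
have := sqr_cos_taylor r (pi / 2); rewrite cos_pihalf expr0n/=.
have : (pi / 2 - r) ^+ 2 <= (r' - r) ^+ 2.
  by rewrite ler_sqr ?nnegrE ?subr_ge0 ?(le_trans (ltW z2))// lerD2r.
have : sin r * cos r * (pi / 2 - r) <= sin r * cos r * (r' - r).
  by rewrite ler_wpM2l// lerD2r.
by move: key rr2; rewrite -!(mulrA 2); lra.
Qed.

Lemma vatanZ k p : vatan (k *: p) = (atan (k * enorm p) / enorm p) *: p.
Proof.
have [->|p0] := eqVneq p 0; first by rewrite /vatan !scaler0.
have [->|k0] := eqVneq k 0.
  by rewrite mul0r atan0 mul0r !scale0r /vatan scaler0.
rewrite /vatan scalerA enormZ; congr (_ *: _).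
have np : enorm p != 0 by rewrite enorm_eq0.
have nk : `|k| != 0 by rewrite normr_eq0.
have [k_gt0|k_lt0] := leP 0 k.
  by rewrite ger0_norm//; field; rewrite np k0.
by rewrite ltr0_norm// mulNr atanN; field; rewrite np k0.
Qed.

Lemma vatan0 : vatan (0 : 'rV[R]_d) = 0. Proof. by rewrite /vatan scaler0. Qed.

Lemma enorm_vatan z : enorm (vatan z) = atan (enorm z).
Proof.
have [->|z0] := eqVneq z 0; first by rewrite vatan0 enorm0 atan0.
rewrite enormZ ger0_norm ?divr_ge0 ?atan_ge0 ?enorm_ge0//.
by rewrite divfK// enorm_eq0.
Qed.

Lemma enorm_vatanZB k (l : R) p :
  enorm (vatan (k *: p) - vatan (l *: p)) = `|atan (k * enorm p) - atan (l * enorm p)|.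
Proof.
rewrite !vatanZ -scalerBl enormZ -mulrBl normrM normfV.
have [->|p0] := eqVneq p 0.
  by rewrite enorm0 !mulr0 subrr normr0.
by rewrite (ger0_norm (enorm_ge0 p)) divfK// enorm_eq0.
Qed.

(** The squared distance splits into a radial part and [2 (|u| |v| - u . v)]. [atan] contracts the
    first, and the second is multiplied by [atan |u| / |u|] and [atan |v| / |v|], both at most 1. *)
Lemma vatan_lipschitz u v : enorm (vatan u - vatan v) <= enorm (u - v).
Proof.
rewrite -(@ler_pXn2r _ 2) ?nnegrE ?enorm_ge0//.
have E x y : enorm (x - y) ^+ 2 =
    (enorm x - enorm y) ^+ 2 + 2 * (enorm x * enorm y - dot x y).
  by rewrite sqrrB !sqr_enorm !(dotBl, dotBr) (dotC y x); ring.
rewrite !E !enorm_vatan dotZl dotZr lerD//.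
  rewrite -[leLHS]real_normK ?num_real// -[leRHS]real_normK ?num_real//.
  by rewrite ler_sqr ?nnegrE// atan_lipschitz.
rewrite ler_pM2l//.
have [->|u0] := eqVneq u 0; first by rewrite dot0l enorm0 atan0 !mul0r subrr.
have [->|v0] := eqVneq v 0.
  by rewrite dotC dot0l enorm0 atan0 !mulr0 subrr.
rewrite -enorm_gt0 in u0; rewrite -enorm_gt0 in v0.
have := dot_le u v.
set a := enorm u; set b := enorm v; set c := dot u v => cab.
have -> : atan a * atan b - atan a / a * (atan b / b * c)
    = (atan a * atan b) / (a * b) * (a * b - c).
  by field; rewrite !gt_eqF.
rewrite ler_piMl ?subr_ge0// ler_pdivrMr ?mulr_gt0// mul1r.
by rewrite ler_pM ?atan_ge0 ?atan_le_id ?ltW.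
Qed.

Lemma vatan_tan z : enorm z < pi / 2 ->
  vatan ((cos (enorm z) ^+ 2)^-1 *: sincos z) = z.
Proof.
move=> z2; have [->|z0] := eqVneq z 0.
  by rewrite /sincos !scaler0 vatan0.
have nz : enorm z != 0 by rewrite enorm_eq0.
have cz : cos (enorm z) != 0.
  by have := cos2_gt0 z2; rewrite cos2_near// exprn_even_gt0.
rewrite scalerA vatanZ.
have -> : (cos (enorm z) ^+ 2)^-1 * (sin (enorm z) * cos (enorm z) / enorm z) * enorm z
   = tan (enorm z) by rewrite /tan; field; rewrite nz cz.
rewrite tanK ?mulfV ?scale1r// in_itv/= z2 andbT.
by rewrite (lt_le_trans _ (enorm_ge0 z))// oppr_lt0 divr_gt0 ?pi_gt0.
Qed.

End euclidean_space.

(** * Weighted images of measures *)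

Section weighted_image.
Context d1 d2 (X : measurableType d1) (Y : measurableType d2) (R : realType).
Variables (mu : {measure set X -> \bar R}) (D : set X) (T : X -> Y) (w : X -> \bar R).
Hypotheses (mD : measurable D) (mT : measurable_fun D T) (mw : measurable_fun D w).
Hypothesis w0 : forall x, D x -> (0 <= w x)%E.
Local Open Scope ereal_scope.

Let mDT A : measurable A -> measurable (D `&` T @^-1` A).
Proof. by move=> mA; exact: mT. Qed.

Definition weighted_image (A : set Y) : \bar R :=
  \int[mu]_(x in D `&` T @^-1` A) w x.

Let weighted_image0 : weighted_image set0 = 0.
Proof. by rewrite /weighted_image preimage_set0 setI0 integral_set0. Qed.

Let weighted_image_ge0 A : 0 <= weighted_image A.
Proof. by apply: integral_ge0 => x [Dx _]; exact: w0. Qed.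

Let weighted_image_sigma_additive : semi_sigma_additive weighted_image.
Proof.
move=> A mA tA mUA; rewrite /weighted_image preimage_bigcup setI_bigcupr.
rewrite ge0_integral_bigcup//.
- apply: is_cvg_ereal_nneg_natsum_cond => n _ _.
  by apply: integral_ge0 => x [Dx _]; exact: w0.
- by move=> n; exact: mDT.
- apply: measurable_funS mw => //.
  by move=> x [n _ []].
- by move=> x [n _ [Dx _]]; exact: w0.
- apply/trivIsetP => i j _ _ ij; rewrite setIACA setIid -preimage_setI.
  by move/trivIsetP : tA => /(_ i j Logic.I Logic.I ij) ->; rewrite preimage_set0 setI0.
Qed.

HB.instance Definition _ := isMeasure.Build _ _ _ weighted_image
  weighted_image0 weighted_image_ge0 weighted_image_sigma_additive.

Lemma exists_weighted_image : \int[mu]_(x in D) w x < +oo ->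
  exists nu : {finite_measure set Y -> \bar R},
    forall A, measurable A -> nu A = \int[mu]_(x in D `&` T @^-1` A) w x.
Proof.
move=> fin.
have finT : fin_num_fun weighted_image.
  apply: lty_fin_num_fun => /=.
  by rewrite /weighted_image preimage_setT setIT.
pose m1 := Measure_isFinite.Build _ _ _ weighted_image finT.
pose nu : {finite_measure set Y -> \bar R} := HB.pack weighted_image m1.
by exists nu.
Qed.

Import HBNNSimple.

(** Weights may be [+oo], since densities may. For an infinite factor the limit is reached at a
    finite stage: either [e] is identically 0 or it is eventually positive. *)
Let cvg_mul (e : nat -> \bar R) (l c : \bar R) : 0 <= c ->
    nondecreasing_seq e -> (forall n, 0 <= e n) -> e @ \oo --> l ->
  (fun n => e n * c) @ \oo --> l * c.
Proof.
move=> c0 nde e0 el; have [cfin|] := boolP (c \is a fin_num); first exact: cvgeZr.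
rewrite ge0_fin_numE// -leNgt leye_eq => /eqP ->.
have le_l n : e n <= l.
  have <- : ereal_sup (range e) = l.
    by apply: (cvg_unique (@ereal_hausdorff R)) el; exact: ereal_nondecreasing_cvgn.
  by apply: ereal_sup_ubound; exists n.
have [l0|l0] := eqVneq l 0.
  rewrite l0 mul0e (_ : (fun n => _) = cst 0); first exact: cvg_cst.
  apply/funext => n /=; have := le_l n; rewrite l0 => en.
  by have /eqP -> : e n == 0; [rewrite eq_le en e0|rewrite mul0e].
have lgt0 : 0 < l by rewrite lt0e l0 (le_trans (e0 0%N)).
rewrite gt0_muley//; apply: cvg_near_cst.
have : \forall n \near \oo, 0 < e n.
  by apply: (el [set y | 0 < y]); apply: open_nbhs_nbhs; split => //; exact: open_ereal_gt_ereal.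
by apply: filterS => n en; rewrite gt0_muley.
Qed.

(** Both sides are limits along increasing simple functions, for which the identity is linear in the
    values of [nu] on level sets. *)
Lemma integral_weighted_image (nu : {measure set Y -> \bar R}) (f : Y -> \bar R) :
    (forall A, measurable A -> nu A = \int[mu]_(x in D `&` T @^-1` A) w x) ->
    measurable_fun setT f -> (forall y, 0 <= f y) ->
  \int[nu]_y f y = \int[mu]_(x in D) (f (T x) * w x).
Proof.
move=> nuE mf f0.
pose h := nnsfun_approx measurableT mf.
have hf y : (EFin \o h ^~ y) @ \oo --> f y by exact: cvg_nnsfun_approx.
have nd_h y : nondecreasing_seq (EFin \o h ^~ y).
  by move=> m n mn; rewrite lee_fin; exact/lefP/nd_nnsfun_approx.
have mh n : measurable_fun setT (EFin \o h n).
  exact/measurable_EFinP/measurable_funP.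
have mhT n : measurable_fun D (EFin \o h n \o T).
  by apply: (measurable_comp measurableT) => //.
have -> : \int[nu]_y f y = limn (fun n => \int[nu]_y (h n y)%:E).
  under eq_integral => y _ do rewrite -(cvg_lim _ (hf y))//.
  apply: monotone_convergence => //.
  - by move=> n y _ /=; rewrite lee_fin.
  - by move=> y _; exact: nd_h.
have -> : \int[mu]_(x in D) (f (T x) * w x) =
    limn (fun n => \int[mu]_(x in D) ((h n (T x))%:E * w x)).
  rewrite -monotone_convergence//.
  - apply: eq_integral => x /[!inE] Dx; apply/esym/cvg_lim => //.
    apply: cvg_mul; [exact: w0|exact: nd_h| |exact: hf].
    by move=> n; rewrite lee_fin.
  - by move=> n; apply: emeasurable_funM => //; exact: mhT.
  - by move=> n x Dx; rewrite mule_ge0 ?w0// lee_fin.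
  - by move=> x Dx m n mn; rewrite lee_wpmul2r ?w0//; exact: nd_h.
congr (limn _); apply/funext => n.
have mk r : measurable (h n @^-1` [set r]) by exact: measurable_sfunP.
under eq_integral => y _ do rewrite fimfunE -fsumEFin//.
rewrite ge0_integral_fsum//; last 2 first.
- by move=> y; exact/measurable_EFinP/measurable_funM.
- by move=> y x _; rewrite nnfun_muleindic_ge0.
have mind r : measurable_fun D (fun x => (\1_(h n @^-1` [set r]) (T x))%:E : \bar R).
  by apply/measurable_EFinP; apply: (measurable_comp measurableT).
transitivity (\int[mu]_(x in D) (\sum_(y \in range (h n))
    (y * \1_(h n @^-1` [set y]) (T x))%:E * w x)); last first.
  apply: eq_integral => x /[!inE] Dx.
  rewrite -ge0_mule_fsuml => [|y]; last exact: nnfun_muleindic_ge0.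
  by rewrite fsumEFin// -(fimfunE _ (T x)).
rewrite ge0_integral_fsum//; last 2 first.
- move=> r; apply: emeasurable_funM => //.
  by under eq_fun do rewrite EFinM; exact: emeasurable_funM.
- by move=> r x Dx; rewrite mule_ge0 ?w0// nnfun_muleindic_ge0.
apply: eq_fsbigr => r /[!inE] -[y _ <-].
rewrite integralZl_indic_nnsfun// integral_indic// setIT nuE//.
under [RHS]eq_integral do rewrite EFinM -muleA.
rewrite ge0_integralZl//.
- congr (_ * _); rewrite integral_mkcondr; apply: eq_integral => x _.
  rewrite patchE indicE.
  have -> : (x \in T @^-1` (h n @^-1` [set h n y])) = (T x \in h n @^-1` [set h n y]).
    by apply/idP/idP; rewrite !inE.
  by case: ifPn => _; rewrite ?mul1e ?mul0e.
- exact: emeasurable_funM.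
- by move=> x Dx; rewrite mule_ge0 ?w0// lee_fin.
- by rewrite lee_fin.
Qed.

End weighted_image.

(** * Borel measurability in Euclidean space and measures determined by Lipschitz tests *)

Section borel_sets.
Context {R : realType} {d : nat}.

Lemma rV_open_measurable (U : set 'rV[R]_d) : open U -> measurable (U : set (Rd R d)).
Proof. by move=> oU; exact: sub_sigma_algebra. Qed.

Lemma rV_closed_measurable (U : set 'rV[R]_d) :
  closed U -> measurable (U : set (Rd R d)).
Proof. by move=> /closed_openC/rV_open_measurable/measurableC; rewrite setCK. Qed.

Lemma rV_subspace_open_measurable (D : set 'rV[R]_d) (U : set (subspace D)) :
  measurable (D : set (Rd R d)) -> open U -> measurable (D `&` U : set (Rd R d)).
Proof.
move=> mD /open_subspaceP[V oV VD]; rewrite setIC -VD.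
by apply: measurableI => //; exact: rV_open_measurable.
Qed.

Lemma rV_continuous_measurable (D : set 'rV[R]_d) (f : 'rV[R]_d -> R) :
    measurable (D : set (Rd R d)) -> {within D, continuous f} ->
  measurable_fun (D : set (Rd R d)) f.
Proof.
move=> mD /continuousP cf; apply: (measurability _ (RGenOpens.measurableE R)).
move=> _ [_ [a [b ->] <-]]; apply: rV_subspace_open_measurable => //.
exact/cf/interval_open.
Qed.

Lemma rV_continuousT_measurable (f : 'rV[R]_d -> R) :
  continuous f -> measurable_fun [set: Rd R d] f.
Proof. by move=> cf; apply: rV_continuous_measurable => //; exact: continuous_subspaceT. Qed.

Lemma rV_continuous_measurable_rV (D : set 'rV[R]_d) (f : 'rV[R]_d -> 'rV[R]_d) :
    measurable (D : set (Rd R d)) -> {within D, continuous f} ->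
  measurable_fun (D : set (Rd R d)) (f : Rd R d -> Rd R d).
Proof.
move=> mD /continuousP cf.
apply: (@measurability _ _ (Rd R d) (Rd R d) D f (@open 'rV[R]_d)) => //.
move=> _ [A oA <-]; apply: rV_subspace_open_measurable => //.
exact: cf.
Qed.

Lemma rV_lsc_measurable (f : 'rV[R]_d -> \bar R) :
  lower_semicontinuous f -> measurable_fun [set: Rd R d] f.
Proof.
move=> scif; apply: (measurability _ (ErealGenOInfty.measurableE R)).
move=> /= _ [_ [a ->]] <-; apply: measurableI => //; apply: rV_open_measurable.
by rewrite preimage_itvoy; move/lower_semicontinuousP : scif; exact.
Qed.

Lemma rV_coord_measurable (i : 'I_d) :
  measurable_fun [set: Rd R d] (fun x : Rd R d => (x : 'rV[R]_d) 0 i).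
Proof. by apply: rV_continuousT_measurable; exact: coord_continuous. Qed.

Lemma measurable_enormB d' (X : measurableType d') (f g : X -> Rd R d) :
  measurable_fun setT f -> measurable_fun setT g ->
  measurable_fun setT (fun x => enorm ((f x : 'rV[R]_d) - g x)).
Proof.
move=> mf mg.
pose sq x := \sum_(i <- index_enum 'I_d) ((f x : 'rV[R]_d) 0 i - (g x : 'rV[R]_d) 0 i) ^+ 2.
have msq : measurable_fun setT sq.
  apply: measurable_sum => i; apply: measurable_funX.
  by apply: measurable_funB; apply: (measurableT_comp (@rV_coord_measurable i)).
apply: (@eq_measurable_fun _ _ _ _ _ (Num.sqrt \o sq)).
  move=> x _; rewrite /= /sq /enorm; congr Num.sqrt; apply: eq_bigr => i _.
  by rewrite !mxE.
apply: measurableT_comp msq; apply: continuous_measurable_fun.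
exact: sqrt_continuous.
Qed.

Lemma measurable_L1B d' (X : measurableType d') (f g : X -> Rd R d) :
  measurable_fun setT f -> measurable_fun setT g ->
  measurable_fun setT (fun x => L1 ((f x : 'rV[R]_d) - g x)).
Proof.
move=> mf mg; have me := measurable_enormB mf mg.
apply: measurable_fun_ifT.
- exact: (measurable_fun_ltr me (measurable_cst _)).
- apply/measurable_EFinP; apply: measurableT_comp => //.
  apply: measurableT_comp => //; apply: measurableT_comp me.
  by apply: continuous_measurable_fun; exact: continuous_cos.
- exact: measurable_cst.
Qed.

Lemma L1_ge0 (z : 'rV[R]_d) : (0 <= L1 z)%E.
Proof.
rewrite /L1; case: ifP => // _; rewrite lee_fin oppr_ge0.
exact/ln_le0/cos_le1.
Qed.

Definition set_dist (A : set 'rV[R]_d) x : R := inf [set enorm (x - y) | y in A].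

Lemma set_dist_lipschitz (A : set 'rV[R]_d) x y : A !=set0 ->
  `|set_dist A x - set_dist A y| <= enorm (x - y).
Proof.
move=> A0.
have key u v : set_dist A u - enorm (u - v) <= set_dist A v.
  apply: lb_le_inf; first by case: A0 => z Az; exists (enorm (v - z)), z.
  move=> _ [z Az <-]; rewrite lerBlDr; apply: le_trans (_ : enorm (u - z) <= _).
    by apply: ge_inf; [exists 0 => _ [? _ <-]; exact: enorm_ge0|exists z].
  by rewrite [leRHS]addrC enormB_triangle.
have := key x y; have := key y x; rewrite (enormBC y x) => h1 h2.
by rewrite ler_norml; apply/andP; split; lra.
Qed.

Lemma set_dist_ge0 (A : set 'rV[R]_d) x : A !=set0 -> 0 <= set_dist A x.
Proof.
case=> z Az; apply: lb_le_inf; first by exists (enorm (x - z)), z.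
by move=> _ [y _ <-]; exact: enorm_ge0.
Qed.

Lemma set_dist_gt0 (U : set 'rV[R]_d) x : open U -> ~` U !=set0 ->
  U x -> 0 < set_dist (~` U) x.
Proof.
move=> oU [z Uz] Ux.
have /nbhs_enorm[e e0 eU] : nbhs x U by apply: open_nbhs_nbhs.
apply: lt_le_trans e0 _; apply: lb_le_inf; first by exists (enorm (x - z)), z.
move=> _ [y Uy <-]; rewrite leNgt; apply/negP => xy.
by apply: Uy; apply: eU; rewrite enormBC.
Qed.

Lemma set_dist_eq0 (A : set 'rV[R]_d) x : A x -> set_dist A x = 0.
Proof.
move=> Ax; apply/eqP; rewrite eq_le set_dist_ge0 ?andbT; last by exists x.
by apply: ge_inf; [exists 0 => _ [? _ <-]; exact: enorm_ge0|exists x => //; rewrite subrr enorm0].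
Qed.

Lemma finite_measure_unique_lipschitz (m1 m2 : fmeas R d) :
    (forall (g : 'rV[R]_d -> R) L, (forall x, 0 <= g x <= 1) ->
      (forall x y, `|g x - g y| <= L * enorm (x - y)) ->
      (\int[m1]_x (g x)%:E = \int[m2]_x (g x)%:E)%E) ->
  forall A : set (Rd R d), measurable A -> m1 A = m2 A.
Proof.
move=> gE A mA.
apply: (@measure_unique _ R (Rd R d) (@open 'rV[R]_d) (fun=> setT) erefl _ _ _ m1 m2 _ _ A mA) => //.
- exact: openI.
- by move=> _; exact: openT.
- by apply/seteqP; split => // x _; exists 0%N.
- move=> U oU.
  have mU := rV_open_measurable oU.
  have indE (m : fmeas R d) : m U = (\int[m]_x (\1_U x)%:E)%E.
    by rewrite integral_indic// setIT.
  (* The whole space has no complement to measure a distance from; its indicator is itself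
     Lipschitz. *)
  have [UT|/set0P U0] := eqVneq (~` U) set0.
    apply: (eq_trans (indE m1)); apply: (eq_trans _ (esym (indE m2))); apply: (gE _ 0).
      by move=> x; rewrite indicE; case: (_ \in _); rewrite ?lexx ?ler01.
    have -> : U = setT by rewrite -(setCK U) UT setC0.
    by move=> x y; rewrite !indicE !in_setT subrr normr0 mul0r.
  pose g (n : nat) x := Num.min 1 (n%:R * set_dist (~` U) x).
  have glip n x y : `|g n x - g n y| <= n%:R * enorm (x - y).
    have : `|n%:R * set_dist (~` U) x - n%:R * set_dist (~` U) y|
        <= n%:R * enorm (x - y).
      by rewrite -mulrBr normrM normr_nat ler_wpM2l// set_dist_lipschitz.
    rewrite /g; move: (n%:R * set_dist _ x) (n%:R * set_dist _ y) => a b.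
    have := enorm_ge0 (x - y); have : 0 <= n%:R :> R by [].
    rewrite !ler_norml => _ _ /andP[h1 h2].
    by case: (leP 1 a) => ?; case: (leP 1 b) => ?; apply/andP; split; lra.
  have g01 n x : 0 <= g n x <= 1.
    by rewrite le_min ler01 mulr_ge0 ?set_dist_ge0//= ge_min lexx.
  have mg n : measurable_fun [set: Rd R d] (EFin \o g n).
    apply/measurable_EFinP; apply: rV_continuousT_measurable.
    exact: enorm_lipschitz_continuous (glip n).
  have limE (m : fmeas R d) :
      m U = limn (fun n => \int[m]_x (g n x)%:E)%E.
    rewrite indE -monotone_convergence//.
    - apply: eq_integral => x _; apply/esym/cvg_lim => //.
      apply: cvg_near_cst; rewrite indicE.
      have [xU|xU] := boolP (x \in U).
        have d0 : 0 < set_dist (~` U) x.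
          by apply: set_dist_gt0 => //; rewrite inE in xU.
        near=> k; rewrite /g min_l//= -ler_pdivrMr//.
        by near: k; exact: nbhs_infty_ger.
      near=> k; rewrite /g set_dist_eq0 ?mulr0 ?min_r//.
      by move: xU; rewrite notin_setE.
    - by move=> k x _; rewrite lee_fin; case/andP: (g01 k x).
    - move=> x _ k m' km; rewrite lee_fin /g le_min ge_min lexx/= ge_min.
      by rewrite ler_wpM2r ?set_dist_ge0 ?ler_nat ?orbT.
  apply: (eq_trans (limE m1)); apply: (eq_trans _ (esym (limE m2))).
  congr (limn _); apply/funext => n.
  exact: gE (g01 n) (glip n).
- by move=> _; rewrite ltey_eq fin_num_measure.
Unshelve. all: by end_near. Qed.

End borel_sets.

(** * Weak duality *)

Section weak_duality.
Context {R : realType} {d : nat}.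
Implicit Types (mu : fmeas R d).
Local Notation Pl := {finite_measure set (Rd R d * Rd R d)%type -> \bar R}.

Lemma F_ge0 (s : R) : 0 <= s -> 0 <= F s.
Proof.
rewrite le_eqVlt => /predU1P[<-|s0]; first by rewrite /F mul0r subrr add0r.
have := @ln_sublinear R s^-1; rewrite invr_gt0 lnV// => /(_ s0) h.
have := @le_ln1Dx R (s^-1 - 1); rewrite addrCA subrr addr0 lnV// ltrBrDl subrr invr_gt0 => /(_ s0) h1.
have : s * (s^-1 - 1 + ln s) >= 0 by rewrite mulr_ge0 ?(ltW s0)//; lra.
rewrite mulrDr mulrBr mulfV ?gt_eqF// /F; lra.
Qed.

(** This is [0 <= a * F (s / a)] written out, with equality at [s = a]. *)
Lemma F_fenchel (s a : R) : 0 <= s -> 0 < a -> 1 + s * ln a <= F s + a.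
Proof.
move=> s0 a0; have : 0 <= a * F (s / a).
  by rewrite mulr_ge0 ?F_ge0 ?divr_ge0 ?(ltW a0).
move: s0; rewrite le_eqVlt => /predU1P[<-|s0]; first by rewrite /F !mul0r; lra.
rewrite /F ln_div//.
have -> : a * (s / a * (ln s - ln a) - s / a + 1) = s * (ln s - ln a) - s + a.
  by field; rewrite gt_eqF.
by lra.
Qed.

Lemma measurable_F : measurable_fun [set: R] F.
Proof.
apply: measurable_funD => //; apply: measurable_funB => //; exact: measurable_funM.
Qed.

(** The measure [nu] in the proof is represented twice: as the image of [eta] under [p] with weight
    1, and as the image of [mu] under the identity with weight [s]. *)
Lemma marginal_image mu (eta : Pl) (p : Rd R d * Rd R d -> Rd R d) s :
    measurable_fun setT p ->
    marginal_density mu s (fun A => eta (p @^-1` A)) ->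
  forall f : 'rV[R]_d -> \bar R, measurable_fun [set: Rd R d] f -> (forall x, 0 <= f x)%E ->
  (\int[eta]_z f (p z) = \int[mu]_x (f x * (s x)%:E))%E.
Proof.
move=> mp [ms s0 sE] f mf f0.
have etaE A : measurable A -> (\int[eta]_(z in setT `&` p @^-1` A) 1 = eta (p @^-1` A))%E.
  move=> mA; rewrite setTI integral_cst ?mul1e//.
  by rewrite -[X in measurable X]setTI; exact: mp.
have [|nu nuE] := @exists_weighted_image _ _ _ _ _ eta setT p (cst 1%E) measurableT mp
    (measurable_cst _) (fun _ _ => lee01).
  by rewrite integral_cst// mul1e ltey_eq fin_num_measure.
transitivity (\int[nu]_x f x)%E.
  rewrite (@integral_weighted_image _ _ _ _ _ eta setT p (cst 1%E) measurableT mp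
    (measurable_cst _) (fun _ _ => lee01) nu f nuE mf f0).
  by under [RHS]eq_integral do rewrite mule1.
rewrite (@integral_weighted_image _ _ _ _ _ mu setT id (EFin \o s) measurableT _ _ _ nu f _ mf f0)//.
- exact/measurable_EFinP.
- by move=> x _; rewrite lee_fin.
- by move=> A mA; apply: (eq_trans (nuE A mA)); rewrite etaE// sE// setTI preimage_id.
Qed.

Lemma marginal_fst mu (eta : Pl) s :
    marginal_density mu s (fun A => eta (A `*` setT)) ->
  marginal_density mu s (fun A => eta (fst @^-1` A)).
Proof.
move=> [? ? sE]; split=> // A /sE <-; congr (eta _).
by apply/seteqP; split => [[x y]|[x y] []].
Qed.

Lemma marginal_snd mu (eta : Pl) s :
    marginal_density mu s (fun A => eta (setT `*` A)) ->
  marginal_density mu s (fun A => eta (snd @^-1` A)).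
Proof.
move=> [? ? sE]; split=> // A /sE <-; congr (eta _).
by apply/seteqP; split => [[x y]|[x y] []].
Qed.

(** The shift [k] makes the logarithm nonnegative, so that all integrals can be added without
    integrability conditions. *)
Lemma entropy_fenchel mu (eta : Pl) (p : Rd R d * Rd R d -> Rd R d) s (a : 'rV[R]_d -> R) k :
    measurable_fun setT p ->
    marginal_density mu s (fun A => eta (p @^-1` A)) ->
    measurable_fun [set: Rd R d] a -> (forall x, 0 < a x) -> (forall x, 0 <= ln (a x) + k) ->
    0 <= k ->
  (mu setT + \int[eta]_z (ln (a (p z)) + k)%:E <=
   \int[mu]_x (F (s x))%:E + \int[mu]_x (a x)%:E + k%:E * eta setT)%E.
Proof.
move=> mp ms ma a0 ak k0; have [mes s0 _] := ms.
have mln : measurable_fun [set: Rd R d] (fun x => (ln (a x) + k)%:E : \bar R).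
  apply/measurable_EFinP/measurable_funD => //.
  exact: measurableT_comp.
rewrite (marginal_image mp ms (f := fun x => (ln (a x) + k)%:E))//; last first.
have -> : (k%:E * eta setT = \int[mu]_x (k%:E * (s x)%:E))%E.
  rewrite -(marginal_image mp ms (f := cst k%:E))//.
  by rewrite integral_cst.
have -> : (mu setT = \int[mu]_x 1)%E by rewrite integral_cst// mul1e.
have mes' : measurable_fun [set: Rd R d] (fun x => (s x)%:E : \bar R).
  exact/measurable_EFinP.
have ma' : measurable_fun [set: Rd R d] (fun x => (a x)%:E : \bar R).
  exact/measurable_EFinP.
have mF' : measurable_fun [set: Rd R d] (fun x => (F (s x))%:E : \bar R).
  by apply/measurable_EFinP; apply: (measurableT_comp measurable_F).
rewrite -ge0_integralD//; last 2 first.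
- by move=> x _; rewrite mule_ge0 ?lee_fin.
- exact: emeasurable_funM.
rewrite -ge0_integralD//; last 2 first.
- by move=> x _; rewrite lee_fin F_ge0.
- by move=> x _; rewrite lee_fin ltW.
rewrite -ge0_integralD//; last 4 first.
- by move=> x _; apply: adde_ge0; rewrite lee_fin ?F_ge0// ltW.
- exact: emeasurable_funD.
- by move=> x _; rewrite mule_ge0 ?lee_fin.
- exact: emeasurable_funM.
apply: ge0_le_integral => //.
- by move=> x _; apply: adde_ge0 => //; apply: mule_ge0; rewrite lee_fin.
- by apply: emeasurable_funD => //; exact: emeasurable_funM.
- by apply: emeasurable_funD; [exact: emeasurable_funD|exact: emeasurable_funM].
move=> x _; rewrite -!EFinM -!EFinD lee_fin.
by have := F_fenchel (s0 x) (a0 x); lra.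
Qed.

Definition plan_cost mu0 mu1 (eta : Pl) (s0 s1 : 'rV[R]_d -> R) : \bar R :=
  (\int[mu0]_x (F (s0 x))%:E + \int[mu1]_x (F (s1 x))%:E
    + \int[eta]_z (2%:E * L1 (z.1 - z.2)%R))%E.

Definition admissible mu0 mu1 (eta : Pl) (s0 s1 : 'rV[R]_d -> R) : Prop :=
  marginal_density mu0 s0 (fun A => eta (A `*` setT)) /\
  marginal_density mu1 s1 (fun A => eta (setT `*` A)).

Lemma plan_cost_ge0 mu0 mu1 eta s0 s1 : admissible mu0 mu1 eta s0 s1 ->
  (0 <= plan_cost mu0 mu1 eta s0 s1)%E.
Proof.
move=> [[_ s00 _] [_ s10 _]]; apply: adde_ge0; first apply: adde_ge0.
- by apply: integral_ge0 => x _; rewrite lee_fin F_ge0.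
- by apply: integral_ge0 => x _; rewrite lee_fin F_ge0.
- by apply: integral_ge0 => x _; rewrite mule_ge0 ?lee_fin ?L1_ge0.
Qed.

Lemma ge0_ereal_cases (x : \bar R) : (0 <= x)%E ->
  x = +oo%E \/ exists2 r, 0 <= r & x = r%:E.
Proof. by case: x => [r|_|//]; [rewrite lee_fin; right; exists r|left]. Qed.

(** The Fenchel inequalities of the two marginals are added; the logarithm of the constraint pays
    for the coupling terms with [2 L1]. *)
Lemma weak_duality_bounded mu0 mu1 eta s0 s1 (a b : 'rV[R]_d -> R) c M :
    admissible mu0 mu1 eta s0 s1 ->
    measurable_fun [set: Rd R d] a -> measurable_fun [set: Rd R d] b ->
    0 < c -> (forall x, c <= a x <= M) -> (forall x, c <= b x <= M) ->
    (forall x y, cos2 (x - y) <= a x * b y) ->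
  (mu0 setT + mu1 setT <= plan_cost mu0 mu1 eta s0 s1
    + \int[mu0]_x (a x)%:E + \int[mu1]_x (b x)%:E)%E.
Proof.
move=> adm ma mb c0 acM bcM ab.
have cost0 := plan_cost_ge0 adm.
have [/marginal_fst m0 /marginal_snd m1] := adm.
pose k := `|ln c|.
have k0 : 0 <= k by rewrite normr_ge0.
have lnk u : c <= u -> 0 <= ln u + k.
  move=> cu; have : ln c <= ln u by rewrite ler_ln ?posrE// (lt_le_trans c0).
  by have := ler_norm (- ln c); rewrite normrN -/k; lra.
have a0 x : 0 < a x by case/andP: (acM x) => h _; exact: lt_le_trans h.
have b0 x : 0 < b x by case/andP: (bcM x) => h _; exact: lt_le_trans h.
have ak x : 0 <= ln (a x) + k by apply: lnk; case/andP: (acM x).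
have bk x : 0 <= ln (b x) + k by apply: lnk; case/andP: (bcM x).
have := entropy_fenchel measurable_fst m0 ma a0 ak k0.
have := entropy_fenchel measurable_snd m1 mb b0 bk k0.
have mla : measurable_fun setT (fun z : Rd R d * Rd R d => (ln (a z.1) + k)%:E : \bar R).
  apply/measurable_EFinP/measurable_funD => //.
  apply: measurableT_comp => //; exact: (measurableT_comp ma measurable_fst).
have mlb : measurable_fun setT (fun z : Rd R d * Rd R d => (ln (b z.2) + k)%:E : \bar R).
  apply/measurable_EFinP/measurable_funD => //.
  apply: measurableT_comp => //; exact: (measurableT_comp mb measurable_snd).
have mL : measurable_fun setT (fun z : Rd R d * Rd R d =>
    (2%:E * L1 ((z.1 : 'rV[R]_d) - z.2)%R)%E : \bar R).
  by apply: emeasurable_funM => //; exact: (measurable_L1B measurable_fst measurable_snd).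
have L0 (z : Rd R d * Rd R d) : (0 <= 2%:E * L1 ((z.1 : 'rV[R]_d) - z.2)%R)%E.
  by rewrite mule_ge0 ?lee_fin ?L1_ge0.
have : ((2 * k)%:E * eta setT <= \int[eta]_z (2%:E * L1 (z.1 - z.2)%R)
    + \int[eta]_z (ln (a z.1) + k)%:E + \int[eta]_z (ln (b z.2) + k)%:E)%E.
  rewrite -ge0_integralD//; last by move=> z _; rewrite lee_fin.
  rewrite -ge0_integralD//; last 3 first.
  - by move=> z _; rewrite adde_ge0// lee_fin.
  - exact: emeasurable_funD.
  - by move=> z _; rewrite lee_fin.
  rewrite -integral_cst//; apply: ge0_le_integral => //.
  - by move=> z _; rewrite lee_fin mulr_ge0.
  - by apply: emeasurable_funD => //; exact: emeasurable_funD.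
  move=> [x y] _ /=; rewrite /L1; case: ifPn => [xy|_]; last first.
    by rewrite gt0_muley ?lte_fin// !addye// leey.
  rewrite -EFinM -!EFinD lee_fin.
  have /= := ab x y; rewrite cos2_near//.
  have cpos : 0 < cos (enorm (x - y)).
    by have := cos2_gt0 xy; rewrite cos2_near// => /gt_eqF h;
      rewrite lt0r; have := cos_angle_ge0 (x - y); rewrite /angle min_l ?(ltW xy)// => ->;
      rewrite andbT; move: h; rewrite sqrf_eq0 => ->.
  rewrite -ler_ln ?posrE ?mulr_gt0 ?exprn_gt0// lnM ?posrE// lnXn//.
  by rewrite -mulr_natl; lra.
(* The logarithmic terms occur on both sides; the upper bound [M] makes them finite, so they can be
   cancelled. *)
have bnd (f : 'rV[R]_d -> R) (p : Rd R d * Rd R d -> Rd R d) :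
    measurable_fun setT (fun z => (ln (f (p z)) + k)%:E : \bar R) ->
    (forall x, c <= f x <= M) ->
    exists2 e, 0 <= e & (\int[eta]_z (ln (f (p z)) + k)%:E = e%:E)%E.
  move=> mf fcM; have f0 z : 0 <= ln (f (p z)) + k by apply: lnk; case/andP: (fcM (p z)).
  have [|foo|//] := @ge0_ereal_cases (\int[eta]_z (ln (f (p z)) + k)%:E)%E.
    by apply: integral_ge0 => z _; rewrite lee_fin.
  have : (\int[eta]_z (ln (f (p z)) + k)%:E <= \int[eta]_z (ln M + k)%:E)%E.
    apply: ge0_le_integral => //.
    - by move=> z _; rewrite lee_fin.
    - move=> z _; rewrite lee_fin lerD2r ler_ln ?posrE//; case/andP: (fcM (p z)) => // h1 h2.
        exact: lt_le_trans h1.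
      by apply: lt_le_trans c0 (le_trans h1 h2).
  have hf : ((ln M + k)%:E * eta setT)%E \is a fin_num by rewrite fin_numM// fin_num_measure.
  by rewrite foo integral_cst// leye_eq => /eqP h; rewrite h in hf.
have [ea ea0 ->] := bnd a fst mla acM.
have [eb eb0 ->] := bnd b snd mlb bcM.
rewrite /plan_cost.
have [e e0 ->] : exists2 e, 0 <= e & eta setT = e%:E.
  exists (fine (eta setT)); first by rewrite fine_ge0.
  by rewrite fineK// fin_num_measure.
have [e1 _ ->] : exists2 e, 0 <= e & mu0 setT = e%:E.
  exists (fine (mu0 setT)); first by rewrite fine_ge0.
  by rewrite fineK// fin_num_measure.
have [e2 _ ->] : exists2 e, 0 <= e & mu1 setT = e%:E.
  exists (fine (mu1 setT)); first by rewrite fine_ge0.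
  by rewrite fineK// fin_num_measure.
have [_ s00 _] := m0; have [_ s10 _] := m1.
have IF0 : (0 <= \int[mu0]_x (F (s0 x))%:E)%E.
  by apply: integral_ge0 => x _; rewrite lee_fin F_ge0.
have IF1 : (0 <= \int[mu1]_x (F (s1 x))%:E)%E.
  by apply: integral_ge0 => x _; rewrite lee_fin F_ge0.
have Ia : (0 <= \int[mu0]_x (a x)%:E)%E.
  by apply: integral_ge0 => x _; rewrite lee_fin ltW.
have Ib : (0 <= \int[mu1]_x (b x)%:E)%E.
  by apply: integral_ge0 => x _; rewrite lee_fin ltW.
have IL : (0 <= \int[eta]_z (2%:E * L1 ((z.1 : 'rV[R]_d) - z.2)%R))%E.
  by apply: integral_ge0 => z _; exact: L0.
move: IF0 IF1 Ia Ib IL => /ge0_ereal_cases IF0 /ge0_ereal_cases IF1 /ge0_ereal_cases Ia /ge0_ereal_cases Ib /ge0_ereal_cases IL.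
case: IF0 => [->|[r0 ? ->]]; case: IF1 => [->|[r1 ? ->]]; case: IL => [->|[r2 ? ->]];
  case: Ia => [->|[r3 ? ->]]; case: Ib => [->|[r4 ? ->]]; rewrite ?addye ?addey ?leey//.
rewrite -!EFinM -!EFinD !lee_fin; lra.
Qed.


Lemma HKsq_le mu0 mu1 eta s0 s1 : admissible mu0 mu1 eta s0 s1 ->
  (HKsq mu0 mu1 <= plan_cost mu0 mu1 eta s0 s1)%E.
Proof. by move=> [m0 m1]; apply: ereal_inf_lbound; exists eta, s0, s1. Qed.

Lemma le_HKsq mu0 mu1 (c : \bar R) :
    (forall eta s0 s1, admissible mu0 mu1 eta s0 s1 ->
      c <= plan_cost mu0 mu1 eta s0 s1)%E ->
  (c <= HKsq mu0 mu1)%E.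
Proof. by move=> h; apply: le_ereal_inf_tmp => _ [eta [s0 [s1 [m0 m1 ->]]]]; exact: h. Qed.

Lemma HKsq_ge0 mu0 mu1 : (0 <= HKsq mu0 mu1)%E.
Proof. by apply: le_HKsq => eta s0 s1; exact: plan_cost_ge0. Qed.

Lemma HKsq_lty mu0 mu1 : (HKsq mu0 mu1 < +oo)%E.
Proof.
have adm : admissible mu0 mu1 (mzero : Pl) (cst 0) (cst 0).
  by split; split=> // A mA; rewrite integral0.
apply: le_lt_trans (HKsq_le adm) _.
rewrite /plan_cost integral_measure_zero adde0 /F/= mul0r subrr add0r.
by rewrite !integral_cst// !mul1e lte_add_pinfty// ltey_eq fin_num_measure.
Qed.

Lemma HK_sqr mu0 mu1 : (HK mu0 mu1 ^+ 2)%:E = HKsq mu0 mu1.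
Proof.
rewrite sqr_sqrtr ?fine_ge0 ?HKsq_ge0// fineK// ge0_fin_numE ?HKsq_ge0//.
exact: HKsq_lty.
Qed.

(* Clipping [A + e] and [B + e] to [e, e + e^-1] keeps the constraint, since a
   clipped factor is at least [e^-1] and the other one at least [e]. *)
Lemma weak_duality mu0 mu1 (A B : 'rV[R]_d -> \bar R) :
    measurable_fun [set: Rd R d] A -> measurable_fun [set: Rd R d] B ->
    (forall x, 0 <= A x)%E -> (forall x, 0 <= B x)%E ->
    (forall x y, A x = +oo \/ B y = +oo \/ (cos2 (x - y))%:E <= A x * B y)%E ->
  (mu0 setT + mu1 setT <= HKsq mu0 mu1 + \int[mu0]_x A x + \int[mu1]_x B x)%E.
Proof.
move=> mA mB A0 B0 AB.
have IA_ge0 : (0 <= \int[mu0]_x A x)%E by exact: integral_ge0.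
have IB_ge0 : (0 <= \int[mu1]_x B x)%E by exact: integral_ge0.
rewrite -HK_sqr.
have [IAE|[IA IA0 IAE]] := ge0_ereal_cases IA_ge0.
  have : (\int[mu1]_x B x)%E != -oo%E by rewrite -ltNye (lt_le_trans _ IB_ge0).
  by rewrite IAE => h; rewrite addey// addye ?leey.
have [IBE|[IB IB0 IBE]] := ge0_ereal_cases IB_ge0.
  by rewrite IBE IAE addey ?leey.
rewrite IAE IBE -!EFinD.
have [m0 m00 m0E] : exists2 e, 0 <= e & mu0 setT = e%:E.
  exists (fine (mu0 setT)); first by rewrite fine_ge0.
  by rewrite fineK// fin_num_measure.
have [m1 m10 m1E] : exists2 e, 0 <= e & mu1 setT = e%:E.
  exists (fine (mu1 setT)); first by rewrite fine_ge0.
  by rewrite fineK// fin_num_measure.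
have clip e x (f : 'rV[R]_d -> \bar R) : 0 < e -> (0 <= f x)%E ->
    exists r, mine (f x + e%:E) (e + e^-1)%:E = r%:E /\ e <= r <= e + e^-1.
  move=> e0; case: (f x) => [r|_|//].
    rewrite lee_fin => r0; exists (Num.min (r + e) (e + e^-1)); split => //.
      by rewrite -EFin_min.
    by rewrite le_min ge_min lexx orbT andbT lerDr r0 lerDl invr_ge0 ltW.
  exists (e + e^-1); split; first by rewrite addye// min_r// leey.
  by rewrite lexx andbT lerDl invr_ge0 ltW.
suff key e : 0 < e -> m0 + m1 <= HK mu0 mu1 ^+ 2 + IA + IB + e * (m0 + m1).
  rewrite m0E m1E -EFinD lee_fin; apply/ler_addgt0Pr => e e0.
  have [m|m] := leP (m0 + m1) 0.
    have := @key 1 ltr01; rewrite mul1r => h; have := sqr_ge0 (HK mu0 mu1).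
    lra.
  have := key _ (divr_gt0 e0 m); rewrite divfK// gt_eqF//.
move=> e0.
pose cl (f : 'rV[R]_d -> \bar R) x := fine (mine (f x + e%:E) (e + e^-1)%:E).
have clE (f : 'rV[R]_d -> \bar R) x : (0 <= f x)%E ->
    (cl f x)%:E = mine (f x + e%:E) (e + e^-1)%:E.
  by move=> fx; rewrite /cl; have [r [-> _]] := clip e x f e0 fx.
have clb (f : 'rV[R]_d -> \bar R) x : (0 <= f x)%E -> e <= cl f x <= e + e^-1.
  by move=> fx; rewrite /cl; have [r [-> ]] := clip e x f e0 fx.
have mcl (f : 'rV[R]_d -> \bar R) : measurable_fun [set: Rd R d] f -> measurable_fun [set: Rd R d] (cl f).
  move=> mf; apply: measurableT_comp => //.
  by apply: measurable_mine => //; apply: emeasurable_funD.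
have ei : 0 < e^-1 by rewrite invr_gt0.
have clAB x y : cos2 (x - y) <= cl A x * cl B y.
  have /andP[Ae _] := clb A x (A0 x); have /andP[Be _] := clb B y (B0 y).
  have far (a b : R) : e <= a -> e + e^-1 <= b -> cos2 (x - y) <= a * b.
    move=> ae be; apply: le_trans (cos2_le1 _) _.
    apply: le_trans (_ : e * (e^-1) <= _); first by rewrite mulfV ?gt_eqF.
    by rewrite ler_pM// ?ltW//; lra.
  have [hA|hA] := leP (e + e^-1) (cl A x); first by rewrite mulrC far.
  have [hB|hB] := leP (e + e^-1) (cl B y); first by rewrite far.
  have nc (f : 'rV[R]_d -> \bar R) z : (0 <= f z)%E -> cl f z < e + e^-1 ->
      f z = (cl f z - e)%:E.
    move=> fz; rewrite -lte_fin clE// gt_min ltxx orbF => h.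
    have := clE f z fz; rewrite min_l ?(ltW h)//.
    by case: (f z) h fz => [r|//|//] _ _ [->]; rewrite addrK.
  have := AB x y; rewrite (nc A x)// (nc B y)//.
  case=> [//|[//|]]; rewrite -EFinM lee_fin => h; apply: le_trans h _.
  have := clb A x (A0 x); have := clb B y (B0 y).
  by rewrite mulrBl mulrBr => /andP[? _] /andP[? _]; nra.
have IclE (m : fmeas R d) (f : 'rV[R]_d -> \bar R) : measurable_fun [set: Rd R d] f ->
    (forall x, 0 <= f x)%E ->
    (\int[m]_x (cl f x)%:E <= \int[m]_x f x + e%:E * m setT)%E.
  move=> mf f0; rewrite -integral_cst// -ge0_integralD//; last by move=> x _; rewrite lee_fin ltW.
  apply: ge0_le_integral => //.
  - by move=> x _; case/andP: (clb f x (f0 x)) => h _; rewrite lee_fin (le_trans (ltW e0)).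
  - by apply/measurable_EFinP; exact: mcl mf.
  - exact: emeasurable_funD.
  - by move=> x _; rewrite clE// ge_min lexx.
suff : (mu0 setT + mu1 setT - (IA + e * m0)%:E - (IB + e * m1)%:E <= HKsq mu0 mu1)%E.
  by rewrite m0E m1E -HK_sqr -!EFinB lee_fin; lra.
apply: le_HKsq => eta s0 s1 adm.
rewrite !leeBlDr//; apply: le_trans
  (weak_duality_bounded adm (mcl _ mA) (mcl _ mB) e0 (fun x => clb A x (A0 x)) (fun x => clb B x (B0 x)) clAB) _.
have := IclE mu1 B mB B0; have := IclE mu0 A mA A0.
rewrite IAE IBE m0E m1E -!EFinM -!EFinD => h0 h1.
move: (plan_cost _ _ _ _ _) => c.
by rewrite [leRHS]addeAC; apply: leeD => //; apply: leeD.
Qed.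

End weak_duality.

(** * Potentials and their contact set *)

Section hopf_lax.
Context {R : realType} {d : nat}.
Implicit Types (x y : 'rV[R]_d) (a b : 'rV[R]_d -> \bar R) (s t r : R).

(** The value 0 at [+oo] is the limit of the formula, so a point with [a y = +oo] contributes
    nothing to the supremum below. *)
Definition weight s (c : \bar R) : R := if c is r%:E then (1 - s + s * r)^-1 else 0.

(* For [a = exp (2 phi0)] this is [1 - 2 s xi_s], and for [a = exp (- 2 phi1)] and
   [1 - s] instead of [s] it is [1 + 2 (1 - s) xibar_s]. *)
Definition hopf_lax a s x : R := sup [set cos2 (x - y) * weight s (a y) | y in setT].

(** Infinite values are listed apart because [+oo * 0 = 0], whereas the original constraint
    [phi1 y <= phi0 x + L1 (y - x)] is vacuous there. *)
Definition dual_pair a b := forall x y,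
  (a x = +oo \/ b y = +oo \/ (cos2 (x - y))%:E <= a x * b y)%E.

Lemma dual_pair_sym a b : dual_pair a b -> dual_pair b a.
Proof.
move=> ab x y; have := ab y x; rewrite cos2BC muleC.
by case=> [->|[->|->]]; [right; left|left|right; right].
Qed.

Lemma weight_bounds s (c : \bar R) : 0 < s < 1 -> (0 <= c)%E ->
  0 <= weight s c <= (1 - s)^-1.
Proof.
move=> /andP[s0 s1]; rewrite -subr_gt0 in s1.
case: c => [r|_|//]/=; last by rewrite lexx invr_ge0 ltW.
rewrite lee_fin => r0.
have h : 0 <= s * r by rewrite mulr_ge0// ltW.
rewrite invr_ge0 addr_ge0 ?(ltW s1)//= lef_pV2 ?posrE//; first by rewrite lerDl.
by rewrite ltr_wpDr.
Qed.

Section one_sided.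
Variables (a : 'rV[R]_d -> \bar R) (s : R).
Hypotheses (a0 : forall x, (0 <= a x)%E) (s01 : 0 < s < 1).

Let s_gt0 : 0 < s. Proof. by case/andP: s01. Qed.
Let s_lt1 : 0 < 1 - s. Proof. by rewrite subr_gt0; case/andP: s01. Qed.

Lemma hopf_lax_arg_bounds x y : 0 <= cos2 (x - y) * weight s (a y) <= (1 - s)^-1.
Proof.
have /andP[w0 w1] := weight_bounds s01 (a0 y).
rewrite mulr_ge0 ?cos2_ge0//= -[leRHS]mul1r ler_pM ?cos2_ge0 ?cos2_le1//.
Qed.

Let hopf_lax_has_sup x : has_sup [set cos2 (x - y) * weight s (a y) | y in setT].
Proof.
split; first by exists (cos2 (x - x) * weight s (a x)), x.
by exists (1 - s)^-1 => _ [y _ <-]; case/andP: (hopf_lax_arg_bounds x y).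
Qed.

Lemma hopf_lax_ub x y : cos2 (x - y) * weight s (a y) <= hopf_lax a s x.
Proof. by apply: ub_le_sup; [case: (hopf_lax_has_sup x)|exists y]. Qed.

Lemma hopf_lax_le x c : (forall y, cos2 (x - y) * weight s (a y) <= c) ->
  hopf_lax a s x <= c.
Proof.
move=> h; apply: ge_sup; first by case: (hopf_lax_has_sup x).
by move=> _ [y _ <-].
Qed.

Lemma hopf_lax_ge0 x : 0 <= hopf_lax a s x.
Proof. by apply: le_trans (hopf_lax_ub x x); case/andP: (hopf_lax_arg_bounds x x). Qed.

Lemma hopf_lax_le_max x : hopf_lax a s x <= (1 - s)^-1.
Proof. by apply: hopf_lax_le => y; case/andP: (hopf_lax_arg_bounds x y). Qed.

Lemma hopf_lax_lipschitz x y :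
  `|hopf_lax a s x - hopf_lax a s y| <= (1 - s)^-1 * enorm (x - y).
Proof.
have key u v : hopf_lax a s u <= hopf_lax a s v + (1 - s)^-1 * enorm (u - v).
  apply: hopf_lax_le => z.
  have /andP[w0 w1] := weight_bounds s01 (a0 z).
  have := hopf_lax_ub v z.
  have := cos2_lipschitz (u - z) (v - z).
  rewrite opprB addrA subrK ler_norml => /andP[_ h].
  have : cos2 (u - z) * weight s (a z) <= (cos2 (v - z) + enorm (u - v)) * weight s (a z).
    by rewrite ler_wpM2r//; lra.
  have : enorm (u - v) * weight s (a z) <= (1 - s)^-1 * enorm (u - v).
    by rewrite mulrC ler_wpM2r ?enorm_ge0.
  by rewrite mulrDl; lra.
have := key x y; have := key y x; rewrite (enormBC y x) => h1 h2.
by rewrite ler_norml; apply/andP; split; lra.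
Qed.

Lemma hopf_lax_continuous : continuous (hopf_lax a s).
Proof. exact: enorm_lipschitz_continuous hopf_lax_lipschitz. Qed.

Hypothesis lsca : lower_semicontinuous a.

(** [cos2] is continuous and [weight] is decreasing in a lower semicontinuous argument. *)
Lemma hopf_lax_arg_usc x y c : cos2 (x - y) * weight s (a y) < c ->
  \forall z \near y, cos2 (x - z) * weight s (a z) < c.
Proof.
move=> fc; have c0 : 0 < c.
  by apply: le_lt_trans fc; case/andP: (hopf_lax_arg_bounds x y).
have near_lt z q : (forall r, a z = r%:E -> q < r) ->
    cos2 (x - z) < c * (1 - s + s * q) -> cos2 (x - z) * weight s (a z) < c.
  case: (a z) (a0 z) => [r|_ _ _|//]; last by rewrite mulr0.
  rewrite lee_fin => r0 /(_ r erefl) qr h /=.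
  have h1 : 0 < 1 - s + s * r by rewrite ltr_wpDr// mulr_ge0// ltW.
  rewrite ltr_pdivrMr//; apply: lt_trans h _.
  by rewrite ltr_pM2l// ltrD2l ltr_pM2l.
(* A real [q] below [a y] turns the strict inequality into an open condition on [z]. For finite
   [a y] it spends half of the slack; for [a y = +oo] the choice [1 / (c s)] already contributes 1,
   which exceeds any [cos2]. *)
have [q [qa qc]] : exists q, (q%:E < a y)%E /\ cos2 (x - y) < c * (1 - s + s * q).
  move: fc (a0 y) => /=; case: (a y) => [r|_ _|//]; last first.
    exists (c * s)^-1; split; first exact: ltry.
    rewrite mulrDr (mulrA c) mulfV ?gt_eqF ?mulr_gt0//.
    have : 0 < c * (1 - s) by rewrite mulr_gt0.
    by have := cos2_le1 (x - y); lra.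
  rewrite lee_fin => + r0 /=.
  have h1 : 0 < 1 - s + s * r by rewrite ltr_wpDr// mulr_ge0// ltW.
  rewrite ltr_pdivrMr// => h.
  pose e := c * (1 - s + s * r) - cos2 (x - y).
  have e0 : 0 < e by rewrite subr_gt0.
  exists (r - e / (2 * (c * s))); split.
    by rewrite lte_fin ltrBlDr ltrDl divr_gt0// !mulr_gt0.
  have -> : c * (1 - s + s * (r - e / (2 * (c * s)))) = c * (1 - s + s * r) - e / 2.
    by field; rewrite !gt_eqF.
  by rewrite /e; lra.
have [V nV Vq] := lsca qa.
have cc : \forall z \near y, cos2 (x - z) < c * (1 - s + s * q).
  have cont : continuous (fun z : 'rV[R]_d => cos2 (x - z)).
    apply: (@enorm_lipschitz_continuous _ _ _ 1) => u v; rewrite mul1r.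
    apply: le_trans (cos2_lipschitz _ _) _.
    by rewrite opprB addrC addrA subrK enormBC.
  exact: (cont y _ (open_nbhs_nbhs (conj (@open_lt _ _) qc))).
near=> z; apply: (near_lt z q); last by near: z.
move=> r ar; rewrite -lte_fin -ar; apply: Vq.
by near: z.
Unshelve. all: by end_near. Qed.

(** A maximizing sequence with positive values stays within distance [pi / 2]; a cluster point is a
    maximizer by upper semicontinuity, and positivity puts it in the open ball. If the supremum is
    0, [x] itself attains it. *)
Lemma hopf_lax_attained x : exists2 y, enorm (x - y) < pi / 2 &
  hopf_lax a s x = cos2 (x - y) * weight s (a y).
Proof.
have pi2 : 0 < pi / 2 :> R by rewrite divr_gt0 ?pi_gt0.
have [M0|M0] := leP (hopf_lax a s x) 0.
  exists x; first by rewrite subrr enorm0.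
  by apply/eqP; rewrite eq_le hopf_lax_ub andbT (le_trans M0)//; case/andP: (hopf_lax_arg_bounds x x).
set M := hopf_lax a s x in M0 *.
have ex (n : nat) : exists y, M - M / n.+1%:R < cos2 (x - y) * weight s (a y).
  have e0 : 0 < M / n.+1%:R by rewrite divr_gt0.
  have [_ [y _ <-] h] := sup_adherent e0 (hopf_lax_has_sup x).
  by exists y.
have [y_ y_P] := choice ex.
pose K := [set y | enorm (y - x) <= pi / 2].
have inK y : 0 < cos2 (x - y) * weight s (a y) -> enorm (x - y) < pi / 2.
  move=> h; rewrite ltNge; apply/negP => h2.
  by rewrite (cos2_far h2) mul0r ltxx in h.
have yK : (y_ @ \oo) K.
  exists 0%N => // n _ /=.
  rewrite /K/= enormBC; apply/ltW/inK; apply: le_lt_trans (y_P n).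
  by rewrite subr_ge0 ler_pdivrMr// ler_peMr ?(ltW M0)// ler1n.
have [y [Ky cy]] := eball_compact (_ : ProperFilter (y_ @ \oo)) yK.
have My : M <= cos2 (x - y) * weight s (a y).
  rewrite leNgt; apply/negP => lt; pose c := (cos2 (x - y) * weight s (a y) + M) / 2.
  have cM : c < M by rewrite /c; lra.
  have /hopf_lax_arg_usc nc : cos2 (x - y) * weight s (a y) < c by rewrite /c; lra.
  have late : (y_ @ \oo) [set z | c < cos2 (x - z) * weight s (a z)].
    have [n nP] : exists n : nat, M / (M - c) <= n%:R.
      exists (Num.truncn (M / (M - c))).+1; apply/ltW.
      exact: truncnS_gt.
    exists n => // k /= nk; apply: le_lt_trans (y_P k).
    rewrite lerBrDl -lerBrDr ler_pdivrMr// -ler_pdivrMl ?subr_gt0//.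
    rewrite mulrC (le_trans nP)// ler_nat.
    exact: leq_trans nk (leqnSn k).
  have [z [zc /= cz]] := cy _ _ late nc.
  by move: (lt_trans zc cz); rewrite ltxx.
exists y; first by apply: inK; exact: lt_le_trans My.
by apply/eqP; rewrite eq_le My hopf_lax_ub.
Qed.

End one_sided.

(** For finite values [r = a x] and [q = b y], with [P = (1 - s) * weight s r] and
    [Q = s * weight (1 - s) q], one has [(1 - P) / P = s r / (1 - s)] and
    [(1 - Q) / Q = (1 - s) q / s]. The claim, which is the determinant hypothesis of
    [cone_midpoint], is then exactly [cos2 (x - y) <= r * q]. *)
Lemma dual_pair_weight a b s x y : (forall x, 0 <= a x)%E -> (forall x, 0 <= b x)%E ->
    dual_pair a b -> 0 < s < 1 ->
  ((1 - s) * weight s (a x)) * (s * weight (1 - s) (b y)) * cos2 (x - y)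
    <= (1 - (1 - s) * weight s (a x)) * (1 - s * weight (1 - s) (b y)).
Proof.
move=> a0 b0 ab s01; have /andP[s0 s1] := s01.
have s1' : 0 < 1 - s < 1 by apply/andP; split; lra.
have /andP[wa0 wa1] := weight_bounds s01 (a0 x).
have /andP[wb0 wb1] := weight_bounds s1' (b0 y).
have hs : 0 < 1 - s by lra.
have Pa : 0 <= 1 - (1 - s) * weight s (a x).
  by rewrite subr_ge0 mulrC -ler_pdivlMr// div1r.
have Pb : 0 <= 1 - s * weight (1 - s) (b y).
  by rewrite subr_ge0 mulrC -ler_pdivlMr// div1r; move: wb1; rewrite opprB addrCA subrr addr0.
move: (ab x y) (a0 x) (b0 y) wa0 wa1 wb0 wb1 Pa Pb.
case: (a x) => [r|_ _ _ _ _ _ _ h1 h2|//] /=; last first.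
  by rewrite !(mulr0, mul0r); exact: mulr_ge0.
case: (b y) => [q|_ _ _ _ _ _ _ h1 h2|//] /=; last first.
  by rewrite !(mulr0, mul0r); exact: mulr_ge0.
rewrite !lee_fin => -[//|[//|]] rq r0 q0 _ _ _ _ _ _.
have sr : 0 <= s * r by rewrite mulr_ge0// ltW.
have sq : 0 <= (1 - s) * q by rewrite mulr_ge0// ltW.
have d1 : 0 < 1 - s + s * r by lra.
have d2 : 0 < s + (1 - s) * q by lra.
have -> : 1 - (1 - s) = s by ring.
have -> : (1 - (1 - s) * (1 - s + s * r)^-1) * (1 - s * (s + (1 - s) * q)^-1)
    = (r * q) * ((1 - s) * s / ((1 - s + s * r) * (s + (1 - s) * q))).
  by field; rewrite !gt_eqF.
have -> : (1 - s) * (1 - s + s * r)^-1 * (s * (s + (1 - s) * q)^-1) * cos2 (x - y)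
    = cos2 (x - y) * ((1 - s) * s / ((1 - s + s * r) * (s + (1 - s) * q))).
  by field; rewrite !gt_eqF.
by rewrite ler_wpM2r// divr_ge0// mulr_ge0// ltW.
Qed.

Section two_sided.
Variables (a b : 'rV[R]_d -> \bar R).
Hypotheses (a0 : forall x, (0 <= a x)%E) (b0 : forall x, (0 <= b x)%E).
Hypothesis ab : dual_pair a b.

(** [cone_midpoint] is applied to one competitor [y] of the first supremum and one competitor [z] of
    the second, with [x] as the point between. *)
Lemma hopf_lax_order s x : 0 < s < 1 ->
  (1 - s) * hopf_lax a s x + s * hopf_lax b (1 - s) x <= 1.
Proof.
move=> s01; have /andP[s0 s1] := s01.
have s1' : 0 < 1 - s < 1 by apply/andP; split; lra.
have hs : 0 < 1 - s by lra.
suff key y z : (1 - s) * (cos2 (x - y) * weight s (a y)) +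
    s * (cos2 (x - z) * weight (1 - s) (b z)) <= 1.
  have : hopf_lax a s x <= (1 - s * hopf_lax b (1 - s) x) / (1 - s).
    apply: hopf_lax_le => // y.
    have : hopf_lax b (1 - s) x <= (1 - (1 - s) * (cos2 (x - y) * weight s (a y))) / s.
      apply: hopf_lax_le => // z; rewrite ler_pdivlMr//.
      by have := key y z; lra.
    by rewrite !ler_pdivlMr//; lra.
  by rewrite ler_pdivlMr//; lra.
have /andP[wa0 wa1] := weight_bounds s01 (a0 y).
have /andP[wb0 wb1] := weight_bounds s1' (b0 z).
have := @cone_midpoint R ((1 - s) * weight s (a y)) (s * weight (1 - s) (b z))
   (angle (x - y)) (angle (x - z)) (cos (angle (y - z))).
rewrite -/(cos2 (x - y)) -/(cos2 (x - z)) -/(cos2 (y - z)) => h.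
suff : (1 - s) * weight s (a y) * cos2 (x - y)
    + s * weight (1 - s) (b z) * cos2 (x - z) <= 1 by lra.
apply: h.
- by rewrite mulr_ge0 ?(ltW hs)//= mulrC -ler_pdivlMr// div1r.
- rewrite mulr_ge0 ?(ltW s0)//= mulrC -ler_pdivlMr// div1r.
  by move: wb1; rewrite opprB addrCA subrr addr0.
- exact: cos_angle_ge0.
- by rewrite -(angleN (x - y)) opprB cos_angle_triangle.
- by rewrite mulr_ge0// cos_angle_ge0.
- by rewrite mulr_ge0// sin_angle_ge0.
- exact: dual_pair_weight.
Qed.

(** This is admissibility of the dual pair between two interior times. Here [y] is the point between
    [x] and a competitor [z] of the second supremum. *)
Lemma hopf_lax_constraint r t x y : 0 < r -> r < t -> t < 1 ->
  (1 - t) * r * cos2 (x - y) <=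
  (t - (t - r) * hopf_lax a r x) * ((1 - r) - (t - r) * hopf_lax b (1 - t) y).
Proof.
move=> r0 rt t1.
have r1 : 0 < 1 - r by lra.
have t1' : 0 < 1 - t by lra.
have tr : 0 < t - r by lra.
have r01 : 0 < r < 1 by apply/andP; split; lra.
have nt01 : 0 < 1 - t < 1 by apply/andP; split; lra.
have nr01 : 0 < 1 - r < 1 by apply/andP; split; lra.
set U := hopf_lax a r x; set V := hopf_lax b (1 - t) y.
have U0 : 0 <= U by exact: hopf_lax_ge0.
have U1 : (1 - r) * U <= 1.
  by rewrite mulrC -ler_pdivlMr// div1r; exact: hopf_lax_le_max.
have dU : 0 < t - (t - r) * U.
  rewrite -(pmulr_rgt0 _ r1) mulrBr mulrCA.
  have : (t - r) * ((1 - r) * U) <= (t - r) * 1 by rewrite ler_pM2l.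
  have : 0 < r * (1 - t) by rewrite mulr_gt0.
  lra.
suff key z : (1 - t) * r * cos2 (x - y) <=
  (t - (t - r) * U) * ((1 - r) - (t - r) * (cos2 (y - z) * weight (1 - t) (b z))).
  have : V <= ((1 - r) - (1 - t) * r * cos2 (x - y) / (t - (t - r) * U)) / (t - r).
    apply: hopf_lax_le => // z; rewrite ler_pdivlMr//.
    have := key z; rewrite [leRHS]mulrC -ler_pdivrMr//; lra.
  rewrite ler_pdivlMr// => h; rewrite [leRHS]mulrC -ler_pdivrMr//; lra.
(* [P] and [Q] are read off from [key]: dividing it by [dP] gives
   [P * cos2 (x - y) + Q * cos2 (y - z) <= 1]. *)
pose P := (1 - t) * r / ((1 - r) * (t - (t - r) * U)).
pose Q := (t - r) / (1 - r) * weight (1 - t) (b z).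
have dP : 0 < (1 - r) * (t - (t - r) * U) by rewrite mulr_gt0.
have nP : 1 - P = (t - r) * (1 - (1 - r) * U) / ((1 - r) * (t - (t - r) * U)).
  by rewrite /P; field; rewrite !gt_eqF.
have P0 : 0 <= P by rewrite /P divr_ge0// ?(ltW dP)// mulr_ge0// ltW.
have P1 : 0 <= 1 - P by rewrite nP divr_ge0 ?(ltW dP)// mulr_ge0 ?(ltW tr)// subr_ge0.
have /andP[w0 w1] := weight_bounds nt01 (b0 z).
have Q0 : 0 <= Q by rewrite /Q mulr_ge0// divr_ge0// ltW.
(* The determinant hypothesis for [P] and [Q] reduces to the order at time [r] and point [x], with
   only the competitor [z] kept on the [b] side. *)
have mid : r * (cos2 (x - z) * weight (1 - r) (b z)) <= 1 - (1 - r) * U.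
  have := hopf_lax_order x r01; rewrite -/U => h.
  have := hopf_lax_ub b0 nr01 x z; rewrite -(ler_pM2l r0); lra.
have PQ : 0 <= 1 - Q /\ P * Q * cos2 (x - z) <= (1 - P) * (1 - Q).
  move: mid w0 w1; rewrite /Q; case: (b z) (b0 z) => [q|_ _ _ _|//]/=; last first.
    by rewrite !mulr0 mul0r subr0 mulr1 ler01.
  rewrite lee_fin => q0.
  have -> : 1 - (1 - r) = r by ring.
  have -> : 1 - (1 - t) = t by ring.
  have d1 : 0 < t + (1 - t) * q by rewrite ltr_pwDl ?mulr_ge0// ?(ltW t1')//; lra.
  have d2 : 0 < r + (1 - r) * q by rewrite ltr_pwDl ?mulr_ge0// ltW.
  move=> mid _ _.
  have nQ : 1 - (t - r) / (1 - r) * (t + (1 - t) * q)^-1 =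
      (1 - t) * (r + (1 - r) * q) / ((1 - r) * (t + (1 - t) * q)).
    by field; rewrite !gt_eqF.
  rewrite nQ; split.
    by rewrite divr_ge0// ltW ?mulr_gt0.
  rewrite nP /P.
  have -> : (1 - t) * r / ((1 - r) * (t - (t - r) * U)) *
      ((t - r) / (1 - r) * (t + (1 - t) * q)^-1) * cos2 (x - z)
    = r * (cos2 (x - z) * (r + (1 - r) * q)^-1) *
      ((1 - t) * (t - r) * (r + (1 - r) * q) /
        ((1 - r) * (t - (t - r) * U) * ((1 - r) * (t + (1 - t) * q)))).
    by field; rewrite !gt_eqF.
  have -> : (t - r) * (1 - (1 - r) * U) / ((1 - r) * (t - (t - r) * U)) *
      ((1 - t) * (r + (1 - r) * q) / ((1 - r) * (t + (1 - t) * q)))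
    = (1 - (1 - r) * U) *
      ((1 - t) * (t - r) * (r + (1 - r) * q) /
        ((1 - r) * (t - (t - r) * U) * ((1 - r) * (t + (1 - t) * q)))).
    by field; rewrite !gt_eqF.
  by rewrite ler_wpM2r// ltW// divr_gt0// !mulr_gt0.
have [Q1 PQ1] := PQ.
have := @cone_midpoint R P Q (angle (x - y)) (angle (y - z)) (cos (angle (x - z))).
rewrite -/(cos2 (x - y)) -/(cos2 (y - z)) -/(cos2 (x - z)) => h.
have {}h : P * cos2 (x - y) + Q * cos2 (y - z) <= 1.
  apply: h => //.
  - by rewrite P0 -subr_ge0.
  - by rewrite Q0 -subr_ge0.
  - exact: cos_angle_ge0.
  - exact: cos_angle_triangle.
  - by rewrite mulr_ge0// cos_angle_ge0.
  - by rewrite mulr_ge0// sin_angle_ge0.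
have : P * cos2 (x - y) <= 1 - Q * cos2 (y - z) by lra.
rewrite -(ler_pM2l dP).
have -> : (1 - r) * (t - (t - r) * U) * (P * cos2 (x - y)) = (1 - t) * r * cos2 (x - y).
  by rewrite /P; field; rewrite !gt_eqF.
have -> // : (1 - r) * (t - (t - r) * U) * (1 - Q * cos2 (y - z)) =
  (t - (t - r) * U) * ((1 - r) - (t - r) * (cos2 (y - z) * weight (1 - t) (b z))).
by rewrite /Q; field; rewrite !gt_eqF.
Qed.

End two_sided.

End hopf_lax.

(** * The potentials [xi] and [xibar] as Hopf-Lax suprema *)

Section potentials_as_hopf_lax.
Context {R : realType} {d : nat}.
Implicit Types (x y : 'rV[R]_d) (phi : 'rV[R]_d -> \bar R) (t : R).

Definition exp2 phi x : \bar R := expeR (2%:E * phi x)%E.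

Definition expN2 phi x : \bar R := expeR (- (2%:E * phi x))%E.

Lemma exp2_ge0 phi x : (0 <= exp2 phi x)%E. Proof. exact: expeR_ge0. Qed.

Lemma expN2_ge0 phi x : (0 <= expN2 phi x)%E. Proof. exact: expeR_ge0. Qed.

Lemma lsc_exp2 phi : lower_semicontinuous phi -> lower_semicontinuous (exp2 phi).
Proof.
move=> lsc x c cx.
have [c_lt0|c_ge0] := ltP c 0.
  exists setT; first exact: filterT.
  by move=> y _; apply: lt_le_trans (exp2_ge0 phi y); rewrite lte_fin.
have [q [qx cq]] : exists q, (q%:E < phi x)%E /\ c <= expR (2 * q).
  move: cx; rewrite /exp2; have [c0|c0] := leP c 0.
    move=> cx; case: (phi x) cx => [r _|_|] /=.
    - by exists (r - 1); rewrite lte_fin ltrBlDr ltrDl ltr01 (le_trans c0)// expR_ge0.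
    - by exists 0; rewrite ltry (le_trans c0)// expR_ge0.
    - by rewrite gt0_muleNy ?lte_fin//= ltNge c_ge0.
  have e2 : expR (2 * (ln c / 2)) = c by rewrite mulrCA mulfV// mulr1 lnK ?posrE.
  case: (phi x) => [r|_|] /=.
  - rewrite lte_fin => h; exists (ln c / 2); rewrite e2; split=> //.
    by rewrite lte_fin ltr_pdivrMr// mulrC -ltr_expR lnK ?posrE.
  - by exists (ln c / 2); rewrite ltry e2.
  - by rewrite gt0_muleNy ?lte_fin//= ltNge c_ge0.
have [V nV Vq] := lsc x q qx; exists V => // y Vy.
apply: le_lt_trans (_ : (expR (2 * q))%:E < _)%E; first by rewrite lee_fin.
rewrite /exp2 -[(expR _)%:E]/(expeR (2 * q)%:E) lte_expeR EFinM lte_pmul2l//.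
exact: Vq.
Qed.

Lemma lsc_expN2 phi : upper_semicontinuous phi -> lower_semicontinuous (expN2 phi).
Proof.
move=> /lsc_exp2; rewrite /exp2 /expN2.
by under eq_fun do rewrite muleN.
Qed.

Lemma xi_term phi t x y : 0 < t < 1 -> enorm (x - y) < pi / 2 ->
  (((2 * t)^-1)%:E * (1 - (cos (enorm (x - y)%R) ^+ 2)%:E / (1 + (2 * t)%:E * xi0 phi y))
   = ((1 - cos2 (x - y) * weight t (exp2 phi y)) / (2 * t))%:E)%E.
Proof.
move=> /andP[t0 t1] xy; rewrite cos2_near// /xi0 -/(exp2 phi y).
have t0' : t != 0 by rewrite gt_eqF.
case: (exp2 phi y) (exp2_ge0 phi y) => [r|_|//]; last first.
  rewrite /= addye// gt0_muley ?lte_fin ?invr_gt0// gt0_muley ?lte_fin ?mulr_gt0//.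
  by rewrite addey// invey mule0 mulr0 !subr0 sube0 mule1 mul1r.
rewrite lee_fin => r0.
have -> : (1 + (2 * t)%:E * ((2^-1)%:E * (r%:E - 1)) =
  (1 + 2 * t * (2^-1 * (r - 1)))%:E)%E by [].
rewrite inver.
have h : 0 < 1 - t + t * r by rewrite ltr_pwDl ?subr_gt0// mulr_ge0// ltW.
have -> : 1 + 2 * t * (2^-1 * (r - 1)) = 1 - t + t * r by field.
by rewrite gt_eqF//; congr (_%:E); rewrite mulrC.
Qed.

(** The infimum over the open ball and the supremum over the whole space agree because the latter is
    attained inside the ball. *)
Lemma xiE phi t x : lower_semicontinuous phi -> 0 < t < 1 ->
  xi phi t x = ((1 - hopf_lax (exp2 phi) t x) / (2 * t))%:E.
Proof.
move=> lsc t01; have /andP[t0 t1] := t01.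
have tt : 0 < (2 * t)^-1 by rewrite invr_gt0 mulr_gt0.
apply/eqP; rewrite eq_le; apply/andP; split.
  have [y xy ->] := hopf_lax_attained (exp2_ge0 phi) t01 (lsc_exp2 lsc) x.
  rewrite -xi_term//; apply: ereal_inf_lbound; exists y => //.
  by rewrite /eball/= enormBC.
apply: le_ereal_inf_tmp => _ [y /= yx <-].
rewrite xi_term//; last by rewrite enormBC.
rewrite lee_fin ler_pM2r// lerD2l lerN2.
exact: (hopf_lax_ub (exp2_ge0 phi) t01).
Qed.

Lemma xibar_term phi t x y : 0 < t < 1 -> enorm (x - y) < pi / 2 ->
  (((2 * (1 - t))^-1)%:E * ((cos (enorm (x - y)%R) ^+ 2)%:E
      / (1 - (2 * (1 - t))%:E * xibar1 phi y) - 1)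
   = ((cos2 (x - y) * weight (1 - t) (expN2 phi y) - 1) / (2 * (1 - t)))%:E)%E.
Proof.
move=> /andP[t0 t1] xy; rewrite cos2_near// /xibar1 -/(expN2 phi y).
have t1' : 0 < 1 - t by rewrite subr_gt0.
have t0' : 1 - t != 0 by rewrite gt_eqF.
case: (expN2 phi y) (expN2_ge0 phi y) => [r|_|//]; last first.
  rewrite /= addeNy// gt0_muleNy ?lte_fin ?invr_gt0// gt0_muleNy ?lte_fin ?mulr_gt0//.
  by rewrite addey// invey mule0 mulr0 !sub0r add0e -EFinM mulrC.
rewrite lee_fin => r0.
have -> : (1 - (2 * (1 - t))%:E * ((2^-1)%:E * (1 - r%:E)) =
  (1 - 2 * (1 - t) * (2^-1 * (1 - r)))%:E)%E by [].
rewrite inver.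
have h : 0 < t + (1 - t) * r by rewrite ltr_pwDl// mulr_ge0// ltW.
have -> : 1 - 2 * (1 - t) * (2^-1 * (1 - r)) = t + (1 - t) * r by field.
by rewrite gt_eqF//; congr (_%:E); rewrite mulrC /= opprB addrCA subrr addr0.
Qed.

Lemma xibarE phi t x : upper_semicontinuous phi -> 0 < t < 1 ->
  xibar phi t x = ((hopf_lax (expN2 phi) (1 - t) x - 1) / (2 * (1 - t)))%:E.
Proof.
move=> usc t01; have /andP[t0 t1] := t01.
have nt01 : 0 < 1 - t < 1 by apply/andP; split; lra.
have tt : 0 < (2 * (1 - t))^-1 by rewrite invr_gt0 mulr_gt0// subr_gt0.
apply/eqP; rewrite eq_le; apply/andP; split.
  apply: ge_ereal_sup => _ [y /= yx <-].
  rewrite xibar_term//; last by rewrite enormBC.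
  rewrite lee_fin ler_pM2r// lerD2r.
  exact: (hopf_lax_ub (expN2_ge0 phi) nt01).
have [y xy ->] := hopf_lax_attained (expN2_ge0 phi) nt01 (lsc_expN2 usc) x.
rewrite -xibar_term//; apply: ereal_sup_ubound; exists y => //.
by rewrite /eball/= enormBC.
Qed.

(** Exponentiating [phi1 y <= phi0 x + L1 (y - x)] gives the product form. An infinite potential
    either makes one of the exponentials [+oo] or contradicts the inequality. *)
Lemma tight_dual_pair (phi0 phi1 : 'rV[R]_d -> \bar R) :
    (forall x1, phi1 x1 =
        ereal_inf [set phi0 x0 + L1 (x1 - x0)%R | x0 in eball x1 (pi / 2)]%E) ->
  dual_pair (exp2 phi0) (expN2 phi1).
Proof.
move=> phi1E x y.
have [xy|xy] := leP (pi / 2) (enorm (x - y)).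
  by right; right; rewrite cos2_far// mule_ge0 ?exp2_ge0 ?expN2_ge0.
have : (phi1 y <= phi0 x + L1 (y - x)%R)%E.
  by rewrite phi1E; apply: ereal_inf_lbound; exists x.
rewrite /L1 (enormBC y x) xy /exp2 /expN2 cos2_near//.
have cpos : 0 < cos (enorm (x - y)).
  apply: cos_gt0_pihalf; rewrite xy andbT (lt_le_trans _ (enorm_ge0 _))//.
  by rewrite oppr_lt0 divr_gt0 ?pi_gt0.
case: (phi0 x) => [p| |]; last 2 first.
- by move=> _; left; rewrite gt0_muley ?lte_fin.
- rewrite addNye leeNy_eq => /eqP ->; right; left.
  by rewrite gt0_muleNy ?lte_fin.
case: (phi1 y) => [q| |]; last 2 first.
- by rewrite -EFinD leye_eq.
- by move=> _; right; left; rewrite gt0_muleNy ?lte_fin.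
rewrite -EFinD lee_fin => h; right; right.
rewrite lee_fin -expRD.
rewrite -[leLHS]lnK ?posrE ?exprn_gt0// ler_expR lnXn// -mulr_natl; lra.
Qed.

End potentials_as_hopf_lax.

(** * Two-sided quadratic expansions and their gradients *)

Section quadratic_expansion.
Context {R : realType} {d : nat}.
Implicit Types (x y p q v h : 'rV[R]_d) (f : 'rV[R]_d -> R) (C : R).

(** The bound is global in [h], so expansions at two distant points can be compared with each
    other. *)
Definition expands f x p C := forall h, `|f (x + h) - f x - dot p h| <= C * enorm h ^+ 2.

(** Test [h = v / (2 k)] with [k = |C| + 1]: the linear term is [|v|^2 / (2 k)] and the quadratic
    one at most half of it. *)
Lemma dot_quadratic_eq0 v C : (forall h, dot v h <= C * enorm h ^+ 2) -> v = 0.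
Proof.
move=> vC; pose k := `|C| + 1.
have k0 : 0 < k by rewrite ltr_wpDl.
have Ck : C <= k by rewrite /k; have := ler_norm C; lra.
have := vC ((2 * k)^-1 *: v).
rewrite dotZr enormZ exprMn -sqr_enorm real_normK ?num_real// => h1.
have : enorm v ^+ 2 <= 0; last first.
  move=> h2; apply/eqP; rewrite -enorm_eq0 -sqrf_eq0.
  by rewrite eq_le h2 sqr_ge0.
have e0 := sqr_ge0 (enorm v).
have : C * ((2 * k)^-1 ^+ 2 * enorm v ^+ 2) <= k * ((2 * k)^-1 ^+ 2 * enorm v ^+ 2).
  by rewrite ler_wpM2r// mulr_ge0// sqr_ge0.
have -> : k * ((2 * k)^-1 ^+ 2 * enorm v ^+ 2) = (2 * k)^-1 * enorm v ^+ 2 / 2.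
  by field; rewrite gt_eqF.
move=> h3; have : (2 * k)^-1 * enorm v ^+ 2 <= 0 by lra.
by rewrite pmulr_rle0// invr_gt0 mulr_gt0.
Qed.

Lemma expands_grad f x p C : expands f x p C -> grad f x = p.
Proof.
move=> fp; apply/rowP => i; rewrite mxE -(dot_delta p i) /derive.
set v := delta_mx 0 i.
apply/cvg_lim => //; apply/cvgrPdist_lt => e e0.
pose k := `|C| * enorm v ^+ 2 + 1.
have k0 : 0 < k by rewrite ltr_wpDl// mulr_ge0// sqr_ge0.
have kC : C * enorm v ^+ 2 < k.
  have : C * enorm v ^+ 2 <= `|C| * enorm v ^+ 2 by rewrite ler_wpM2r ?sqr_ge0// ler_norm.
  by rewrite /k; lra.
near=> t; have t0 : t != 0 by near: t; exact: nbhs_dnbhs_neq.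
rewrite /= -[dot p v](mulKf t0) -dotZr -mulrBr normrM normfV.
rewrite mulrC ltr_pdivrMr ?normr_gt0// distrC (addrC (t *: v)).
apply: le_lt_trans (fp (t *: v)) _.
rewrite enormZ exprMn mulrCA expr2 -mulrA mulrC ltr_pM2r ?normr_gt0//.
apply: le_lt_trans (_ : `|t| * k < _); first by rewrite ler_wpM2l// ltW.
rewrite -ltr_pdivlMr//; near: t.
by apply: dnbhs0_lt; rewrite divr_gt0.
Unshelve. all: by end_near. Qed.

(** Three expansions, one at [x] and two at [y], bound [(P x - P y) . h]. Taking [h] of length
    [|x - y|] along an axis gives [6 = 1 + 4 + 1]; the factor [d] compares the Euclidean with the
    max norm. *)
Lemma expands_lipschitz f (D : set 'rV[R]_d) (P : 'rV[R]_d -> 'rV[R]_d) C :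
    0 <= C -> (forall x, D x -> expands f x (P x) C) ->
  forall x y, D x -> D y -> enorm (P x - P y) <= d%:R * (6 * C) * enorm (x - y).
Proof.
move=> C0 fP x y Dx Dy.
have ineq h : dot (P x - P y) h <=
    C * (enorm h ^+ 2 + enorm (x - y + h) ^+ 2 + enorm (x - y) ^+ 2).
  have := fP _ Dx h; have := fP _ Dy (x - y + h); have := fP _ Dy (x - y).
  have -> : y + (x - y) = x by rewrite addrC subrK.
  have -> : y + (x - y + h) = x + h by rewrite addrA (addrC y) subrK.
  rewrite !dotDr dotBl !ler_norml => /andP[? ?] /andP[? ?] /andP[? ?].
  by rewrite !mulrDr; lra.
have coord (i : 'I_d) k : `|k| = 1 -> k * (P x - P y) 0 i <= 6 * C * enorm (x - y).
  move=> k1; have [->|xy] := eqVneq x y; first by rewrite !subrr mxE enorm0 !mulr0.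
  have xy0 : 0 < enorm (x - y) by rewrite enorm_gt0 subr_eq0.
  have := ineq ((k * enorm (x - y)) *: delta_mx 0 i).
  rewrite dotZr dot_delta.
  have e1 : enorm ((k * enorm (x - y)) *: (delta_mx 0 i : 'rV[R]_d)) = enorm (x - y).
    have d1 : enorm (delta_mx 0 i : 'rV[R]_d) = 1 :> R.
      by apply/eqP; rewrite -sqrp_eq1 ?enorm_ge0// sqr_enorm dot_delta mxE !eqxx.
    by rewrite enormZ d1 mulr1 normrM k1 mul1r (ger0_norm (enorm_ge0 _)).
  have := enormD (x - y) ((k * enorm (x - y)) *: delta_mx 0 i); rewrite e1 => h2.
  have h3 : enorm (x - y + (k * enorm (x - y)) *: delta_mx 0 i) ^+ 2 <= 4 * enorm (x - y) ^+ 2.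
    apply: le_trans (_ : (2 * enorm (x - y)) ^+ 2 <= _); last by rewrite exprMn -natrX.
    by rewrite ler_sqr ?nnegrE ?mulr_ge0 ?enorm_ge0//; lra.
  have h4 := ler_wpM2l C0 h3.
  move=> h5; rewrite -(ler_pM2r xy0).
  by move: h5; rewrite !mulrDr; lra.
have := enorm_le_norm (P x - P y).
have M0 : 0 <= 6 * C * enorm (x - y) by rewrite !mulr_ge0// enorm_ge0.
suff : `|P x - P y| <= 6 * C * enorm (x - y).
  by move=> h1 h2; apply: le_trans h2 _; rewrite -!mulrA ler_wpM2l// !mulrA.
rewrite [leLHS]/Num.norm/= mx_normrE; apply/bigmax_leP; split=> // -[i j] _/=.
rewrite (ord1 i) ler_norml; apply/andP; split.
  by have := coord j (-1); rewrite normrN1 mulN1r => /(_ erefl); lra.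
by have := coord j 1; rewrite normr1 mul1r => /(_ erefl).
Qed.

End quadratic_expansion.

(** * Maximizers of the Hopf-Lax supremum and their first-order condition *)

Section optimal_points.
Context {R : realType} {d : nat}.
Implicit Types (x y p h z : 'rV[R]_d) (a b : 'rV[R]_d -> \bar R) (s t C : R).

(** These are the subtraction formulas for [atan (k |p|)] and [atan (l |p|)]. The hypothesis is the
    inner product of the cone vectors [(1, k p)] and [(1, l p)], so its positivity means an angle
    below [pi / 2]. *)
Lemma vatanB_geometry (k l : R) p : 0 < 1 + k * l * enorm p ^+ 2 ->
  [/\ enorm (vatan (k *: p) - vatan (l *: p)) < pi / 2,
      cos2 (vatan (k *: p) - vatan (l *: p)) = (1 + k * l * enorm p ^+ 2) ^+ 2 /
        ((1 + k ^+ 2 * enorm p ^+ 2) * (1 + l ^+ 2 * enorm p ^+ 2)) &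
      sincos (vatan (k *: p) - vatan (l *: p)) =
        ((1 + k * l * enorm p ^+ 2) * (k - l) /
         ((1 + k ^+ 2 * enorm p ^+ 2) * (1 + l ^+ 2 * enorm p ^+ 2))) *: p].
Proof.
move=> klp; set g := enorm p in klp *.
set u := atan (k * g); set v := atan (l * g).
have dk : 0 < 1 + k ^+ 2 * g ^+ 2 by rewrite ltr_wpDr// mulr_ge0// sqr_ge0.
have dl : 0 < 1 + l ^+ 2 * g ^+ 2 by rewrite ltr_wpDr// mulr_ge0// sqr_ge0.
have ck : cos u ^+ 2 = (1 + k ^+ 2 * g ^+ 2)^-1 by rewrite cos_atan_sqr exprMn.
have cl : cos v ^+ 2 = (1 + l ^+ 2 * g ^+ 2)^-1 by rewrite cos_atan_sqr exprMn.
have cB : cos (u - v) = cos u * cos v * (1 + k * l * g ^+ 2).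
  by rewrite cosB (sin_atan (k * g)) (sin_atan (l * g)) -/u -/v; ring.
have sB : sin (u - v) = cos u * cos v * (k - l) * g.
  by rewrite sinB (sin_atan (k * g)) (sin_atan (l * g)) -/u -/v; ring.
have nE : enorm (vatan (k *: p) - vatan (l *: p)) = `|u - v| by rewrite enorm_vatanZB.
have cpos : 0 < cos (u - v) by rewrite cB !mulr_gt0// cos_atan_gt0.
have uv : `|u - v| < pi / 2.
  rewrite ltNge; apply/negP => h.
  have : cos `|u - v| <= cos (pi / 2).
    apply: cos_nincr => //; first by rewrite divr_ge0 ?pi_ge0.
    rewrite ler_norml; have := atan_gtNpi2 (k * g); have := atan_ltpi2 (k * g).
    have := atan_gtNpi2 (l * g); have := atan_ltpi2 (l * g).
    by rewrite -/u -/v => *; apply/andP; split; lra.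
  by rewrite cos_pihalf cos_norm leNgt cpos.
split; first by rewrite nE.
  rewrite cos2_near ?nE// cos_norm cB !exprMn ck cl.
  by rewrite mulrC invfM.
rewrite /sincos nE cos_norm !vatanZ -/g -/u -/v -scalerBl -mulrBl scalerA.
have [p0|p0] := eqVneq p 0; first by rewrite p0 !scaler0.
have g0 : g != 0 by rewrite /g enorm_eq0.
congr (_ *: _).
have [uv0|uv0] := eqVneq (u - v) 0.
  have : sin (u - v) = 0 by rewrite uv0 sin0.
  rewrite sB => /eqP; rewrite !mulf_eq0 (negbTE g0) orbF.
  rewrite !(gt_eqF (cos_atan_gt0 _))/= => /eqP ->.
  by rewrite uv0 !(mul0r, mulr0).
have -> : sin `|u - v| * cos (u - v) / `|u - v| * ((u - v) / g) =
    sin (u - v) * cos (u - v) / g.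
  have [h|h] := leP 0 (u - v).
    by rewrite ger0_norm//; field; rewrite g0 uv0.
  by rewrite ltr0_norm// sinN; field; rewrite g0 uv0.
rewrite sB cB.
have -> : cos u * cos v * (k - l) * g * (cos u * cos v * (1 + k * l * g ^+ 2)) / g
   = cos u ^+ 2 * cos v ^+ 2 * ((1 + k * l * g ^+ 2) * (k - l)) by field.
by rewrite ck cl; field; rewrite !exprMn !gt_eqF.
Qed.

(** The last clause is the first-order condition in [x]: it makes [p] the gradient of [(1 - cos2 (x
    - y) * weight s (a y)) / (2 s)]. *)
Definition optimal a s x p y :=
  [/\ enorm (x - y) < pi / 2, 0 < weight s (a y),
      hopf_lax a s x = cos2 (x - y) * weight s (a y) &
      s *: p = weight s (a y) *: sincos (x - y)].

(** This is [xi_s], and for [b] and [1 - s] it is [- xibar_s]; time reversal changes the sign of the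
    potential and hence of its gradient. *)
Definition hl_potential a s x : R := (1 - hopf_lax a s x) / (2 * s).

Section one_sided.
Variables (a : 'rV[R]_d -> \bar R) (s : R).
Hypotheses (a0 : forall x, (0 <= a x)%E) (s01 : 0 < s < 1).

Let s_gt0 : 0 < s. Proof. by case/andP: s01. Qed.
Let s_lt1 : 0 < 1 - s. Proof. by rewrite subr_gt0; case/andP: s01. Qed.

(** The maximizer at [x] is kept as a competitor at [x + h]. The constant is [4 / (2 s)] times the
    largest weight [1 / (1 - s)]. *)
Lemma hl_potential_upper x y h : enorm (x - y) < pi / 2 ->
    hopf_lax a s x = cos2 (x - y) * weight s (a y) ->
  hl_potential a s (x + h) <= hl_potential a s x
    + dot (s^-1 *: (weight s (a y) *: sincos (x - y))) h + 2 / (s * (1 - s)) * enorm h ^+ 2.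
Proof.
move=> xy UE; have /andP[w0 w1] := weight_bounds s01 (a0 y).
have := hopf_lax_ub a0 s01 (x + h) y.
have := cos2_taylor h xy; move: (sincos (x - y)) => v taylor.
have : weight s (a y) * (cos2 (x - y) - 2 * dot v h - 4 * enorm h ^+ 2)
   <= weight s (a y) * cos2 (x - y + h).
  by rewrite ler_wpM2l.
have -> : x - y + h = x + h - y by rewrite addrAC.
have : weight s (a y) * (4 * enorm h ^+ 2) <= (1 - s)^-1 * (4 * enorm h ^+ 2).
  by rewrite ler_wpM2r// mulr_ge0// sqr_ge0.
rewrite /hl_potential UE !dotZl => h1 h2 h3.
have h4 : cos2 (x - y) * weight s (a y) - 2 * (weight s (a y) * dot v h)
    - (1 - s)^-1 * (4 * enorm h ^+ 2) <= hopf_lax a s (x + h) by lra.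
have s2 : 0 < 2 * s by rewrite mulr_gt0.
rewrite ler_pdivrMr//.
have -> : ((1 - cos2 (x - y) * weight s (a y)) / (2 * s)
     + s^-1 * (weight s (a y) * dot v h) + 2 / (s * (1 - s)) * enorm h ^+ 2) * (2 * s)
   = 1 - cos2 (x - y) * weight s (a y) + 2 * (weight s (a y) * dot v h)
     + (1 - s)^-1 * (4 * enorm h ^+ 2).
  by field; rewrite !gt_eqF.
by lra.
Qed.

Lemma optimal_of_expands x p y C : expands (hl_potential a s) x p C ->
    enorm (x - y) < pi / 2 -> 0 < weight s (a y) ->
    hopf_lax a s x = cos2 (x - y) * weight s (a y) ->
  optimal a s x p y.
Proof.
move=> xp xy w0 UE; split=> //.
suff -> : p = s^-1 *: (weight s (a y) *: sincos (x - y)).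
  by rewrite scalerA mulfV ?scale1r// gt_eqF.
apply/eqP; rewrite -subr_eq0; apply/eqP.
apply: (@dot_quadratic_eq0 _ _ _ (C + 2 / (s * (1 - s)))) => h.
rewrite dotBl mulrDl.
have := hl_potential_upper h xy UE; have := xp h.
by rewrite ler_norml => /andP[? ?]; lra.
Qed.

Hypothesis lsca : lower_semicontinuous a.

(** Where the supremum is 0 the potential is maximal, so its gradient vanishes; elsewhere the
    maximizer has positive weight. *)
Lemma optimal_cases x p C : expands (hl_potential a s) x p C ->
  (hopf_lax a s x = 0 /\ p = 0) \/ (0 < hopf_lax a s x /\ exists y, optimal a s x p y).
Proof.
move=> xp.
have := hopf_lax_ge0 a0 s01 x; rewrite le_eqVlt => /predU1P[U0|U0]; last first.
  right; split=> //; have [y xy UE] := hopf_lax_attained a0 s01 lsca x.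
  exists y; apply: (optimal_of_expands xp xy _ UE).
  by move: U0; rewrite UE pmulr_rgt0// cos2_gt0.
left; split=> //; apply: (@dot_quadratic_eq0 _ _ _ C) => h.
have : hl_potential a s (x + h) <= hl_potential a s x.
  rewrite /hl_potential -U0 subr0 ler_pM2r ?invr_gt0 ?mulr_gt0// gerBl.
  exact: hopf_lax_ge0.
by have := xp h; rewrite ler_norml => /andP[? ?]; lra.
Qed.

Lemma hl_potential_quadratic_upper x : exists v, forall h,
  hl_potential a s (x + h) <= hl_potential a s x + dot v h + 2 / (s * (1 - s)) * enorm h ^+ 2.
Proof.
have [y xy UE] := hopf_lax_attained a0 s01 lsca x.
by exists (s^-1 *: (weight s (a y) *: sincos (x - y))) => h; exact: hl_potential_upper.
Qed.

End one_sided.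

Section along_geodesic.
Variables (a : 'rV[R]_d -> \bar R) (s : R) (x p y : 'rV[R]_d).
Hypotheses (a0 : forall x, (0 <= a x)%E) (s01 : 0 < s < 1).
Hypothesis opt : optimal a s x p y.

Let s_gt0 : 0 < s. Proof. by case/andP: s01. Qed.
Let s_lt1 : 0 < 1 - s. Proof. by rewrite subr_gt0; case/andP: s01. Qed.
Local Notation U := (hopf_lax a s x).
Local Notation g2 := (enorm p ^+ 2).
Local Notation k := (weight s (a y)).

Let near_y : enorm (x - y) < pi / 2. Proof. by case: opt. Qed.
Let k_gt0 : 0 < k. Proof. by case: opt. Qed.
Let UE : U = cos (enorm (x - y)) ^+ 2 * k.
Proof. by case: opt => xy _ -> _; rewrite cos2_near. Qed.
Let cos_gt0 : 0 < cos (enorm (x - y)).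
Proof.
apply: cos_gt0_pihalf; rewrite near_y andbT (lt_le_trans _ (enorm_ge0 _))//.
by rewrite oppr_lt0 divr_gt0 ?pi_gt0.
Qed.

Lemma optimal_gt0 : 0 < U. Proof. by rewrite UE mulr_gt0// exprn_gt0. Qed.

(** [U] is [k cos^2] and [s p] has length [k sin cos], so by Pythagoras the vector [(U, s p)] has
    squared length [k^2 cos^2]. *)
Lemma optimal_weight : k * U = U ^+ 2 + s ^+ 2 * g2.
Proof.
have : enorm (s *: p) ^+ 2 = enorm (k *: sincos (x - y)) ^+ 2 by case: opt => _ _ _ ->.
rewrite !enormZ !exprMn !real_normK ?num_real// => ->.
have [z0|z0] := eqVneq (enorm (x - y)) 0.
  by rewrite UE z0 sin0 !mul0r expr0n/= mul0r mulr0 addr0 cos0 expr1n mul1r expr2.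
rewrite -exprMn divfK// exprMn sin2cos2 UE; ring.
Qed.

Lemma optimal_point : y = x + vatan ((- (s / U)) *: p).
Proof.
have -> : - (s / U) *: p = - ((cos (enorm (x - y)) ^+ 2)^-1 *: sincos (x - y)).
  rewrite scaleNr mulrC -scalerA; congr (- _); case: opt => _ _ _ ->.
  by rewrite scalerA UE invfM mulfVK ?gt_eqF.
have vatanN z : vatan (- z) = - vatan z by rewrite /vatan enormN scalerN.
by rewrite vatanN vatan_tan// opprB addrC subrK.
Qed.

Lemma optimal_bound : (1 - s) * (U ^+ 2 + s ^+ 2 * g2) <= U.
Proof.
have /andP[_ k1] := weight_bounds s01 (a0 y).
rewrite -optimal_weight mulrA ler_piMl ?(ltW optimal_gt0)//.
by rewrite mulrC -ler_pdivlMr// div1r.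
Qed.

(** The value [a y] is determined by the weight at time [s], hence so is the weight at any time [t].
    The right-hand side is the inner product of the cone points at times 0 and [t]. *)
Lemma optimal_source : exists2 c, 0 <= c & a y = c%:E /\
  forall t, (1 - t + t * c) * (U ^+ 2 + s ^+ 2 * g2)
    = U * ((t - (t - s) * U) / s) - s * (t - s) * g2.
Proof.
have := k_gt0; have := optimal_weight.
case: (a y) (a0 y) => [c|_ _|//] /=; last by rewrite ltxx.
rewrite lee_fin => c0 kU kc; exists c => //; split=> // t.
rewrite invr_gt0 in kc.
have U0 := optimal_gt0.
have -> : s * (t - s) * g2 = (t - s) / s * ((1 - s + s * c)^-1 * U - U ^+ 2).
  by rewrite kU; field; rewrite gt_eqF.
by rewrite -kU; field; rewrite !gt_eqF.
Qed.

(** The maximizer [y] for [x] at time [s] is a competitor for the transported point [xt] at time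
    [t], with value [w / q]; in the contact set this value turns out to be the supremum. *)
Lemma optimal_along t : 0 <= t -> t < 1 -> 
    let A := (t - (t - s) * U) / s in
    let w := U * A - s * (t - s) * g2 in
    let q := A ^+ 2 + (t - s) ^+ 2 * g2 in
    let xt := x + vatan (((t - s) / A) *: p) in
    0 < A ->
  [/\ 0 < w, enorm (xt - y) < pi / 2, 0 < weight t (a y),
      cos2 (xt - y) * weight t (a y) = w / q &
      weight t (a y) *: sincos (xt - y) = (t / q) *: p].
Proof.
move=> t0 t1 A w q xt A0.
have [c c0 [ac cE]] := optimal_source.
have U0 := optimal_gt0.
have q0 : 0 < U ^+ 2 + s ^+ 2 * g2 by rewrite -optimal_weight mulr_gt0.
have dt : 0 < 1 - t + t * c by rewrite ltr_wpDr ?subr_gt0// mulr_ge0.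
have wE : w = (1 - t + t * c) * (U ^+ 2 + s ^+ 2 * g2) by rewrite cE.
have w0 : 0 < w by rewrite wE mulr_gt0.
have qgt0 : 0 < q by rewrite ltr_pwDl ?exprn_gt0// mulr_ge0// sqr_ge0.
have klE : 1 + (t - s) / A * - (s / U) * g2 = w / (A * U).
  by rewrite /w; field; rewrite !gt_eqF.
have xty : xt - y = vatan (((t - s) / A) *: p) - vatan ((- (s / U)) *: p).
  by rewrite {1}optimal_point opprD addrACA subrr add0r.
have [|h1 h2 h3] := @vatanB_geometry ((t - s) / A) (- (s / U)) p.
  by rewrite klE divr_gt0// mulr_gt0.
have wtE : weight t (a y) = (U ^+ 2 + s ^+ 2 * g2) / w.
  by rewrite ac /= wE invfM mulrCA mulfV ?mulr1 ?gt_eqF.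
have e1 : 1 + ((t - s) / A) ^+ 2 * g2 = q / A ^+ 2.
  by rewrite /q; field; rewrite !gt_eqF.
have e2 : 1 + (- (s / U)) ^+ 2 * g2 = (U ^+ 2 + s ^+ 2 * g2) / U ^+ 2.
  by field; rewrite !gt_eqF.
have e3 : (t - s) / A - - (s / U) = t / (A * U).
  have tE : t = (t - s) * U + A * s by rewrite /A divfK ?gt_eqF//; ring.
  by rewrite [in RHS]tE; field; rewrite !gt_eqF.
split=> //.
- by rewrite xty.
- by rewrite ac /= invr_gt0.
- by rewrite xty h2 klE e1 e2 wtE; field; rewrite ?exprMn !gt_eqF.
- rewrite xty h3 klE e1 e2 e3 wtE scalerA; congr (_ *: _); field.
  by rewrite ?exprMn !gt_eqF.
Qed.

End along_geodesic.

End optimal_points.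

(** * The contact set and straight lines on the cone *)

Section contact_set.
Context {R : realType} {d : nat}.
Implicit Types (x y p h z : 'rV[R]_d) (s t r : R).

(* [(cone_re U V t, (t - s) p)] is the straight line through [(1, 0)] at time [s]
   representing the geodesic on the cone; [cone_dot] is the inner product of two
   of its points. *)
Definition cone_re (U V t : R) : R := (1 - t) * U + t * V.

Definition cone_dot (U V : R) s p r t : R :=
  cone_re U V r * cone_re U V t + (r - s) * (t - s) * enorm p ^+ 2.

Definition cone_pt (U V : R) s x p t : 'rV[R]_d :=
  if 0 < cone_re U V t then x + vatan (((t - s) / cone_re U V t) *: p) else x.

Definition contact (a b : 'rV[R]_d -> \bar R) s x : Prop :=
  (1 - s) * hopf_lax a s x + s * hopf_lax b (1 - s) x = 1.

Lemma contact_sym (a b : 'rV[R]_d -> \bar R) s x : contact a b s x -> contact b a (1 - s) x.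
Proof. by rewrite /contact opprB addrCA subrr addr0 addrC. Qed.

Lemma cone_re_sym (U V : R) t : cone_re V U (1 - t) = cone_re U V t.
Proof. by rewrite /cone_re; ring. Qed.

Lemma cone_dot_sym (U V : R) s p r t :
  cone_dot V U (1 - s) (- p) (1 - t) (1 - r) = cone_dot U V s p r t.
Proof. by rewrite /cone_dot !cone_re_sym enormN; ring. Qed.

Lemma cone_pt_sym (U V : R) s x p t :
  cone_pt V U (1 - s) x (- p) (1 - t) = cone_pt U V s x p t.
Proof.
rewrite /cone_pt cone_re_sym; case: ifP => // _.
by rewrite scalerN -scaleNr -mulNr (_ : - (1 - t - (1 - s)) = t - s)//; ring.
Qed.

Lemma cone_dotC (U V : R) s p r t : cone_dot U V s p r t = cone_dot U V s p t r.
Proof. by rewrite /cone_dot; ring. Qed.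

Lemma hopf_lax_lower_along (a : 'rV[R]_d -> \bar R) s x p C t :
    (forall x, 0 <= a x)%E -> lower_semicontinuous a -> 0 < s < 1 -> 0 < t < 1 ->
    expands (hl_potential a s) x p C ->
    let U := hopf_lax a s x in
    let A := (t - (t - s) * U) / s in
    let q := A ^+ 2 + (t - s) ^+ 2 * enorm p ^+ 2 in
    0 < A ->
  (U * A - s * (t - s) * enorm p ^+ 2) / q
    <= hopf_lax a t (x + vatan (((t - s) / A) *: p)).
Proof.
move=> a0 lsca s01 t01 xp U A q A0; have /andP[t0 t1] := t01.
have [[U0 p0]|[U0 [y opt]]] := optimal_cases a0 s01 lsca xp.
  rewrite {1}/U U0 p0 enorm0 mul0r expr0n/= mulr0 subr0 mul0r.
  exact: hopf_lax_ge0.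
have [_ _ _ <- _] := optimal_along a0 s01 opt (ltW t0) t1 A0.
exact: hopf_lax_ub.
Qed.

(* [1 + 2 (t - r) xi_r], with [xi_0] taken from the dual potential when [r = 0] *)
Definition source_factor (a' : 'rV[R]_d -> \bar R) r t y : \bar R :=
  if r == 0 then ((1 - t)%:E + t%:E * a' y)%E
  else ((t - (t - r) * hopf_lax a' r y) / r)%:E.

Section two_potentials.
Variables (a b : 'rV[R]_d -> \bar R).
Hypotheses (a0 : forall x, (0 <= a x)%E) (b0 : forall x, (0 <= b x)%E).
Hypotheses (lsca : lower_semicontinuous a) (lscb : lower_semicontinuous b).
Hypothesis ab : dual_pair a b.

Lemma hl_potential_sum s x : 0 < s < 1 ->
  hl_potential a s x + hl_potential b (1 - s) x =
  (1 - ((1 - s) * hopf_lax a s x + s * hopf_lax b (1 - s) x)) / (2 * s * (1 - s)).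
Proof.
move=> /andP[s0 s1]; rewrite /hl_potential; field.
by rewrite !gt_eqF ?subr_gt0.
Qed.

Lemma hl_potential_sum_ge0 s x : 0 < s < 1 ->
  0 <= hl_potential a s x + hl_potential b (1 - s) x.
Proof.
move=> s01; rewrite hl_potential_sum//; have /andP[s0 s1] := s01.
rewrite divr_ge0//; first by rewrite subr_ge0 hopf_lax_order.
by rewrite !mulr_ge0// ?subr_ge0 ltW.
Qed.

(** Both potentials have quadratic upper bounds, and their sum is nonnegative with value 0 at [x].
    The two linear parts are therefore opposite, and each upper bound is a lower bound for the other
    potential. *)
Lemma contact_expands s x : 0 < s < 1 -> contact a b s x -> exists p,
  expands (hl_potential a s) x p (2 / (s * (1 - s))) /\
  expands (hl_potential b (1 - s)) x (- p) (2 / (s * (1 - s))).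
Proof.
move=> s01 cx; have /andP[s0 s1] := s01.
have s01' : 0 < 1 - s < 1 by apply/andP; split; lra.
have [va hva] := hl_potential_quadratic_upper a0 s01 lsca x.
have [vb hvb] := hl_potential_quadratic_upper b0 s01' lscb x.
have eC : 2 / ((1 - s) * (1 - (1 - s))) = 2 / (s * (1 - s)).
  by congr (2 / _); ring.
rewrite eC in hvb.
have sum0 : hl_potential a s x + hl_potential b (1 - s) x = 0.
  by rewrite hl_potential_sum// cx subrr mul0r.
have vab : vb = - va.
  apply/eqP; rewrite -addr_eq0 addrC; apply/eqP.
  rewrite -[LHS]opprK; apply/eqP; rewrite oppr_eq0; apply/eqP.
  apply: (@dot_quadratic_eq0 _ _ _ (2 * (2 / (s * (1 - s))))) => h.
  have := hva h; have := hvb h; have := hl_potential_sum_ge0 (x + h) s01.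
  by rewrite dotNl dotDl; lra.
exists va; split=> h; have := hva h; have := hvb h;
  have := hl_potential_sum_ge0 (x + h) s01;
  by rewrite vab !dotNl ler_norml => *; apply/andP; split; lra.
Qed.

Section at_contact_point.
Variables (s : R) (x p : 'rV[R]_d) (C : R).
Hypotheses (s01 : 0 < s < 1) (cx : contact a b s x).
Hypothesis pa : expands (hl_potential a s) x p C.
Hypothesis pb : expands (hl_potential b (1 - s)) x (- p) C.

Local Notation U := (hopf_lax a s x).
Local Notation V := (hopf_lax b (1 - s) x).
Local Notation A := (cone_re U V).
Local Notation w := (cone_dot U V s p).
Local Notation X := (cone_pt U V s x p).
Local Notation g2 := (enorm p ^+ 2).

Let s_gt0 : 0 < s. Proof. by case/andP: s01. Qed.
Let s_lt1 : 0 < 1 - s. Proof. by rewrite subr_gt0; case/andP: s01. Qed.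
Let s01' : 0 < 1 - s < 1. Proof. by rewrite s_lt1/= ltrBlDr ltrDl. Qed.
Let U_ge0 : 0 <= U. Proof. exact: hopf_lax_ge0. Qed.
Let V_ge0 : 0 <= V. Proof. exact: hopf_lax_ge0. Qed.
Let VE : V = (1 - (1 - s) * U) / s.
Proof. by apply: (canRL (mulfK (lt0r_neq0 s_gt0))); move: cx; rewrite /contact; lra. Qed.

Lemma cone_reE t : A t = (t - (t - s) * U) / s.
Proof. by rewrite /cone_re VE; field; rewrite gt_eqF. Qed.

Lemma cone_re_at_s : A s = 1. Proof. exact: cx. Qed.

Lemma cone_re0 : A 0 = U. Proof. by rewrite /cone_re; ring. Qed.

Lemma cone_re1 : A 1 = V. Proof. by rewrite /cone_re; ring. Qed.

Lemma cone_re_ge0 t : 0 <= t <= 1 -> 0 <= A t.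
Proof. by move=> /andP[t0 t1]; rewrite addr_ge0 ?mulr_ge0// subr_ge0. Qed.

Lemma cone_re_gt0 t : 0 < t < 1 -> 0 < A t.
Proof.
move=> /andP[t0 t1]; rewrite lt0r cone_re_ge0 ?(ltW t0) ?(ltW t1)// andbT.
rewrite paddr_eq0 ?mulr_ge0 ?(ltW t0) ?subr_ge0 ?(ltW t1)//.
rewrite !mulf_eq0 subr_eq0 (gt_eqF t0) (gt_eqF t1)/=; apply/negP => /andP[/eqP U0 /eqP V0].
by move: cx; rewrite /contact U0 V0 !mulr0 addr0 => /eqP; rewrite eq_sym oner_eq0.
Qed.

(** This is [optimal_bound], that is [(1 - s) * weight <= 1], after eliminating [V]; the two ends of
    the line make an angle of at most [pi / 2]. *)
Lemma cone_dot01_ge0 : 0 <= w 0 1.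
Proof.
rewrite /cone_dot cone_re0 cone_re1.
have [[U0 p0]|[U0 [y opt]]] := optimal_cases a0 s01 lsca pa.
  by rewrite U0 p0 enorm0 expr0n/= mul0r mulr0 addr0.
have := optimal_bound a0 s01 opt.
have -> : U * V + (0 - s) * (1 - s) * g2 =
    (U - (1 - s) * (U ^+ 2 + s ^+ 2 * g2)) / s.
  by rewrite VE; field; rewrite gt_eqF.
by move=> h; rewrite divr_ge0 ?subr_ge0// ltW.
Qed.

(** Each point of the line is a convex combination of its two ends, so the inner product expands
    into nonnegative terms. *)
Lemma cone_dot_ge0 r t : 0 <= r <= 1 -> 0 <= t <= 1 -> 0 <= w r t.
Proof.
move=> /andP[r0 r1] /andP[t0 t1].
have -> : w r t = (1 - r) * (1 - t) * w 0 0 + r * t * w 1 1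
    + ((1 - r) * t + r * (1 - t)) * w 0 1.
  have e : (1 - s) * U + s * V = 1 by exact: cx.
  by rewrite /cone_dot /cone_re; ring.
have sq u : 0 <= w u u.
  by rewrite /cone_dot -!expr2; apply: addr_ge0; last apply: mulr_ge0; exact: sqr_ge0.
have r1' : 0 <= 1 - r by rewrite subr_ge0.
have t1' : 0 <= 1 - t by rewrite subr_ge0.
apply: addr_ge0.
  apply: addr_ge0; first exact: (mulr_ge0 (mulr_ge0 r1' t1') (sq 0)).
  exact: (mulr_ge0 (mulr_ge0 r0 t0) (sq 1)).
by apply: (mulr_ge0 _ cone_dot01_ge0); apply: addr_ge0; apply: mulr_ge0.
Qed.

Lemma cone_dot_gt0 t : 0 < t < 1 -> 0 < w t t.
Proof.
move=> t01; rewrite /cone_dot -!expr2 ltr_pwDl ?exprn_gt0 ?cone_re_gt0//.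
by apply: mulr_ge0; exact: sqr_ge0.
Qed.

Lemma cone_pt_in t : 0 < t < 1 -> X t = x + vatan (((t - s) / A t) *: p).
Proof. by move=> t01; rewrite /cone_pt cone_re_gt0. Qed.

Lemma cone_dot0E t : w 0 t = U * A t - s * (t - s) * g2.
Proof. by rewrite /cone_dot cone_re0; ring. Qed.

Lemma cone_dot_convex t : (1 - t) * w 0 t + t * w 1 t = w t t.
Proof. by rewrite /cone_dot cone_re0 cone_re1 {1}/cone_re /cone_re; ring. Qed.

Let lower_a t : 0 < t < 1 -> w 0 t / w t t <= hopf_lax a t (X t).
Proof.
move=> t01; have A0 := cone_re_gt0 t01.
have /= := hopf_lax_lower_along a0 lsca s01 t01 pa; rewrite -cone_reE => /(_ A0).
by rewrite cone_pt_in// cone_dot0E [in w t t]/cone_dot -!expr2.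
Qed.

Let lower_b t : 0 < t < 1 -> w 1 t / w t t <= hopf_lax b (1 - t) (X t).
Proof.
move=> t01; have A0 := cone_re_gt0 t01; have /andP[t0 t1] := t01.
have t01' : 0 < 1 - t < 1 by apply/andP; split; lra.
have AE : (1 - t - (1 - t - (1 - s)) * V) / (1 - s) = A t.
  by rewrite cone_reE VE; field; rewrite !gt_eqF.
have /= := hopf_lax_lower_along b0 lscb s01' t01' pb; rewrite AE => /(_ A0).
rewrite enormN scalerN -scaleNr.
have -> : - ((1 - t - (1 - s)) / A t) = (t - s) / A t by rewrite -mulNr; congr (_ / _); ring.
rewrite cone_pt_in// /cone_dot cone_re1.
have -> : V * A t - (1 - s) * (1 - t - (1 - s)) * g2
  = V * A t + (1 - s) * (t - s) * g2 by ring.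
by have -> : A t ^+ 2 + (1 - t - (1 - s)) ^+ 2 * g2
  = A t * A t + (t - s) * (t - s) * g2 by ring.
Qed.

(** The transported maximizers bound both suprema from below. By [cone_dot_convex] the weighted sum
    of these bounds is 1, the largest value [hopf_lax_order] allows, so both bounds are
    equalities. *)
Lemma contact_along t : 0 < t < 1 ->
  [/\ contact a b t (X t), hopf_lax a t (X t) = w 0 t / w t t &
      hopf_lax b (1 - t) (X t) = w 1 t / w t t].
Proof.
move=> t01; have /andP[t0 t1] := t01; have t1' : 0 < 1 - t by rewrite subr_gt0.
have la := lower_a t01; have lb := lower_b t01.
have ord := hopf_lax_order a0 b0 ab (X t) t01.
have wt := cone_dot_gt0 t01.
have e : (1 - t) * (w 0 t / w t t) + t * (w 1 t / w t t) = 1.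
  by rewrite !mulrA -(mulrDl _ _ (w t t)^-1) cone_dot_convex mulfV ?gt_eqF.
have la' : (1 - t) * (w 0 t / w t t) <= (1 - t) * hopf_lax a t (X t) by rewrite ler_pM2l.
have lb' : t * (w 1 t / w t t) <= t * hopf_lax b (1 - t) (X t) by rewrite ler_pM2l.
split.
- by rewrite /contact; lra.
- by apply: (mulfI (lt0r_neq0 t1')); lra.
- by apply: (mulfI (lt0r_neq0 t0)); lra.
Qed.

(** Contact at [X t] gives some gradient there. The maximizer of [x] is optimal at [X t] too, and
    its first-order condition identifies that gradient. *)
Lemma expands_along t : 0 < t < 1 ->
  expands (hl_potential a t) (X t) ((w t t)^-1 *: p) (2 / (t * (1 - t))) /\
  expands (hl_potential b (1 - t)) (X t) (- ((w t t)^-1 *: p)) (2 / (t * (1 - t))).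
Proof.
move=> t01; have /andP[t0 t1] := t01.
have [ct Ut Vt] := contact_along t01.
have [pt [pta ptb]] := contact_expands t01 ct.
suff <- : pt = (w t t)^-1 *: p by split.
have A0 := cone_re_gt0 t01.
have [[U0 p0]|[U0 [y opt]]] := optimal_cases a0 s01 lsca pa.
  rewrite p0 scaler0; have [[_ ->//]|[]] := optimal_cases a0 t01 lsca pta.
  by rewrite Ut cone_dot0E U0 p0 enorm0 mul0r expr0n/= mulr0 subr0 mul0r ltxx.
have /= := optimal_along a0 s01 opt (ltW t0) t1; rewrite -cone_reE => /(_ A0).
rewrite -cone_dot0E -[A t ^+ 2 + _]/(A t * A t + (t - s) * (t - s) * g2) -/(w t t).
rewrite -cone_pt_in// => -[_ Xy wy UE SE].
have [_ _ _] : optimal a t (X t) pt y.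
  by apply: (optimal_of_expands a0 t01 pta) => //; rewrite Ut.
rewrite SE mulrC => h; apply: (scalerI (lt0r_neq0 t0)).
by rewrite h scalerA mulrC.
Qed.

Lemma cone_re_back t : 0 < t < 1 ->
  cone_re (hopf_lax a t (X t)) (hopf_lax b (1 - t) (X t)) s = A t / w t t.
Proof.
move=> t01; have [_ -> ->] := contact_along t01.
rewrite /cone_re; have e : (1 - s) * U + s * V = 1 by exact: cx.
have -> : (1 - s) * (w 0 t / w t t) + s * (w 1 t / w t t) = ((1 - s) * w 0 t + s * w 1 t) / w t t.
  by move: (w 0 t) (w 1 t) ((w t t)^-1) => u v k; ring.
congr (_ / _); rewrite /cone_dot cone_re0 cone_re1.
have -> : (1 - s) * (U * A t + (0 - s) * (t - s) * g2) + s * (V * A t + (1 - s) * (t - s) * g2)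
   = ((1 - s) * U + s * V) * A t by ring.
by rewrite e mul1r.
Qed.

(** Seen from [X t], the real part at time [s] and the gradient are those of the old line divided by
    [w t t]; the displacement is the old one with opposite sign. *)
Lemma cone_pt_back t : 0 < t < 1 ->
  cone_pt (hopf_lax a t (X t)) (hopf_lax b (1 - t) (X t)) t (X t) ((w t t)^-1 *: p) s = x.
Proof.
move=> t01; have wt := cone_dot_gt0 t01; have At := cone_re_gt0 t01.
have := cone_pt_in t01; have := cone_re_back t01; move: (X t) => y reE yE.
rewrite /cone_pt reE divr_gt0// yE scalerA.
have -> : (s - t) / (A t / w t t) / w t t = - ((t - s) / A t).
  by field; rewrite !gt_eqF.
have vatanN z : vatan (- z) = - vatan z by rewrite /vatan enormN scalerN.
by rewrite scaleNr vatanN addrK.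
Qed.

Lemma cone_re_source r t : 0 < r < 1 ->
  (t - (t - r) * hopf_lax a r (X r)) / r * w r r = w r t.
Proof.
move=> r01; have /andP[r0 r1] := r01; have [_ -> _] := contact_along r01.
have wr := cone_dot_gt0 r01.
have -> : (t - (t - r) * (w 0 r / w r r)) / r * w r r = (t * w r r - (t - r) * w 0 r) / r.
  by field; rewrite !gt_eqF.
apply: (canLR (mulfK (lt0r_neq0 r0))).
by rewrite /cone_dot cone_re0 !cone_reE; field; rewrite gt_eqF.
Qed.

(** Since the squared cone length at time [r] is the local mass, this says that the dual factor is
    the density of the coupling mass [w r t] on that marginal. *)
Lemma source_factor_along r t : 0 <= r < 1 ->
  (source_factor a r t (X r) * (w r r)%:E = (w r t)%:E)%E.
Proof.
move=> /andP[r0 r1]; rewrite /source_factor; case: eqVneq => [->|rn0]; last first.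
  rewrite -EFinM cone_re_source//; apply/andP; split=> //.
  by rewrite lt0r rn0.
have [[U0 p0]|[U0 [y opt]]] := optimal_cases a0 s01 lsca pa.
  (* No maximizer need exist, and the factor may be [+oo]; both masses vanish, and [+oo * 0 = 0]. *)
  rewrite /cone_dot cone_re0 U0 p0 enorm0 !mul0r expr0n/= !mulr0 !addr0.
  by rewrite mule0.
have [c c0 [ac cE]] := optimal_source a0 s01 opt.
have X0 : X 0 = y.
  rewrite /cone_pt cone_re0 U0 sub0r mulNr; exact/esym/(optimal_point opt).
rewrite X0 ac.
have -> : (((1 - t)%:E + t%:E * c%:E) * (w 0 0)%:E = ((1 - t + t * c) * w 0 0)%:E)%E by [].
congr (_%:E); rewrite (cone_dot0E t) (cone_reE t) -cE; congr (_ * _).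
by rewrite /cone_dot cone_re0; ring.
Qed.

End at_contact_point.

Lemma source_factor_ge0 r t x : 0 <= r -> r < t -> t <= 1 -> (0 <= source_factor a r t x)%E.
Proof.
move=> r0 rt t1; rewrite /source_factor; case: eqVneq => [_|rn0].
  by rewrite adde_ge0 ?mule_ge0 ?lee_fin ?subr_ge0 ?(le_trans r0 (ltW rt)).
have r_gt0 : 0 < r by rewrite lt0r rn0.
have r1 : 0 < 1 - r by rewrite subr_gt0 (lt_le_trans rt).
have r01 : 0 < r < 1 by rewrite r_gt0 -subr_gt0.
rewrite lee_fin divr_ge0//.
have : (t - r) * hopf_lax a r x <= (t - r) * (1 - r)^-1.
  by rewrite ler_wpM2l ?subr_ge0 ?(ltW rt)// hopf_lax_le_max.
have : (t - r) / (1 - r) <= t.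
  rewrite ler_pdivrMr// mulrBr mulr1 lerD2l lerN2 mulrC.
  by rewrite ler_piMr.
by lra.
Qed.

Lemma source_factor_measurable r t : 0 <= r < 1 ->
  measurable_fun [set: Rd R d] (source_factor a r t).
Proof.
move=> /andP[r0 r1]; rewrite /source_factor; case: eqVneq => [_|rn0].
  apply: emeasurable_funD => //; apply: emeasurable_funM => //.
  exact: rV_lsc_measurable.
have r01 : 0 < r < 1 by rewrite lt0r rn0 r0.
apply/measurable_EFinP; apply: measurable_funM => //.
apply: measurable_funB => //; apply: measurable_funM => //.
by apply: rV_continuousT_measurable; exact: hopf_lax_continuous.
Qed.

End two_potentials.

Lemma weight_source s (c : \bar R) : 0 < s < 1 -> (0 <= c)%E -> c != +oo%E ->
  ((1 - s)%:E + s%:E * c)%E = ((weight s c)^-1)%:E /\ 0 < weight s c.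
Proof.
move=> /andP[s0 s1]; case: c => [r|//|//]; rewrite lee_fin => r0 _ /=.
have h : 0 < 1 - s + s * r by rewrite ltr_pwDl ?subr_gt0// mulr_ge0// ltW.
by rewrite invrK invr_gt0.
Qed.

Lemma source_factor_constraint (a b : 'rV[R]_d -> \bar R) r t x y :
    (forall x, 0 <= a x)%E -> (forall x, 0 <= b x)%E -> dual_pair a b ->
    0 <= r -> r < t -> t <= 1 ->
  (source_factor a r t x = +oo \/ source_factor b (1 - t) (1 - r) y = +oo \/
   (cos2 (x - y))%:E <= source_factor a r t x * source_factor b (1 - t) (1 - r) y)%E.
Proof.
(* With one time at an end, [u] is a competitor in the supremum at [v], and the order at [v] gives
   the constraint. The opposite end follows by time reversal. *)
have one_end (a' b' : 'rV[R]_d -> \bar R) q u v :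
    (forall x, 0 <= a' x)%E -> (forall x, 0 <= b' x)%E -> dual_pair a' b' -> 0 < q < 1 ->
    (source_factor a' 0 q u = +oo \/
      (cos2 (u - v))%:E <= source_factor a' 0 q u * source_factor b' (1 - q) 1 v)%E.
  move=> a0 b0 ab q01; have /andP[q0 q1] := q01; have q1' : 0 < 1 - q by rewrite subr_gt0.
  rewrite /source_factor eqxx (gt_eqF q1').
  have [au|au] := eqVneq (a' u) +oo%E.
    by left; rewrite au gt0_muley ?lte_fin// addey.
  right; have [-> wpos] := weight_source q01 (a0 u) au.
  rewrite -EFinM lee_fin ler_pdivlMl// ler_pdivlMr//.
  have := hopf_lax_order a0 b0 ab v q01.
  have := hopf_lax_ub a0 q01 v u; rewrite cos2BC.
  move=> h1 h2; have := ler_wpM2l (ltW q1') h1.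
  by rewrite (_ : 1 - (1 - q) = q); [lra|ring].
move=> a0 b0 ab r0 rt t1.
have [r_eq0|rn0] := eqVneq r 0; have [t_eq1|tn1] := eqVneq t 1.
- rewrite r_eq0 t_eq1 subrr subr0 /source_factor eqxx subrr add0e mul1e.
  by rewrite add0e mul1e; exact: ab.
- have t01 : 0 < t < 1 by rewrite -r_eq0 rt lt_neqAle tn1.
  rewrite r_eq0 subr0; have [->|h] := one_end a b t x y a0 b0 ab t01; first by left.
  by right; right.
- have r01 : 0 < 1 - r < 1 by apply/andP; split; [lra|rewrite ltrBlDr ltrDl lt0r rn0].
  have := one_end b a (1 - r) y x b0 a0 (dual_pair_sym ab) r01.
  rewrite t_eq1 subrr (_ : 1 - (1 - r) = r); last by ring.
  by case=> [->|h]; [right; left|right; right; rewrite muleC cos2BC].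
have r_gt0 : 0 < r by rewrite lt0r rn0.
have t_lt1 : t < 1 by rewrite lt_neqAle tn1.
right; right; have := hopf_lax_constraint a0 b0 ab x y r_gt0 rt t_lt1.
have t1' : 0 < 1 - t by rewrite subr_gt0.
rewrite /source_factor (negbTE rn0) (gt_eqF t1') -EFinM lee_fin.
rewrite (_ : 1 - r - (1 - t) = t - r); last by ring.
by move=> h; rewrite mulf_div ler_pdivlMr ?mulr_gt0// mulrC (mulrC r).
Qed.

End contact_set.

(** * Transport and growth maps on the contact set *)

Section transport_maps.
Context {R : realType} {d : nat}.
Variables (phi0 phi1 : 'rV[R]_d -> \bar R).
Hypotheses (lsc0 : lower_semicontinuous phi0) (usc1 : upper_semicontinuous phi1).
Hypothesis phi1E : forall x1, phi1 x1 =
  ereal_inf [set phi0 x0 + L1 (x1 - x0)%R | x0 in eball x1 (pi / 2)]%E.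
Implicit Types (x y : 'rV[R]_d) (s t r : R).

Local Notation a := (exp2 phi0).
Local Notation b := (expN2 phi1).
Local Notation Xi := (Xi phi0 phi1).
Local Notation T := (transport phi0).
Local Notation q := (growth phi0).
Local Notation U s x := (hopf_lax a s x).
Local Notation V s x := (hopf_lax b (1 - s) x).
Local Notation p s x := (grad (xir phi0 s) x).

Let a0 := exp2_ge0 phi0.
Let b0 := expN2_ge0 phi1.
Let lsca := lsc_exp2 lsc0.
Let lscb := lsc_expN2 usc1.
Let ab := tight_dual_pair phi1E.

Lemma XiE s x : 0 < s < 1 -> Xi s x <-> contact a b s x.
Proof.
move=> s01; have /andP[s0 s1] := s01; have s1' : 0 < 1 - s by rewrite subr_gt0.
rewrite /Defs.Xi/= xiE// xibarE// /contact.
have e : (1 - U s x) / (2 * s) - (V s x - 1) / (2 * (1 - s)) =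
    (1 - ((1 - s) * U s x + s * V s x)) / (2 * s * (1 - s)).
  by field; rewrite !gt_eqF.
split=> [[h]|h].
  move: e; rewrite h subrr => /esym/eqP; rewrite mulf_eq0 invr_eq0 !mulf_eq0.
  by rewrite (gt_eqF s0) (gt_eqF s1') pnatr_eq0/= !orbF subr_eq0 => /eqP <-.
congr (_%:E); apply/eqP; rewrite -subr_eq0 e h subrr mul0r//.
Qed.

Lemma xirE s : 0 < s < 1 -> xir phi0 s = hl_potential a s.
Proof. by move=> s01; apply/funext => x; rewrite /xir xiE. Qed.

Lemma grad_expands s x : 0 < s < 1 -> Xi s x ->
  expands (hl_potential a s) x (p s x) (2 / (s * (1 - s))) /\
  expands (hl_potential b (1 - s)) x (- p s x) (2 / (s * (1 - s))).
Proof.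
move=> s01 /(XiE _ s01) cx; have [v [va vb]] := contact_expands a0 b0 lsca lscb ab s01 cx.
by rewrite xirE// (expands_grad va).
Qed.

Lemma transport_factorE s t x : 0 < s < 1 -> Xi s x ->
  1 + 2 * (t - s) * xir phi0 s x = cone_re (U s x) (V s x) t.
Proof.
move=> s01 /(XiE _ s01) cx; have /andP[s0 s1] := s01.
rewrite (cone_reE s01 cx) xirE// /hl_potential; field.
by rewrite gt_eqF.
Qed.

Lemma transportE s t x : 0 < s < 1 -> Xi s x ->
  T s t x = cone_pt (U s x) (V s x) s x (p s x) t.
Proof. by move=> s01 cx; rewrite /transport transport_factorE. Qed.

Lemma growth_sqr s t x : 0 < s < 1 -> Xi s x ->
  q s t x ^+ 2 = cone_dot (U s x) (V s x) s (p s x) t t.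
Proof.
move=> s01 cx; rewrite sqr_sqrtr; last first.
  by apply: addr_ge0; [exact: sqr_ge0|apply: mulr_ge0; exact: sqr_ge0].
by rewrite transport_factorE// /cone_dot -!expr2.
Qed.

Lemma transport_Xi s t x : 0 < s < 1 -> 0 < t < 1 -> Xi s x -> Xi t (T s t x).
Proof.
move=> s01 t01 cx; have [va vb] := grad_expands s01 cx.
rewrite transportE//; apply/(XiE _ t01); have /(XiE _ s01) cx' := cx.
by have [] := contact_along a0 b0 lsca lscb ab s01 cx' va vb t01.
Qed.

Lemma transport_back s t x : 0 < s < 1 -> 0 < t < 1 -> Xi s x -> T t s (T s t x) = x.
Proof.
move=> s01 t01 cx; have [va vb] := grad_expands s01 cx.
have Tx := transport_Xi s01 t01 cx; have /(XiE _ s01) cx' := cx.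
rewrite (transportE _ t01 Tx).
have [va' _] := expands_along a0 b0 lsca lscb ab s01 cx' va vb t01.
rewrite {1 2 3 4}transportE//; set y := cone_pt _ _ _ _ _ _ in va' *.
rewrite (xirE t01) (expands_grad va').
exact: (cone_pt_back a0 b0 lsca lscb ab s01 cx' va vb t01).
Qed.

Lemma xir_continuous s : 0 < s < 1 -> continuous (xir phi0 s).
Proof.
move=> s01; have /andP[s0 s1] := s01; rewrite xirE//.
apply: (@enorm_lipschitz_continuous _ _ _ ((1 - s)^-1 / (2 * s))) => x y.
rewrite /hl_potential -mulrBl.
have -> : 1 - U s x - (1 - U s y) = U s y - U s x by ring.
rewrite normrM normfV.
rewrite (ger0_norm (_ : 0 <= 2 * s)) ?mulr_ge0 ?(ltW s0)// mulrAC.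
rewrite ler_wpM2r ?invr_ge0 ?mulr_ge0 ?(ltW s0)// distrC.
exact: hopf_lax_lipschitz.
Qed.

Lemma Xi_closed s : 0 < s < 1 -> closed (Xi s).
Proof.
move=> s01; have /andP[s0 s1] := s01.
have s01' : 0 < 1 - s < 1 by apply/andP; split; lra.
pose f (x : 'rV[R]_d) := (1 - s) * U s x + s * V s x.
have -> : Xi s = f @^-1` [set 1].
  by apply/seteqP; split=> x h; [exact/(XiE _ s01)|apply/(XiE _ s01)].
apply: closed_comp; last exact: closed_eq.
move=> x _; apply: (@cvgD _ _ _ (nbhs x)).
  by apply: (@cvgMl_tmp _ _ (nbhs x)); exact: hopf_lax_continuous.
by apply: (@cvgMl_tmp _ _ (nbhs x)); exact: hopf_lax_continuous.
Qed.

Lemma Xi_measurable s : 0 < s < 1 -> measurable (Xi s : set (Rd R d)).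
Proof. by move=> s01; apply: rV_closed_measurable; exact: Xi_closed. Qed.

Lemma grad_lipschitz s : 0 < s < 1 -> exists2 k, 0 <= k &
  forall x y, Xi s x -> Xi s y -> enorm (p s x - p s y) <= k * enorm (x - y).
Proof.
move=> s01; have /andP[s0 s1] := s01.
have C0 : 0 <= 2 / (s * (1 - s)) by rewrite divr_ge0 ?mulr_ge0 ?subr_ge0 ?(ltW s0) ?(ltW s1).
exists (d%:R * (6 * (2 / (s * (1 - s))))); first by apply: mulr_ge0 => //; apply: mulr_ge0.
move=> x y cx cy; apply: (@expands_lipschitz _ _ (hl_potential a s) (Xi s)) => //.
by move=> z /(grad_expands s01) [].
Qed.

Lemma grad_continuous s : 0 < s < 1 -> {within Xi s, continuous (fun x => p s x)}.
Proof.
move=> s01; have [k k0 kP] := grad_lipschitz s01.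
exact: enorm_lipschitz_continuous_rV kP.
Qed.

Let re s t x := 1 + 2 * (t - s) * xir phi0 s x.

Let re_continuous s t : 0 < s < 1 -> continuous (re s t).
Proof.
move=> s01 x; apply: (@cvgD _ _ _ (nbhs x)); first exact: cvg_cst.
by apply: (@cvgMl_tmp _ _ (nbhs x)); exact: xir_continuous.
Qed.

Lemma transport_continuous_pos s t : 0 < s < 1 ->
  {within Xi s `&` [set x | 0 < re s t x], continuous (T s t)}.
Proof.
move=> s01; apply/subspace_continuousP => x [cx /= A0].
set D := _ `&` _; set F := within D (nbhs x).
have FF : Filter F by exact: within_filter.
have idx : (fun y : 'rV[R]_d => y) @ F --> x by apply: cvg_within.
have rex : re s t @ F --> re s t x by apply: cvg_within_filter; exact: re_continuous.
have px : (fun y => p s y) @ F --> p s x.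
  have : {within D, continuous (fun y => p s y)}.
    by apply: continuous_subspaceW (grad_continuous s01) => y [].
  by move/subspace_continuousP/(_ x); apply; split.
have arg : (fun y => ((t - s) / re s t y) *: p s y) @ F --> ((t - s) / re s t x) *: p s x.
  apply: cvgZ px; apply: cvgMl_tmp.
  by apply: cvgV rex; rewrite gt_eqF.
have vat : {for ((t - s) / re s t x) *: p s x, continuous (@vatan R d)}.
  move=> W /nbhs_enorm[e e0 eW]; apply/nbhs_enorm; exists e => // y h.
  by apply: eW; apply: le_lt_trans (vatan_lipschitz _ _) h.
have := cvgD idx (cvg_comp _ _ arg vat).
have TE y : 0 < re s t y -> T s t y = y + vatan (((t - s) / re s t y) *: p s y).
  by rewrite /transport /= -/(re s t y) => ->.
rewrite -(TE x A0) => h.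
have lim : T s t @ F --> T s t x.
  move=> W /h; rewrite !nbhs_simpl /F /within/=; apply: filterS => y hy Dy.
  by rewrite TE; [exact: hy|case: Dy].
exact: lim.
Qed.

(** For [t = 0] or [t = 1] the factor may vanish on part of the contact set, where the map jumps to
    the identity; each part is measurable by itself. *)
Lemma transport_measurable s t : 0 < s < 1 ->
  measurable_fun (Xi s : set (Rd R d)) (T s t : Rd R d -> Rd R d).
Proof.
move=> s01.
have mpos : measurable ([set x | 0 < re s t x] : set (Rd R d)).
  apply: rV_open_measurable; apply: (@open_comp _ _ (re s t) [set u | 0 < u]); last exact: open_gt.
  by move=> x _; exact: re_continuous.
have mX := Xi_measurable s01.
have -> : Xi s = (Xi s `&` [set x | 0 < re s t x]) `|` (Xi s `\` [set x | 0 < re s t x]).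
  by rewrite setUIDK.
apply/measurable_funU; [exact: measurableI|exact: measurableD|split].
  apply: rV_continuous_measurable_rV; first exact: measurableI.
  exact: transport_continuous_pos.
apply: (@eq_measurable_fun _ _ (Rd R d) (Rd R d) _ (fun x : Rd R d => x)); last exact: measurable_id.
move=> x; rewrite inE => -[_ /= /negP A0]; rewrite /transport /= -/(re s t x).
by rewrite (negbTE A0).
Qed.

Lemma growth_measurable s t : 0 < s < 1 -> measurable_fun (Xi s : set (Rd R d)) (q s t).
Proof.
move=> s01; have mX := Xi_measurable s01.
have mp : measurable_fun (Xi s : set (Rd R d)) (fun x => p s x : Rd R d).
  by apply: rV_continuous_measurable_rV => //; exact: grad_continuous.
have mn : measurable_fun (Xi s : set (Rd R d)) (fun x => enorm (p s x)).
  apply: (measurableT_comp (f := fun z : Rd R d => enorm z)) mp.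
  by apply: rV_continuousT_measurable; exact: continuous_enorm.
apply: measurableT_comp.
  by apply: continuous_measurable_fun; exact: sqrt_continuous.
apply: measurable_funD; last first.
  by apply: measurable_funM => //; exact: measurable_funX.
apply: measurable_funX; apply: (@measurable_funS _ _ _ _ setT) => //.
by apply: rV_continuousT_measurable; exact: re_continuous.
Qed.

(** The gradient is bounded because [0 <= w 0 1] reads [s (1 - s) |p|^2 <= U V], and [U] and [V] are
    bounded by [1 / (1 - s)] and [1 / s]. *)
Lemma growth_bounded s t : 0 < s < 1 -> 0 <= t <= 1 -> exists M,
  forall x, Xi s x -> q s t x ^+ 2 <= M.
Proof.
move=> s01 t01; have /andP[s0 s1] := s01; have s1' : 0 < 1 - s by rewrite subr_gt0.
have s01' : 0 < 1 - s < 1 by apply/andP; split; lra.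
exists (((1 - s)^-1 + s^-1) ^+ 2 + (s * (1 - s))^-1 * ((1 - s)^-1 * s^-1)) => x cx.
have /(XiE _ s01) cx' := cx; have [va vb] := grad_expands s01 cx.
rewrite growth_sqr// /cone_dot -!expr2.
have U0 : 0 <= U s x by exact: hopf_lax_ge0.
have V0 : 0 <= V s x by exact: hopf_lax_ge0.
have U1 : U s x <= (1 - s)^-1 by exact: hopf_lax_le_max.
have V1 : V s x <= s^-1.
  have -> : s^-1 = (1 - (1 - s))^-1 by congr (_^-1); ring.
  exact: hopf_lax_le_max.
have /andP[t0 t1] := t01.
apply: lerD.
  have A0 : 0 <= cone_re (U s x) (V s x) t by exact: cone_re_ge0.
  rewrite ler_sqr ?nnegrE//; last by rewrite addr_ge0 ?invr_ge0 ?(ltW s0) ?(ltW s1').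
  apply: lerD; first by rewrite -[leRHS]mul1r ler_pM//; lra.
  by rewrite -[leRHS]mul1r ler_pM.
have g0 : 0 <= enorm (p s x) ^+ 2 by exact: sqr_ge0.
apply: le_trans (_ : 1 * enorm (p s x) ^+ 2 <= _).
  rewrite ler_wpM2r// -[leLHS]real_normK ?num_real// expr_le1//.
  by rewrite ler_norml; apply/andP; split; lra.
rewrite mul1r ler_pdivlMl ?mulr_gt0//.
have := cone_dot01_ge0 a0 lsca s01 cx' va.
rewrite /cone_dot cone_re0 cone_re1.
have : U s x * V s x <= (1 - s)^-1 * s^-1 by exact: ler_pM.
by rewrite sub0r !mulNr; lra.
Qed.

End transport_maps.

(** * Perturbation of optimal dual pairs *)

Section perturbation.
Context {R : realType} {d : nat}.
Implicit Types (x y h P : 'rV[R]_d).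

Lemma quadratic_gradient_bound (D0 K : R) (v : 'rV[R]_d) : 0 < K ->
  (forall h, 0 <= D0 + dot v h + K * enorm h ^+ 2) -> enorm v ^+ 2 <= 4 * K * D0.
Proof.
move=> K0 /(_ (- (2 * K)^-1 *: v)); rewrite dotZr enormZ normrN exprMn real_normK ?num_real//.
rewrite -sqr_enorm.
have -> : D0 + - (2 * K)^-1 * enorm v ^+ 2 + K * ((2 * K)^-1 ^+ 2 * enorm v ^+ 2)
   = (4 * K)^-1 * (4 * K * D0 - enorm v ^+ 2) by field; rewrite gt_eqF.
by rewrite pmulr_rge0 ?invr_gt0 ?mulr_gt0// subr_ge0.
Qed.

Lemma enormB_sqr_le (u v : 'rV[R]_d) : enorm (u + v) ^+ 2 <= 2 * (enorm u ^+ 2 + enorm v ^+ 2).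
Proof.
apply: le_trans (_ : (enorm u + enorm v) ^+ 2 <= _).
  by rewrite ler_sqr ?nnegrE ?addr_ge0 ?enorm_ge0// enormD.
by have := sqr_ge0 (enorm u - enorm v); rewrite sqrrB sqrrD; lra.
Qed.

Variables (a b : 'rV[R]_d -> R) (D : set 'rV[R]_d) (P : 'rV[R]_d -> 'rV[R]_d) (m M C : R).
Hypotheses (m0 : 0 < m) (C1 : 1 <= C).
Hypotheses (am : forall x, m <= a x <= M) (bm : forall x, m <= b x <= M).
Hypothesis ab : forall x y, cos2 (x - y) <= a x * b y.
Hypothesis aP : forall x, D x -> forall h, a (x + h) <= a x + dot (P x) h + C * enorm h ^+ 2.

(** If the deficit [a x * b y - cos2 (x - y)] is 0 with [D x] and [P x] the gradient of [a] at [x],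
    its gradient in [x] vanishes as well; this forces [y] to be this point and [b y] to be
    [a x / contact_mass x]. *)
Definition contact_target x := x + vatan ((2 * a x)^-1 *: P x).

Definition contact_mass x := a x ^+ 2 + enorm (P x) ^+ 2 / 4.

Local Notation T := contact_target.
Local Notation Q := contact_mass.

Let a_gt0 x : 0 < a x. Proof. by case/andP: (am x) => h _; exact: lt_le_trans h. Qed.
Let b_gt0 x : 0 < b x. Proof. by case/andP: (bm x) => h _; exact: lt_le_trans h. Qed.
Let aM x : a x <= M. Proof. by case/andP: (am x). Qed.
Let bM x : b x <= M. Proof. by case/andP: (bm x). Qed.
Let M0 : 0 < M. Proof. exact: lt_le_trans (aM 0). Qed.
Let C0 : 0 < C. Proof. exact: lt_le_trans C1. Qed.

Let P_bound x : D x -> enorm (P x) ^+ 2 <= 4 * C * M.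
Proof.
move=> Dx; apply: (@le_trans _ _ (4 * C * a x)); last by rewrite ler_pM2l ?mulr_gt0.
apply: quadratic_gradient_bound => // h.
by apply: le_trans (aP Dx h); exact: ltW.
Qed.

Let QM := M ^+ 2 + C * M.

Lemma contact_mass_le x : D x -> Q x <= QM.
Proof.
move=> Dx; apply: lerD; first by rewrite ler_sqr ?nnegrE ?(ltW (a_gt0 x)) ?(ltW M0).
by rewrite ler_pdivrMr// (le_trans (P_bound Dx))//; lra.
Qed.

Lemma contact_mass_gt0 x : 0 < Q x.
Proof. by rewrite ltr_pwDl ?exprn_gt0// divr_ge0 ?sqr_ge0. Qed.

(* The deficit [a x * b y - cos2 (x - y)] is nonnegative in [x]; expanding it to
   second order around [x] bounds its gradient, which measures how far [y] is
   from [T x]. *)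
Let near_target x y : D x -> enorm (y - x) < pi / 2 -> m ^+ 2 / 2 <= cos2 (x - y) ->
  a x * b y - cos2 (x - y) <= m ^+ 2 / 2 ->
  enorm (y - T x) ^+ 2 <=
    (8 / m ^+ 4) * (M * C + 4 + C * M / 2) * (a x * b y - cos2 (x - y)).
Proof.
move=> Dx yx cm; set D0 := a x * b y - cos2 (x - y) => Dm.
have D00 : 0 <= D0 by rewrite subr_ge0.
have c0 : 0 < cos2 (x - y) by apply: lt_le_trans cm; rewrite divr_gt0 ?exprn_gt0.
have xy : enorm (x - y) < pi / 2 by rewrite enormBC.
have taylor h := cos2_taylor h xy.
have tanE := vatan_tan xy; rewrite -(cos2_near xy) in tanE.
move: (sincos (x - y)) taylor tanE => sc taylor tanE.
have [W WE] : exists W, W = (2 * a x)^-1 *: P x by eexists.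
(* [v] is the gradient of the deficit in its first variable; the constant [M * C + 4] adds the
   quadratic errors of [a], multiplied by [b <= M], and of [cos2]. *)
pose v := b y *: P x + 2 *: sc.
have K0 : 0 < M * C + 4 by rewrite ltr_wpDl ?mulr_ge0 ?(ltW M0) ?(ltW C0).
have hv h : 0 <= D0 + dot v h + (M * C + 4) * enorm h ^+ 2.
  have h1 := taylor h; have h2 := ab (x + h) y.
  rewrite (_ : x + h - y = x - y + h) in h2; last by rewrite addrAC.
  have h3 := ler_wpM2r (ltW (b_gt0 y)) (aP Dx h).
  have h4 : C * enorm h ^+ 2 * b y <= C * enorm h ^+ 2 * M.
    by rewrite ler_wpM2l// mulr_ge0 ?sqr_ge0 ?(ltW C0).
  rewrite /v dotDl !dotZl /D0; move: h1 h2 h3 h4.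
  by rewrite !mulrDl; lra.
have v2 := quadratic_gradient_bound K0 hv.
have PE : P x = (2 * a x) *: W by rewrite WE scalerA mulfV ?scale1r// gt_eqF// mulr_gt0.
(* Under [vatan] the vector [sc / cos2] corresponds to [x - y], and [- W] to [x - T x]. Their
   difference is governed by [v] up to a multiple of the deficit. *)
have key : cos2 (x - y) *: ((cos2 (x - y))^-1 *: sc + W) = 2^-1 *: v - D0 *: W.
  rewrite scalerDr scalerA mulfV ?gt_eqF// scale1r /v PE scalerDr !scalerA.
  rewrite mulVf// scale1r addrAC -scalerBl [LHS]addrC; congr (_ *: _ + _).
  by rewrite /D0; field.
have W2 : enorm W ^+ 2 <= C * M / m ^+ 2.
  rewrite WE enormZ exprMn ger0_norm ?invr_ge0 ?mulr_ge0 ?(ltW (a_gt0 x))//.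
  rewrite exprVn ler_pdivrMl ?exprn_gt0 ?mulr_gt0//.
  apply: le_trans (P_bound Dx) _.
  rewrite exprMn mulrAC mulrA ler_pdivlMr ?exprn_gt0//.
  have : m ^+ 2 <= a x ^+ 2.
    by rewrite ler_sqr ?nnegrE ?(ltW m0) ?(ltW (a_gt0 x))//; case/andP: (am x).
  have : 0 <= C * M by rewrite mulr_ge0 ?(ltW M0) ?(ltW C0).
  by move=> h1 h2; have := ler_wpM2l h1 h2; rewrite -natrX; lra.
have dist : cos2 (x - y) * enorm (y - T x) <= enorm (2^-1 *: v - D0 *: W).
  rewrite -key enormZ (ger0_norm (ltW c0)) ler_pM2l//.
  have vatanN z : vatan (- z) = - vatan z :> 'rV[R]_d by rewrite /vatan enormN scalerN.
  have -> : y - T x = - (vatan ((cos2 (x - y))^-1 *: sc) - vatan (- W)).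
    by rewrite tanE vatanN opprK /T -WE !opprD opprK addrA (addrC (- x) y).
  by rewrite enormN; apply: le_trans (vatan_lipschitz _ _) _; rewrite opprK.
have dist2 : cos2 (x - y) ^+ 2 * enorm (y - T x) ^+ 2 <=
    2 * (2^-1 ^+ 2 * enorm v ^+ 2 + D0 ^+ 2 * enorm W ^+ 2).
  rewrite -exprMn; apply: (@le_trans _ _ (enorm (2^-1 *: v - D0 *: W) ^+ 2)).
    by rewrite ler_sqr ?nnegrE ?enorm_ge0 ?(mulr_ge0 (cos2_ge0 _) (enorm_ge0 _)).
  apply: le_trans (enormB_sqr_le _ _) _.
  by rewrite enormN !enormZ !exprMn !real_normK ?num_real.
have D2 : D0 ^+ 2 * enorm W ^+ 2 <= D0 * (C * M / 2).
  apply: (@le_trans _ _ (D0 * (m ^+ 2 / 2) * (C * M / m ^+ 2))).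
    by apply: ler_pM; rewrite ?sqr_ge0// expr2 ler_wpM2l.
  by rewrite le_eqVlt; apply/orP; left; apply/eqP; field; rewrite gt_eqF.
have c2 : m ^+ 4 / 4 <= cos2 (x - y) ^+ 2.
  have -> : m ^+ 4 / 4 = (m ^+ 2 / 2) ^+ 2 by rewrite exprMn -exprM exprVn -natrX.
  by rewrite ler_sqr ?nnegrE ?cos2_ge0 ?divr_ge0 ?sqr_ge0.
have m4 : 0 < m ^+ 4 / 8 by rewrite divr_gt0 ?exprn_gt0.
rewrite -(ler_pM2l m4).
have -> : m ^+ 4 / 8 * (8 / m ^+ 4 * (M * C + 4 + C * M / 2) * D0) =
   (M * C + 4) * D0 + C * M / 2 * D0 by field; rewrite gt_eqF.
have h5 := ler_wpM2r (sqr_ge0 (enorm (y - T x))) c2.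
by move: dist2 v2 D2 h5; rewrite exprVn -natrX; lra.
Qed.

Let target_mass x : cos2 (x - T x) * Q x = a x ^+ 2.
Proof.
have ax := a_gt0 x.
have nW : enorm (x - T x) = atan (enorm ((2 * a x)^-1 *: P x)).
  by rewrite /T opprD addrA subrr add0r enormN enorm_vatan.
rewrite cos2_near ?nW ?atan_ltpi2// cos_atan_sqr enormZ ger0_norm; last first.
  by rewrite invr_ge0 mulr_ge0// ltW.
rewrite /Q; set e := enorm (P x).
have h : 0 < a x ^+ 2 + e ^+ 2 / 4 by exact: contact_mass_gt0.
have -> : 1 + ((2 * a x)^-1 * e) ^+ 2 = (a x ^+ 2 + e ^+ 2 / 4) / a x ^+ 2.
  by field; rewrite gt_eqF.
by rewrite invfM invrK mulrAC mulVf ?mul1r// gt_eqF.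
Qed.

(** The squared quantity is the slope in [e] of the perturbed product. Bounding its square by the
    deficit keeps the quadratic polynomial [D0 + e z + K e^2 / 4] nonnegative for every [e]. *)
Lemma perturbation_slope (g : 'rV[R]_d -> R) L :
    (forall x, 0 <= g x <= 1) -> (forall x y, `|g x - g y| <= L * enorm (x - y)) ->
  exists2 K, 0 < K & forall x y, D x ->
    (a x * g y - g (T x) * Q x * b y) ^+ 2 <= K * (a x * b y - cos2 (x - y)).
Proof.
move=> g01 gL; have QM0 : 0 <= QM by rewrite addr_ge0 ?sqr_ge0// mulr_ge0 ?(ltW M0) ?(ltW C0).
pose K1 := (8 / m ^+ 4) * (M * C + 4 + C * M / 2).
have K10 : 0 <= K1.
  rewrite mulr_ge0 ?divr_ge0 ?exprn_ge0 ?(ltW m0)//.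
  have : 0 <= M * C by rewrite mulr_ge0 ?(ltW M0) ?(ltW C0).
  by lra.
pose Kf := (M + QM * M) ^+ 2 * (2 / m ^+ 2).
pose Kn := 2 * ((M * L + QM / m) ^+ 2 * K1 + (QM / m) ^+ 2 * (m ^+ 2 / 2)).
have Kf0 : 0 <= Kf by rewrite mulr_ge0 ?sqr_ge0// divr_ge0 ?sqr_ge0.
have Kn0 : 0 <= Kn.
  by rewrite mulr_ge0// addr_ge0// mulr_ge0 ?sqr_ge0// divr_ge0 ?sqr_ge0.
exists (Kf + Kn + 1) => [|x y Dx]; first by rewrite ltr_wpDl// addr_ge0.
set D0 := a x * b y - cos2 (x - y).
have D00 : 0 <= D0 by rewrite subr_ge0.
set z := a x * g y - _.
suff : z ^+ 2 <= Kf * D0 \/ z ^+ 2 <= Kn * D0.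
  have := mulr_ge0 Kf0 D00; have := mulr_ge0 Kn0 D00.
  by rewrite !mulrDl mul1r => ? ? [?|?]; lra.
have /andP[gy0 gy1] := g01 y; have /andP[gT0 gT1] := g01 (T x).
have ax := a_gt0 x; have bx := b_gt0 y.
have Qx := contact_mass_le Dx; have Q0 := contact_mass_gt0 x.
have mm : m ^+ 2 <= a x * b y.
  have /andP[am' _] := am x; have /andP[bm' _] := bm y.
  by rewrite expr2 ler_pM ?(ltW m0).
(* A large deficit needs only the crude bound [M + QM * M] on the slope; a small one places [y]
   within a multiple of the square root of the deficit from [T x]. *)
have [far|near] := leP (m ^+ 2 / 2) D0.
  left; apply: (@le_trans _ _ ((M + QM * M) ^+ 2)).
    rewrite -[leLHS]real_normK ?num_real// ler_sqr ?nnegrE//; last first.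
      by rewrite addr_ge0 ?(ltW M0)// mulr_ge0 ?(ltW M0).
    have h1 : 0 <= a x * g y <= M.
      by rewrite mulr_ge0 ?(ltW ax)//= -[leRHS]mulr1 ler_pM ?(ltW ax).
    have h2 : 0 <= g (T x) * Q x * b y <= QM * M.
      rewrite !mulr_ge0 ?(ltW Q0) ?(ltW bx)//= ler_pM ?mulr_ge0 ?(ltW Q0) ?(ltW bx)//.
      by rewrite -[leRHS]mul1r ler_pM ?(ltW Q0).
    have : 0 <= QM * M by rewrite mulr_ge0 ?(ltW M0).
    by rewrite /z ler_norml; move: h1 h2 => /andP[? ?] /andP[? ?] ?; apply/andP; split; lra.
  rewrite -mulrA -[leLHS]mulr1 ler_wpM2l ?sqr_ge0//.
  have h : 0 < m ^+ 2 / 2 by rewrite divr_gt0 ?exprn_gt0.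
  rewrite -(ler_pM2l h) mulr1 mulrA.
  have -> : m ^+ 2 / 2 * (2 / m ^+ 2) = 1 by field; rewrite gt_eqF.
  by rewrite mul1r.
right.
have cm : m ^+ 2 / 2 <= cos2 (x - y) by move: near mm; rewrite /D0; lra.
have yx : enorm (y - x) < pi / 2.
  rewrite ltNge; apply/negP; rewrite enormBC => /cos2_far c0.
  by move: cm; rewrite c0 leNgt divr_gt0 ?exprn_gt0.
have dist := near_target Dx yx cm (ltW near); rewrite -/D0 -/K1 in dist.
set e := enorm (y - T x) in dist; have e0 : 0 <= e by exact: enorm_ge0.
have h1 : `|g y - g (T x)| <= L * e by exact: gL.
have L0 : 0 <= L * e by apply: le_trans h1.
have h2 : `|cos2 (x - T x) - cos2 (x - y)| <= e.
  apply: le_trans (cos2_lipschitz _ _) _.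
  by rewrite opprB addrC addrA subrK.
(* At [y = T x] with zero deficit the slope vanishes, because [cos2 (x - T x) * Q x = a x ^+ 2]; the
   remaining terms are differences controlled by the distance and the deficit. *)
have zE : z = a x * (g y - g (T x)) + g (T x) * ((Q x / a x) * (cos2 (x - T x) - cos2 (x - y) - D0)).
  have -> : g (T x) * ((Q x / a x) * (cos2 (x - T x) - cos2 (x - y) - D0))
     = g (T x) * (cos2 (x - T x) * Q x / a x - Q x / a x * (a x * b y)).
    by rewrite /D0; field; rewrite gt_eqF.
  by rewrite target_mass /z; field; rewrite gt_eqF.
have Qa0 : 0 <= Q x / a x by rewrite divr_ge0 ?(ltW Q0) ?(ltW ax).
have Qa : Q x / a x <= QM / m.
  by rewrite ler_pM ?invr_ge0 ?(ltW Q0) ?(ltW ax)// lef_pV2 ?posrE//; case/andP: (am x).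
have zb : `|z| <= (M * L + QM / m) * e + (QM / m) * D0.
  rewrite zE; apply: le_trans (ler_normD _ _) _.
  have t1 : `|a x * (g y - g (T x))| <= M * (L * e).
    by rewrite normrM (gtr0_norm ax) ler_pM ?(ltW ax).
  have t2 : `|g (T x) * (Q x / a x * (cos2 (x - T x) - cos2 (x - y) - D0))| <= QM / m * (e + D0).
    rewrite normrM (ger0_norm gT0) -[leRHS]mul1r; apply: ler_pM => //.
    rewrite normrM (ger0_norm Qa0); apply: ler_pM => //.
    by apply: le_trans (ler_normB _ _) _; rewrite (ger0_norm D00) lerD2r.
  by move: t1 t2; rewrite mulrDl mulrDr; lra.
have QMm : 0 <= QM / m by rewrite divr_ge0 ?(ltW m0).
have ML : 0 <= (M * L + QM / m) * e.
  by rewrite mulrDl -mulrA; exact: addr_ge0 (mulr_ge0 (ltW M0) L0) (mulr_ge0 QMm e0).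
apply: (@le_trans _ _ (((M * L + QM / m) * e + (QM / m) * D0) ^+ 2)).
  by rewrite -[leLHS]real_normK ?num_real// ler_sqr ?nnegrE ?(addr_ge0 ML (mulr_ge0 QMm D00)).
apply: (@le_trans _ _ (2 * ((M * L + QM / m) ^+ 2 * e ^+ 2 + (QM / m) ^+ 2 * D0 ^+ 2))).
  have := sqr_ge0 ((M * L + QM / m) * e - (QM / m) * D0).
  by rewrite sqrrB sqrrD -!exprMn; lra.
have u1 := ler_wpM2l (sqr_ge0 (M * L + QM / m)) dist.
have u2 : (QM / m) ^+ 2 * D0 ^+ 2 <= (QM / m) ^+ 2 * (m ^+ 2 / 2 * D0).
  by rewrite ler_wpM2l ?sqr_ge0// expr2 ler_wpM2r// ltW.
rewrite /Kn; move: u1 u2.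
by move: ((M * L + QM / m) ^+ 2) ((QM / m) ^+ 2) (m ^+ 2 / 2) => *; lra.
Qed.

(* Raising [b] by [e g] and lowering [a] by the first-order effect [e g(T x) Q x]
   breaks the constraint by at most a multiple of [e ^+ 2], since near violations
   force [y] close to [T x]. *)
Lemma perturbed_constraint (g : 'rV[R]_d -> R) L :
    (forall x, 0 <= g x <= 1) -> (forall x y, `|g x - g y| <= L * enorm (x - y)) ->
  exists K e0, [/\ 0 <= K, 0 < e0, (forall e y, `|e| <= e0 -> 0 <= b y + e * g y) &
    forall e x y, `|e| <= e0 -> D x ->
      0 <= a x - e * (g (T x) * Q x) + K * e ^+ 2 /\
      cos2 (x - y) <= (a x - e * (g (T x) * Q x) + K * e ^+ 2) * (b y + e * g y)].
Proof.
move=> g01 gL; have [K K0 KP] := perturbation_slope g01 gL.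
have QM0 : 0 <= QM by rewrite addr_ge0 ?sqr_ge0// mulr_ge0 ?(ltW M0) ?(ltW C0).
(* The first bound on [e] keeps [b + e g >= m / 2], the second keeps the lowered [a] nonnegative.
   The added term pays [K / 4] for completing the square and [QM] for the product of both
   perturbations, divided by [m / 2]. *)
exists (2 / m * (QM + K / 4)), (Num.min (m / 2) (m / (QM + 1))).
have N0 : 0 <= 2 / m * (QM + K / 4).
  by rewrite mulr_ge0 ?divr_ge0 ?(ltW m0)// addr_ge0// divr_ge0 ?(ltW K0).
have bound (e u : R) : 0 <= u <= 1 -> - `|e| <= e * u <= `|e|.
  move=> /andP[u0 u1]; rewrite -ler_norml normrM (ger0_norm u0).
  by rewrite -[leRHS]mulr1 ler_wpM2l.
have bg0 e y : `|e| <= m / 2 -> m / 2 <= b y + e * g y.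
  move=> e1; have /andP[bm' _] := bm y.
  by have /andP[] := bound e _ (g01 y); lra.
split=> //.
- by rewrite lt_min !divr_gt0// ltr_wpDl.
- move=> e y; rewrite le_min => /andP[e1 _].
  by apply: le_trans (bg0 _ _ e1); rewrite divr_ge0 ?(ltW m0).
move=> e x y; rewrite le_min => /andP[e1 e2] Dx.
have /andP[gy0 gy1] := g01 y; have /andP[gT0 gT1] := g01 (T x).
have Qx := contact_mass_le Dx; have Q0 := contact_mass_gt0 x.
have /andP[am' _] := am x.
have bg := bg0 e y e1.
have aQ : 0 <= a x - e * (g (T x) * Q x) + (2 / m * (QM + K / 4)) * e ^+ 2.
  apply: addr_ge0; last exact: mulr_ge0 N0 (sqr_ge0 e).
  have : `|e * (g (T x) * Q x)| <= m.
    rewrite normrM (ger0_norm (mulr_ge0 gT0 (ltW Q0))).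
    apply: (@le_trans _ _ (m / (QM + 1) * (QM + 1))); last by rewrite divfK// gt_eqF// ltr_wpDl.
    apply: ler_pM => //; first by rewrite mulr_ge0 ?(ltW Q0).
    apply: (@le_trans _ _ (1 * QM)); last by lra.
    by rewrite ler_pM ?(ltW Q0).
  by rewrite ler_norml => /andP[_ ?]; lra.
split=> //.
have := KP x y Dx.
set D0 := a x * b y - cos2 (x - y); set z := a x * g y - g (T x) * Q x * b y => zK.
have h1 : 0 <= D0 + e * z + e ^+ 2 * (K / 4).
  rewrite -(pmulr_lge0 _ K0).
  have -> : (D0 + e * z + e ^+ 2 * (K / 4)) * K =
     (K * D0 - z ^+ 2) + (z + e * K / 2) ^+ 2 by field.
  by rewrite addr_ge0 ?sqr_ge0// subr_ge0.
have h2 : (QM + K / 4) * e ^+ 2 <= (2 / m * (QM + K / 4)) * e ^+ 2 * (b y + e * g y).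
  apply: (@le_trans _ _ ((2 / m * (QM + K / 4)) * e ^+ 2 * (m / 2))); last first.
    by apply: ler_wpM2l => //; exact: mulr_ge0 N0 (sqr_ge0 e).
  by rewrite le_eqVlt; apply/orP; left; apply/eqP; field; rewrite gt_eqF.
have h3 : e ^+ 2 * (g (T x) * Q x * g y) <= QM * e ^+ 2.
  rewrite mulrC ler_wpM2r ?sqr_ge0//.
  apply: (@le_trans _ _ (1 * QM * 1)); last by rewrite mul1r mulr1.
  by apply: ler_pM => //; [rewrite !mulr_ge0 ?(ltW Q0)|apply: ler_pM; rewrite ?(ltW Q0)].
have -> : (a x - e * (g (T x) * Q x) + 2 / m * (QM + K / 4) * e ^+ 2) * (b y + e * g y)
   = cos2 (x - y) + (D0 + e * z) - e ^+ 2 * (g (T x) * Q x * g y)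
     + (2 / m * (QM + K / 4)) * e ^+ 2 * (b y + e * g y).
  by rewrite /D0 /z; ring.
by move: h1 h2 h3; rewrite mulrDl; lra.
Qed.

End perturbation.

(** * First variation of the dual problem *)

Section stationarity.
Context {R : realType} {d : nat}.
Implicit Types (m : fmeas R d) (D : set 'rV[R]_d).

Lemma bounded_integrable m D (f : 'rV[R]_d -> R) (M : R) :
    measurable (D : set (Rd R d)) -> measurable_fun (D : set (Rd R d)) f ->
    (forall x, D x -> `|f x| <= M) -> m.-integrable (D : set (Rd R d)) (EFin \o f).
Proof.
move=> mD mf fM; apply: measurable_bounded_integrable => //.
  by rewrite ltey_eq fin_num_measure.
exists M; split; first exact: num_real.
by move=> N MN x Dx /=; apply: le_trans (fM x Dx) (ltW MN).
Qed.

Lemma bounded_integral_fin m D (f : 'rV[R]_d -> R) (M : R) :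
    measurable (D : set (Rd R d)) -> measurable_fun (D : set (Rd R d)) f ->
    (forall x, D x -> `|f x| <= M) ->
  (\int[m]_(x in D) (f x)%:E)%E = (Rintegral m D f)%:E.
Proof.
move=> mD mf fM; rewrite /Rintegral fineK//.
by apply: integrable_fin_num => //; exact: bounded_integrable fM.
Qed.

Lemma slope_eq0 (J K e0 : R) : 0 <= K -> 0 < e0 ->
  (forall e, `|e| <= e0 -> 0 <= e * J + K * e ^+ 2) -> J = 0.
Proof.
move=> K0 e0_gt0 h; apply/eqP; apply: contraT => J0.
pose n := Num.min (e0 / `|J|) (2 * (K + 1))^-1.
have nJ : 0 < `|J| by rewrite normr_gt0.
have n0 : 0 < n by rewrite lt_min divr_gt0// invr_gt0 mulr_gt0// ltr_wpDl.
have := h (- (n * J)).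
rewrite normrN normrM (gtr0_norm n0) -ler_pdivlMr// ge_min lexx => /(_ isT).
rewrite sqrrN exprMn.
have -> : - (n * J) * J + K * (n ^+ 2 * J ^+ 2) = (n * J ^+ 2) * (K * n - 1) by ring.
rewrite pmulr_rge0; last by rewrite mulr_gt0// exprn_even_gt0.
have : K * n <= K * (2 * (K + 1))^-1 by rewrite ler_wpM2l// ge_min lexx orbT.
have : K * (2 * (K + 1))^-1 <= 2^-1.
  by rewrite ler_pdivrMr ?mulr_gt0 ?ltr_wpDl//; lra.
lra.
Qed.

(** Weak duality for the perturbed pair, minus the equality for the unperturbed one, leaves an
    inequality [0 <= e * J + K * e ^+ 2]. It holds for both signs of [e], so the slope is 0. *)
Lemma dual_stationarity (m1 m2 : fmeas R d) (H : R) (a b : 'rV[R]_d -> R) D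
    (P : 'rV[R]_d -> 'rV[R]_d) (m M C : R) (g : 'rV[R]_d -> R) (L : R) :
    0 < m -> 1 <= C ->
    (forall x, m <= a x <= M) -> (forall x, m <= b x <= M) ->
    (forall x y, cos2 (x - y) <= a x * b y) ->
    (forall x, D x -> forall h, a (x + h) <= a x + dot (P x) h + C * enorm h ^+ 2) ->
    measurable_fun [set: Rd R d] a -> measurable_fun [set: Rd R d] b ->
    measurable (D : set (Rd R d)) -> m1 (~` D) = 0%E ->
    measurable_fun (D : set (Rd R d)) (contact_target a P : Rd R d -> Rd R d) ->
    measurable_fun (D : set (Rd R d)) (contact_mass a P) ->
    (forall A B : 'rV[R]_d -> \bar R,
      measurable_fun [set: Rd R d] A -> measurable_fun [set: Rd R d] B ->
      (forall x, 0 <= A x)%E -> (forall x, 0 <= B x)%E ->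
      (forall x y, A x = +oo \/ B y = +oo \/ (cos2 (x - y))%:E <= A x * B y)%E ->
      (m1 setT + m2 setT <= H%:E + \int[m1]_x A x + \int[m2]_x B x)%E) ->
    fine (m1 setT) + fine (m2 setT) = H + Rintegral m1 setT a + Rintegral m2 setT b ->
    (forall x, 0 <= g x <= 1) -> (forall x y, `|g x - g y| <= L * enorm (x - y)) ->
  (\int[m2]_y (g y)%:E =
   \int[m1]_(x in D) (g (contact_target a P x) * contact_mass a P x)%:E)%E.
Proof.
move=> m0 C1 am bm ab aP ma mb mD D0 mT mQ WD EQ g01 gL.
have [K [e0 [K0 e0_gt0 pertb pert]]] := perturbed_constraint m0 C1 am bm ab aP g01 gL.
have mg : measurable_fun [set: Rd R d] g.
  by apply: rV_continuousT_measurable; exact: enorm_lipschitz_continuous gL.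
set T := contact_target a P in mT pert *; set Q := contact_mass a P in mQ pert *.
have mgT : measurable_fun (D : set (Rd R d)) (fun x => g (T x)).
  exact: (measurableT_comp mg mT).
pose J x := g (T x) * Q x.
have mJ : measurable_fun (D : set (Rd R d)) J by exact: measurable_funM.
have a_gt0 x : 0 < a x by case/andP: (am x) => h _; exact: lt_le_trans h.
have Q0 x : 0 < Q x by exact: contact_mass_gt0 am _.
have Jb x : D x -> `|J x| <= M ^+ 2 + C * M.
  move=> Dx; have /andP[g0 g1] := g01 (T x).
  rewrite ger0_norm ?mulr_ge0 ?(ltW (Q0 x))//.
  apply: (@le_trans _ _ (Q x)); last exact: (contact_mass_le m0 C1 am aP Dx).
  by rewrite ler_piMl ?(ltW (Q0 x)).
have ab1 x : `|a x| <= M by rewrite gtr0_norm//; case/andP: (am x).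
have bb1 x : `|b x| <= M.
  case/andP: (bm x) => h1 h2; rewrite ger0_norm//.
  exact: (le_trans (ltW m0) h1).
have gb x : `|g x| <= 1 by case/andP: (g01 x) => h1 h2; rewrite ger0_norm.
have maD : measurable_fun (D : set (Rd R d)) a by exact: measurable_funTS.
have intE1 (f : 'rV[R]_d -> R) N : measurable_fun [set: Rd R d] f -> (forall x, `|f x| <= N) ->
    Rintegral m1 setT f = Rintegral m1 D f.
  move=> mf fN; rewrite /Rintegral.
  rewrite (negligible_integral (N := ~` D : set (Rd R d)))//.
  - by rewrite setDE setCK setTI.
  - exact: measurableC.
  - exact: (@bounded_integrable m1 setT f N).
pose G := Rintegral m2 setT g.
pose JI := Rintegral m1 D J.
suff : G - JI = 0.
  move=> /eqP; rewrite subr_eq0 => /eqP GJ.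
  rewrite (@bounded_integral_fin m2 setT g 1)// (bounded_integral_fin m1 mD mJ Jb).
  by rewrite -/G GJ.
apply: (@slope_eq0 _ (K * fine (m1 D)) e0) => //.
  by rewrite mulr_ge0// fine_ge0.
move=> e ee0.
(* The expansion is available only on [D]; elsewhere the value [+oo] makes the constraint vacuous,
   and the complement of [D] is null. *)
pose A x : \bar R := if x \in D then (a x - e * J x + K * e ^+ 2)%:E else +oo%E.
pose B y : \bar R := (b y + e * g y)%:E.
have mA' : measurable_fun (D : set (Rd R d)) (fun x => a x - e * J x + K * e ^+ 2).
  by apply: measurable_funD => //; apply: measurable_funB => //; exact: measurable_funM.
have mA : measurable_fun [set: Rd R d] A.
  rewrite -(setUv (D : set (Rd R d))); apply/measurable_funU => //; first exact: measurableC.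
  split.
    have : measurable_fun (D : set (Rd R d)) (fun x => (a x - e * J x + K * e ^+ 2)%:E : \bar R).
      exact/measurable_EFinP.
    by apply: eq_measurable_fun => x xD; rewrite /A xD.
  have : measurable_fun (~` D : set (Rd R d)) (fun=> +oo%E : \bar R) by [].
  by apply: eq_measurable_fun => x; rewrite inE => xD; rewrite /A memNset.
have mB : measurable_fun [set: Rd R d] B.
  by apply/measurable_EFinP; apply: measurable_funD => //; exact: measurable_funM.
have A0 x : (0 <= A x)%E.
  rewrite /A; case: ifPn => // xD; rewrite lee_fin.
  by have [] := pert e x x ee0 (set_mem xD).
have B0 y : (0 <= B y)%E by rewrite lee_fin; exact: pertb.
have AB x y : (A x = +oo \/ B y = +oo \/ (cos2 (x - y))%:E <= A x * B y)%E.
  rewrite /A; case: ifPn => [xD'|_]; last by left.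
  by right; right; rewrite -EFinM lee_fin; have [] := pert e x y ee0 (set_mem xD').
have := WD A B mA mB A0 B0 AB.
have -> : (\int[m1]_x A x = (Rintegral m1 D (fun x => a x - e * J x + K * e ^+ 2))%:E)%E.
  rewrite (ge0_negligible_integral (N := ~` D : set (Rd R d)))//; last exact: measurableC.
  rewrite setDE setCK setTI.
  have fb x : D x -> `|a x - e * J x + K * e ^+ 2| <= M + `|e| * (M ^+ 2 + C * M) + `|K * e ^+ 2|.
    move=> Dx; apply: le_trans (ler_normD _ _) _; rewrite lerD2r.
    apply: le_trans (ler_normB _ _) _; apply: lerD => //.
    by rewrite normrM ler_wpM2l// Jb.
  rewrite -(bounded_integral_fin m1 mD mA' fb).
  by apply: eq_integral => x xD'; rewrite /A xD'.
have -> : (\int[m2]_x B x = (Rintegral m2 setT b + e * G)%:E)%E.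
  have beg x : setT x -> `|b x + e * g x| <= M + `|e| * 1.
    move=> _; apply: le_trans (ler_normD _ _) _; apply: lerD => //.
    by rewrite normrM ler_wpM2l.
  rewrite (@bounded_integral_fin m2 setT (fun x => b x + e * g x) (M + `|e| * 1))//; last first.
    by apply: measurable_funD => //; exact: measurable_funM.
  congr (_%:E); rewrite RintegralD//.
  - by rewrite RintegralZl//; exact: (@bounded_integrable m2 setT g 1).
  - exact: (@bounded_integrable m2 setT b M).
  - apply: (@bounded_integrable m2 setT (fun x => e * g x) (`|e| * 1)) => //.
      exact: measurable_funM.
    by move=> x _; rewrite normrM ler_wpM2l.
have -> : Rintegral m1 D (fun x => a x - e * J x + K * e ^+ 2) =
    Rintegral m1 D a - e * JI + K * e ^+ 2 * fine (m1 D).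
  have ia : m1.-integrable (D : set (Rd R d)) (EFin \o a).
    by apply: (@bounded_integrable m1 D a M).
  have iJ : m1.-integrable (D : set (Rd R d)) (EFin \o J) by exact: bounded_integrable Jb.
  have ieJ : m1.-integrable (D : set (Rd R d)) (EFin \o (fun x => e * J x)).
    apply: (@bounded_integrable m1 D _ (`|e| * (M ^+ 2 + C * M))) => //.
      exact: measurable_funM.
    by move=> x Dx; rewrite normrM ler_wpM2l// Jb.
  rewrite RintegralD//; last 2 first.
  - apply: (@bounded_integrable m1 D _ (M + `|e| * (M ^+ 2 + C * M))) => //.
      by apply: measurable_funB => //; exact: measurable_funM.
    move=> x Dx; apply: le_trans (ler_normB _ _) _; apply: lerD => //.
    by rewrite normrM ler_wpM2l// Jb.
  - exact: (@bounded_integrable m1 D _ `|K * e ^+ 2|).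
  by rewrite RintegralB// RintegralZl// Rintegral_cst.
rewrite -(fineK (fin_num_measure m1 _ measurableT)) -(fineK (fin_num_measure m2 _ measurableT)).
rewrite -!EFinD lee_fin EQ (intE1 a M ma ab1).
by move=> h; move: h; rewrite mulrBr; lra.
Qed.

End stationarity.

(** * Potentials along the geodesic *)

Section geodesic_potentials.
Context {R : realType} {d : nat}.
Variables (mu : R -> fmeas R d) (phi0 phi1 : 'rV[R]_d -> \bar R).
Hypotheses (geo : HK_geodesic mu) (pot : tight_optimal_pair (mu 0) (mu 1) phi0 phi1).
Implicit Types (x y : 'rV[R]_d) (s t r : R).

Local Notation a := (exp2 phi0).
Local Notation b := (expN2 phi1).
Local Notation Xi := (Xi phi0 phi1).
Local Notation U s := (hopf_lax a s).
Local Notation V s := (hopf_lax b (1 - s)).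
Local Notation H := (HK (mu 0) (mu 1) ^+ 2).
Local Notation mass s := (fine (mu s setT)).
Local Notation I0 := (fine (\int[mu 0]_x a x)%E).
Local Notation I1 := (fine (\int[mu 1]_x b x)%E).

Let a0 := exp2_ge0 phi0.
Let b0 := expN2_ge0 phi1.
Let lsca : lower_semicontinuous a. Proof. by case: pot => -[/lsc_exp2]. Qed.
Let lscb : lower_semicontinuous b. Proof. by case: pot => -[_ /lsc_expN2]. Qed.
Let ab : dual_pair a b. Proof. by case: pot => _ _ /tight_dual_pair. Qed.
Let ma : measurable_fun [set: Rd R d] a. Proof. exact: rV_lsc_measurable. Qed.
Let mb : measurable_fun [set: Rd R d] b. Proof. exact: rV_lsc_measurable. Qed.

Let massE (m : fmeas R d) : m setT = (fine (m setT))%:E.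
Proof. by rewrite fineK// fin_num_measure. Qed.

Lemma geodesic_HKsq s t : 0 <= s <= 1 -> 0 <= t <= 1 ->
  HKsq (mu s) (mu t) = ((t - s) ^+ 2 * H)%:E.
Proof.
move=> s01 t01; rewrite -HK_sqr geo// exprMn real_normK ?num_real//.
by rewrite -sqrrN opprB.
Qed.

Let IaE : (\int[mu 0]_x a x = I0%:E)%E.
Proof.
rewrite fineK// ge0_fin_numE; first by case: pot => _ _ _ [].
exact: integral_ge0.
Qed.

Let IbE : (\int[mu 1]_x b x = I1%:E)%E.
Proof.
rewrite fineK// ge0_fin_numE; first by case: pot => _ _ _ [].
exact: integral_ge0.
Qed.

Let integrable_fin (m : fmeas R d) (f : 'rV[R]_d -> \bar R) (r : R) :
  measurable_fun [set: Rd R d] f -> (forall x, 0 <= f x)%E ->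
  (\int[m]_x f x = r%:E)%E -> m.-integrable setT f.
Proof.
move=> mf f0 fr; apply/integrableP; split=> //.
by under eq_integral => x _ do rewrite gee0_abs//; rewrite fr ltry.
Qed.

Let integrable_one (m : fmeas R d) : m.-integrable (setT : set (Rd R d)) (fun=> 1%E).
Proof. exact: (finite_measure_integrable_cst m 1). Qed.

Lemma dual_value : H = mass 0 + mass 1 - I0 - I1.
Proof.
have [_ _ _ _] := pot.
have ia : (mu 0).-integrable (setT : set (Rd R d)) a by exact: integrable_fin IaE.
have ib : (mu 1).-integrable (setT : set (Rd R d)) b by exact: integrable_fin IbE.
have -> : (\int[mu 0]_x xi0 phi0 x = (2^-1 * (I0 - mass 0))%:E)%E.
  rewrite /xi0 integralZl//; last exact: (integrableB measurableT ia (integrable_one _)).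
  rewrite (integralB measurableT ia (integrable_one _)) integral_cst// mul1e.
  by rewrite [X in (X - _)%E]IaE [X in (_ - X)%E]massE -!EFinM.
have -> : (\int[mu 1]_x xibar1 phi1 x = (2^-1 * (mass 1 - I1))%:E)%E.
  rewrite /xibar1 integralZl//; last exact: (integrableB measurableT (integrable_one _) ib).
  rewrite (integralB measurableT (integrable_one _) ib) integral_cst// mul1e.
  by rewrite [X in (_ - X)%E]IbE [X in (X - _)%E]massE -!EFinM.
by rewrite -EFinB => -[]; lra.
Qed.

Section at_time.
Variable s : R.
Hypothesis s01 : 0 < s < 1.

Let s_gt0 : 0 < s. Proof. by case/andP: s01. Qed.
Let s_lt1 : s < 1. Proof. by case/andP: s01. Qed.
Let s1_gt0 : 0 < 1 - s. Proof. by rewrite subr_gt0. Qed.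
Let s01' : 0 < 1 - s < 1. Proof. by rewrite s1_gt0/= ltrBlDr ltrDl. Qed.
Let in01 : 0 <= s <= 1. Proof. by rewrite !ltW. Qed.

Lemma hopf_lax_measurable (c : 'rV[R]_d -> \bar R) q : (forall x, 0 <= c x)%E -> 0 < q < 1 ->
  measurable_fun [set: Rd R d] (hopf_lax c q).
Proof. by move=> c0 q01; apply: rV_continuousT_measurable; exact: hopf_lax_continuous. Qed.

Lemma hopf_lax_norm_le (c : 'rV[R]_d -> \bar R) q x : (forall x, 0 <= c x)%E -> 0 < q < 1 ->
  `|hopf_lax c q x| <= (1 - q)^-1.
Proof. by move=> c0 q01; rewrite ger0_norm ?hopf_lax_ge0// hopf_lax_le_max. Qed.

Let intUE : (\int[mu s]_x (U s x)%:E = (Rintegral (mu s) setT (U s))%:E)%E.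
Proof.
apply: (@bounded_integral_fin _ _ (mu s) setT (U s) (1 - s)^-1) => //.
  exact: hopf_lax_measurable.
by move=> x _; exact: hopf_lax_norm_le.
Qed.

Let intVE : (\int[mu s]_x (V s x)%:E = (Rintegral (mu s) setT (V s))%:E)%E.
Proof.
apply: (@bounded_integral_fin _ _ (mu s) setT (V s) (1 - (1 - s))^-1) => //.
  exact: hopf_lax_measurable.
by move=> x _; exact: hopf_lax_norm_le.
Qed.

Let affine_int (m : fmeas R d) (c : 'rV[R]_d -> \bar R) (q I : R) : 0 < q < 1 ->
  measurable_fun [set: Rd R d] c -> (forall x, 0 <= c x)%E -> (\int[m]_x c x = I%:E)%E ->
  (\int[m]_x ((1 - q)%:E + q%:E * c x) = ((1 - q) * fine (m setT) + q * I)%:E)%E.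
Proof.
move=> /andP[q0 q1] mc c0 cI; have q1' : 0 <= 1 - q by rewrite subr_ge0 ltW.
rewrite ge0_integralD//; last 2 first.
- by move=> x _; rewrite mule_ge0// lee_fin ltW.
- exact: emeasurable_funM.
rewrite integral_cst// ge0_integralZl// ?lee_fin ?(ltW q0)// cI.
by rewrite [X in (_ * X + _)%E]massE -!EFinM -EFinD.
Qed.

(** The supremum defining [U] makes [1 - s + s a] at time 0 and [U] at time [s] an admissible dual
    pair. *)
Let dual0 : mass 0 + mass s <= s ^+ 2 * H + ((1 - s) * mass 0 + s * I0)
  + Rintegral (mu s) setT (U s).
Proof.
have zero01 : 0 <= (0 : R) <= 1 by rewrite lexx ler01.
have := @weak_duality _ _ (mu 0) (mu s)
  (fun x => ((1 - s)%:E + s%:E * a x)%E) (fun x => (U s x)%:E).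
rewrite geodesic_HKsq// subr0 intUE (affine_int s01 ma a0 IaE) [X in (X + _ <= _)%E]massE [X in (_ + X <= _)%E]massE -!EFinD lee_fin; apply.
- by apply: emeasurable_funD => //; exact: emeasurable_funM.
- by apply/measurable_EFinP; exact: hopf_lax_measurable.
- by move=> x; rewrite adde_ge0 ?mule_ge0// lee_fin ltW.
- by move=> x; rewrite lee_fin hopf_lax_ge0.
- move=> x y; have [ax|ax] := eqVneq (a x) +oo%E.
    by left; rewrite ax gt0_muley ?lte_fin// addey.
  right; right; have [-> w0] := weight_source s01 (a0 x) ax.
  rewrite -EFinM lee_fin ler_pdivlMl// mulrC cos2BC.
  exact: hopf_lax_ub.
Qed.

Let dual1 : mass s + mass 1 <= (1 - s) ^+ 2 * H + Rintegral (mu s) setT (V s)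
  + (s * mass 1 + (1 - s) * I1).
Proof.
have one01 : 0 <= (1 : R) <= 1 by rewrite lexx ler01.
have sE : 1 - (1 - s) = s by ring.
have := @weak_duality _ _ (mu s) (mu 1)
  (fun x => (V s x)%:E) (fun x => ((1 - (1 - s))%:E + (1 - s)%:E * b x)%E).
rewrite geodesic_HKsq// intVE (affine_int s01' mb b0 IbE) sE [X in (X + _ <= _)%E]massE [X in (_ + X <= _)%E]massE -!EFinD lee_fin; apply.
- by apply/measurable_EFinP; exact: hopf_lax_measurable.
- by apply: emeasurable_funD => //; exact: emeasurable_funM.
- by move=> x; rewrite lee_fin hopf_lax_ge0.
- by move=> x; rewrite adde_ge0 ?mule_ge0// lee_fin ltW.
- move=> x y; have [bx|bx] := eqVneq (b y) +oo%E.
    by right; left; rewrite bx gt0_muley ?lte_fin// addey.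
  right; right; have := weight_source s01' (b0 y) bx; rewrite sE => -[-> w0].
  rewrite -EFinM lee_fin ler_pdivlMr//.
  exact: hopf_lax_ub.
Qed.

Let intUV : (1 - s) * Rintegral (mu s) setT (U s) + s * Rintegral (mu s) setT (V s) =
  Rintegral (mu s) setT (fun x => (1 - s) * U s x + s * V s x).
Proof.
have iU : (mu s).-integrable (setT : set (Rd R d)) (EFin \o U s).
  apply: (@bounded_integrable _ _ (mu s) setT (U s) (1 - s)^-1) => //.
    exact: hopf_lax_measurable.
  by move=> x _; exact: hopf_lax_norm_le.
have iV : (mu s).-integrable (setT : set (Rd R d)) (EFin \o V s).
  apply: (@bounded_integrable _ _ (mu s) setT (V s) (1 - (1 - s))^-1) => //.
    exact: hopf_lax_measurable.
  by move=> x _; exact: hopf_lax_norm_le.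
rewrite RintegralD//; first by rewrite !RintegralZl.
- by apply: (integrableZl _ (1 - s) iU).
- by apply: (integrableZl _ s iV).
Qed.

Let WS := fun x => (1 - s) * U s x + s * V s x.

Let WS_measurable : measurable_fun [set: Rd R d] WS.
Proof.
by apply: measurable_funD; apply: measurable_funM => //; exact: hopf_lax_measurable.
Qed.

Let WS_le1 x : `|WS x| <= 1.
Proof.
rewrite ger0_norm ?hopf_lax_order//.
by rewrite /WS addr_ge0// mulr_ge0 ?hopf_lax_ge0// ltW.
Qed.

Let int_defect_ge0 : 0 <= Rintegral (mu s) setT (fun x => 1 - WS x).
Proof.
by apply: Rintegral_ge0 => x _; rewrite subr_ge0; apply: le_trans (ler_norm _) (WS_le1 x).
Qed.

Let int_defect : Rintegral (mu s) setT (fun x => 1 - WS x) =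
  mass s - ((1 - s) * Rintegral (mu s) setT (U s) + s * Rintegral (mu s) setT (V s)).
Proof.
rewrite RintegralB// ?intUV ?Rintegral_cst ?mul1r//.
- exact: (integrable_one (mu s)).
- exact: (@bounded_integrable _ _ (mu s) setT WS 1).
Qed.

(** In [(1 - s)] times [dual0] plus [s] times [dual1] the terms in [H] add up to [s (1 - s) H],
    which [dual_value] cancels against the end terms. What remains is the reverse of the integrated
    [hopf_lax_order], so both inequalities are equalities. *)
Let dual_equality :
  Rintegral (mu s) setT (U s) = mass s - s ^+ 2 * H + s * (mass 0 - I0) /\
  Rintegral (mu s) setT (V s) = mass s - (1 - s) ^+ 2 * H + (1 - s) * (mass 1 - I1).
Proof.
have := int_defect_ge0; rewrite int_defect.
have := dual0; have := dual1; have := dual_value.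
move: (Rintegral _ _ _) (Rintegral _ _ _) (mass 0) (mass 1) (mass s) I0 I1 H => IU IV m0 m1 ms i0 i1 h hE.
set p := IU - (ms - s ^+ 2 * h + s * (m0 - i0)).
set q := IV - (ms - (1 - s) ^+ 2 * h + (1 - s) * (m1 - i1)) => h1 h0 hd.
have p0 : 0 <= p by rewrite /p; lra.
have q0 : 0 <= q by rewrite /q; lra.
have sum0 : (1 - s) * p + s * q <= 0.
  have -> : (1 - s) * p + s * q = - (ms - ((1 - s) * IU + s * IV)) by rewrite /p /q hE; ring.
  by rewrite oppr_le0.
have := mulr_ge0 (ltW s1_gt0) p0; have := mulr_ge0 (ltW s_gt0) q0 => sq sp.
have /eqP : (1 - s) * p = 0 by lra.
have /eqP : s * q = 0 by lra.
rewrite !mulf_eq0 (gt_eqF s_gt0) (gt_eqF s1_gt0)/= => /eqP q00 /eqP p00.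
by split; [move: p00; rewrite /p; lra|move: q00; rewrite /q; lra].
Qed.

Lemma integral_hopf_lax0 :
  Rintegral (mu s) setT (U s) = mass s - s ^+ 2 * H + s * (mass 0 - I0).
Proof. by case: dual_equality. Qed.

Lemma integral_hopf_lax1 :
  Rintegral (mu s) setT (V s) = mass s - (1 - s) ^+ 2 * H + (1 - s) * (mass 1 - I1).
Proof. by case: dual_equality. Qed.

Let lsc0 : lower_semicontinuous phi0. Proof. by case: pot => -[]. Qed.
Let usc1 : upper_semicontinuous phi1. Proof. by case: pot => -[]. Qed.
Let phi1E : forall x1, phi1 x1 =
  ereal_inf [set phi0 x0 + L1 (x1 - x0)%R | x0 in eball x1 (pi / 2)]%E.
Proof. by case: pot. Qed.

Lemma contact_full : mu s (~` Xi s) = 0%E.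
Proof.
have mW : measurable_fun [set: Rd R d] (EFin \o (fun x => 1 - WS x)).
  by apply/measurable_EFinP; exact: measurable_funB.
have W0 : (\int[mu s]_x `|(EFin \o (fun x => 1 - WS x)%R) x| = 0)%E.
  apply: (@eq_trans _ _ (\int[mu s]_x ((1 - WS x)%:E))%E).
    apply: eq_integral => x _; rewrite gee0_abs// lee_fin subr_ge0.
    exact: le_trans (ler_norm _) (WS_le1 x).
  rewrite (@bounded_integral_fin _ _ (mu s) setT _ 2)//; last 2 first.
  - exact: measurable_funB.
  - by move=> x _; apply: le_trans (ler_normB _ _) _; rewrite normr1 -[leRHS]/(1 + 1) lerD2l.
  rewrite int_defect integral_hopf_lax0 integral_hopf_lax1; congr (_%:E).
  by rewrite dual_value; ring.
have /ae_eq_integral_abs := W0.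
move=> /(_ measurableT mW)[N [mN N0 sub]].
have mXi := Xi_measurable lsc0 usc1 s01.
apply: (subset_measure0 (measurableC mXi) mN _ N0) => x Xix; apply: sub => /= h.
apply: Xix; apply/(XiE lsc0 usc1 x s01).
by have [/eqP] := h I; rewrite subr_eq0 => /eqP.
Qed.

Lemma supp_contact : supp (mu s) `<=` Xi s.
Proof.
have cXi := Xi_closed lsc0 usc1 s01.
move=> x xmu; apply: contrapT => nXi.
have /= := xmu _ (closed_openC cXi) nXi.
by rewrite contact_full ltxx.
Qed.


End at_time.

End geodesic_potentials.

(** * First variation at the Hopf-Lax potentials between two interior times *)

Section stationarity_of_hopf_lax.
Context {R : realType} {d : nat}.
Variables (a b : 'rV[R]_d -> \bar R) (s t : R).
Hypotheses (a0 : forall x, (0 <= a x)%E) (b0 : forall x, (0 <= b x)%E).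
Hypothesis ab : dual_pair a b.
Hypotheses (s0 : 0 < s) (st : s < t) (t1 : t < 1).

Local Notation U := (hopf_lax a s).
Local Notation V := (hopf_lax b (1 - t)).

Let s01 : 0 < s < 1. Proof. by rewrite s0 (lt_trans st). Qed.
Let t01 : 0 < 1 - t < 1. Proof. by rewrite subr_gt0 t1 ltrBlDr ltrDl (lt_trans s0). Qed.
Let s1 : 0 < 1 - s. Proof. by rewrite subr_gt0 (lt_trans st). Qed.
Let t1' : 0 < 1 - t. Proof. by rewrite subr_gt0. Qed.
Let t0 : 0 < t. Proof. exact: lt_trans st. Qed.
Let ts : 0 < t - s. Proof. by rewrite subr_gt0. Qed.

(** [A] and [B] are [1 + 2 (t - s) xi_s] and [1 - 2 (t - s) xibar_t]. Both times being interior
    keeps them away from 0 and infinity, as the perturbation requires. *)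
Let A x := (t - (t - s) * U x) / s.
Let B y := (1 - s - (t - s) * V y) / (1 - t).

Let mU : measurable_fun [set: Rd R d] U.
Proof. by apply: rV_continuousT_measurable; exact: hopf_lax_continuous. Qed.

Let mV : measurable_fun [set: Rd R d] V.
Proof. by apply: rV_continuousT_measurable; exact: hopf_lax_continuous. Qed.

Let U_bound x : 0 <= U x <= (1 - s)^-1.
Proof. by rewrite hopf_lax_ge0//= hopf_lax_le_max. Qed.

Let V_bound x : 0 <= V x <= t^-1.
Proof.
rewrite hopf_lax_ge0//=; have -> : t^-1 = (1 - (1 - t))^-1 by congr (_^-1); ring.
exact: hopf_lax_le_max.
Qed.

Let A_bound x : (1 - t) / (1 - s) <= A x <= t / s.
Proof.
have /andP[u0 u1] := U_bound x; rewrite /A.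
have -> : (1 - t) / (1 - s) = (t - (t - s) * (1 - s)^-1) / s.
  by field; rewrite !gt_eqF.
rewrite !ler_pM2r ?invr_gt0// lerD2l lerN2 ler_pM2l// u1/=.
by rewrite lerBlDr lerDl mulr_ge0// ltW.
Qed.

Let B_bound x : s / t <= B x <= (1 - s) / (1 - t).
Proof.
have /andP[u0 u1] := V_bound x; rewrite /B.
have -> : s / t = (1 - s - (t - s) * t^-1) / (1 - t).
  by field; rewrite !gt_eqF.
rewrite !ler_pM2r ?invr_gt0// lerD2l lerN2 ler_pM2l// u1/=.
by rewrite lerBlDr lerDl mulr_ge0// ltW.
Qed.

Let AB x y : cos2 (x - y) <= A x * B y.
Proof.
rewrite -(ler_pM2l (mulr_gt0 t1' s0)).
apply: le_trans (hopf_lax_constraint a0 b0 ab x y s0 st t1) _.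
by rewrite /A /B le_eqVlt; apply/orP; left; apply/eqP; field; rewrite !gt_eqF.
Qed.

Let int_affine (m : fmeas R d) (f : 'rV[R]_d -> R) (u v w M : R) :
    measurable_fun [set: Rd R d] f -> (forall x, 0 <= f x <= M) ->
  Rintegral m setT (fun x => (u - v * f x) / w) =
  (u * fine (m setT) - v * Rintegral m setT f) / w.
Proof.
move=> mf fM.
have fi : m.-integrable (setT : set (Rd R d)) (EFin \o f).
  apply: (@bounded_integrable _ _ m setT f M) => // x _.
  by have /andP[f0 ?] := fM x; rewrite ger0_norm.
have vi : m.-integrable (setT : set (Rd R d)) (EFin \o (fun x => v * f x)).
  exact: (integrableZl _ v fi).
have ui : m.-integrable (setT : set (Rd R d)) (EFin \o (fun=> u)).
  exact: (finite_measure_integrable_cst m u).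
transitivity (Rintegral m setT (fun x => w^-1 * (u - v * f x))).
  by apply: eq_Rintegral => x _; rewrite mulrC.
rewrite RintegralZl//; last exact: (integrableB _ ui vi).
rewrite RintegralB// RintegralZl// Rintegral_cst// mulrC//.
Qed.

(** The maps enter only through their cone formulas, so the lemma serves both time directions; the
    equation after [HKsq] states optimality of the pair [A, B]. *)
Lemma hopf_lax_stationarity (m1 m2 : fmeas R d) (H C : R) (D : set 'rV[R]_d)
    (p T : 'rV[R]_d -> 'rV[R]_d) (q : 'rV[R]_d -> R) (g : 'rV[R]_d -> R) (L : R) :
    HKsq m1 m2 = H%:E ->
    fine (m1 setT) + fine (m2 setT) = H +
      (t * fine (m1 setT) - (t - s) * Rintegral m1 setT U) / s +
      ((1 - s) * fine (m2 setT) - (t - s) * Rintegral m2 setT V) / (1 - t) ->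
    measurable (D : set (Rd R d)) -> m1 (~` D) = 0%E ->
    (forall x, D x -> contact a b s x) ->
    (forall x, D x -> expands (hl_potential a s) x (p x) C) ->
    (forall x, D x -> T x = cone_pt (U x) (hopf_lax b (1 - s) x) s x (p x) t) ->
    (forall x, D x -> q x ^+ 2 = cone_dot (U x) (hopf_lax b (1 - s) x) s (p x) t t) ->
    measurable_fun (D : set (Rd R d)) (T : Rd R d -> Rd R d) ->
    measurable_fun (D : set (Rd R d)) q ->
    (forall x, 0 <= g x <= 1) -> (forall x y, `|g x - g y| <= L * enorm (x - y)) ->
  (\int[m2]_y (g y)%:E = \int[m1]_(x in D) (g (T x) * q x ^+ 2)%:E)%E.
Proof.
move=> m12 eqH mD D0 cD pD TE qE mT mq g01 gL.
(* This is the gradient of [A]; it makes [contact_target] the transport map and [contact_mass] the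
   squared growth. *)
pose P x := (2 * (t - s)) *: p x.
have Are x : D x -> A x = cone_re (U x) (hopf_lax b (1 - s) x) t.
  by move=> /cD cx; rewrite (cone_reE s01 cx).
have A_gt0 x : 0 < A x.
  by have /andP[+ _] := A_bound x; apply: lt_le_trans; rewrite divr_gt0.
have targetE x : D x -> T x = contact_target A P x.
  have -> : contact_target A P x = x + vatan (((t - s) / A x) *: p x).
    rewrite /contact_target /P scalerA.
    by have -> : (2 * A x)^-1 * (2 * (t - s)) = (t - s) / A x by field; rewrite gt_eqF.
  by move=> Dx; rewrite TE// /cone_pt -(Are x Dx) A_gt0.
have massE x : D x -> q x ^+ 2 = contact_mass A P x.
  have -> : contact_mass A P x = A x ^+ 2 + (t - s) ^+ 2 * enorm (p x) ^+ 2.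
    by rewrite /contact_mass /P enormZ (exprMn 2 `|_|) real_normK ?num_real//; field.
  by move=> Dx; rewrite qE// /cone_dot -Are//; ring.
transitivity (\int[m1]_(x in D) (g (contact_target A P x) * contact_mass A P x)%:E)%E; last first.
  by apply: eq_integral => x; rewrite inE => Dx; rewrite targetE// massE.
apply: (@dual_stationarity _ _ m1 m2 H A B D P
  (Num.min ((1 - t) / (1 - s)) (s / t)) (Num.max (t / s) ((1 - s) / (1 - t)))
  (Num.max 1 (2 * (t - s) * C)) g L) => //.
- by rewrite lt_min !divr_gt0.
- by rewrite le_max lexx.
- by move=> x; have /andP[? ?] := A_bound x; rewrite ge_min le_max; apply/andP; split; apply/orP; left.
- by move=> x; have /andP[? ?] := B_bound x; rewrite ge_min le_max; apply/andP; split; apply/orP; right.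
- move=> x Dx h; have /ler_normlP[_] := pD x Dx h.
  rewrite /hl_potential /A /P dotZl.
  move: (U x) (U (x + h)) (dot (p x) h) => u uh ph hC.
  apply: le_trans (_ : (t - (t - s) * u) / s + 2 * (t - s) * ph + 2 * (t - s) * C * enorm h ^+ 2 <= _); last first.
    by rewrite lerD2l ler_wpM2r ?sqr_ge0// le_max lexx orbT.
  have -> : (t - (t - s) * uh) / s = (t - (t - s) * u) / s +
      2 * (t - s) * ((1 - uh) / (2 * s) - (1 - u) / (2 * s)) by field; rewrite gt_eqF.
  rewrite -addrA lerD2l -(mulrA _ C) -mulrDr ler_pM2l ?mulr_gt0//.
  by rewrite -lerBlDl.
- apply: measurable_funM => //; apply: measurable_funB => //; exact: measurable_funM.
- apply: measurable_funM => //; apply: measurable_funB => //; exact: measurable_funM.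
- by apply: eq_measurable_fun mT => x; rewrite inE => Dx; rewrite targetE.
- have mq2 : measurable_fun (D : set (Rd R d)) (fun x => q x ^+ 2) by exact: measurable_funX.
  by apply: eq_measurable_fun mq2 => x; rewrite inE => Dx; rewrite massE.
- move=> A' B' mA mB A0 B0 AB'; rewrite -m12; exact: weak_duality.
- by rewrite eqH (int_affine _ _ _ _ mU U_bound) (int_affine _ _ _ _ mV V_bound).
Qed.

End stationarity_of_hopf_lax.

(** * Measures produced by the transport-growth action *)

Section action.
Context {R : realType} {d : nat}.
Variables (phi0 phi1 : 'rV[R]_d -> \bar R).
Hypotheses (lsc0 : lower_semicontinuous phi0) (usc1 : upper_semicontinuous phi1).
Hypothesis phi1E : forall x1, phi1 x1 =
  ereal_inf [set phi0 x0 + L1 (x1 - x0)%R | x0 in eball x1 (pi / 2)]%E.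
Implicit Types (m nu : fmeas R d) (s t : R).

Local Notation Xi := (Xi phi0 phi1).
Local Notation T := (transport phi0).
Local Notation q := (growth phi0).

Lemma exists_action m s t : 0 < s < 1 -> 0 <= t <= 1 ->
  exists nu : fmeas R d, forall A : set (Rd R d), measurable A ->
    nu A = (\int[m]_(x in Xi s `&` T s t @^-1` A) (q s t x ^+ 2)%:E)%E.
Proof.
move=> s01 t01; have [M qM] := growth_bounded lsc0 usc1 phi1E s01 t01.
have mXi := Xi_measurable lsc0 usc1 s01.
have mq : measurable_fun (Xi s : set (Rd R d)) (fun x => q s t x ^+ 2).
  by apply: measurable_funX; exact: (growth_measurable lsc0 usc1 phi1E t s01).
apply: (@exists_weighted_image _ _ (Rd R d) (Rd R d) R m (Xi s) (T s t)
  (fun x => (q s t x ^+ 2)%:E)) => //.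
- exact: (transport_measurable lsc0 usc1 phi1E t s01).
- exact/measurable_EFinP.
- by move=> x _; rewrite lee_fin sqr_ge0.
rewrite (@bounded_integral_fin _ _ m (Xi s) _ M) ?ltry// => x cx.
by rewrite ger0_norm ?sqr_ge0// qM.
Qed.

Lemma integral_action m nu s t (f : 'rV[R]_d -> \bar R) : 0 < s < 1 ->
    (forall A : set (Rd R d), measurable A ->
      nu A = (\int[m]_(x in Xi s `&` T s t @^-1` A) (q s t x ^+ 2)%:E)%E) ->
    measurable_fun [set: Rd R d] f -> (forall y, 0 <= f y)%E ->
  (\int[nu]_y f y = \int[m]_(x in Xi s) (f (T s t x) * (q s t x ^+ 2)%:E))%E.
Proof.
move=> s01 nuE mf f0.
apply: (@integral_weighted_image _ _ (Rd R d) (Rd R d) R m (Xi s) (T s t)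
  (fun x => (q s t x ^+ 2)%:E)) => //.
- exact: (Xi_measurable lsc0 usc1 s01).
- exact: (transport_measurable lsc0 usc1 phi1E t s01).
- apply/measurable_EFinP; apply: measurable_funX.
  exact: (growth_measurable lsc0 usc1 phi1E t s01).
- by move=> x _; rewrite lee_fin sqr_ge0.
Qed.

End action.

(** * The given geodesic as an action between interior times *)

Section geodesic_action.
Context {R : realType} {d : nat}.
Variables (mu : R -> fmeas R d) (phi0 phi1 : 'rV[R]_d -> \bar R).
Hypotheses (geo : HK_geodesic mu) (pot : tight_optimal_pair (mu 0) (mu 1) phi0 phi1).
Implicit Types (x y : 'rV[R]_d) (s t : R).

Local Notation a := (exp2 phi0).
Local Notation b := (expN2 phi1).
Local Notation Xi := (Xi phi0 phi1).
Local Notation T := (transport phi0).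
Local Notation q := (growth phi0).
Local Notation U s x := (hopf_lax a s x).
Local Notation V s x := (hopf_lax b (1 - s) x).
Local Notation p s x := (grad (xir phi0 s) x).

Let a0 := exp2_ge0 phi0.
Let b0 := expN2_ge0 phi1.
Let lsc0 : lower_semicontinuous phi0. Proof. by case: pot => -[]. Qed.
Let usc1 : upper_semicontinuous phi1. Proof. by case: pot => -[]. Qed.
Let phi1E : forall x1, phi1 x1 =
  ereal_inf [set phi0 x0 + L1 (x1 - x0)%R | x0 in eball x1 (pi / 2)]%E.
Proof. by case: pot. Qed.
Let ab : dual_pair a b. Proof. exact: tight_dual_pair phi1E. Qed.

Let test_equality s t (g : 'rV[R]_d -> R) (L : R) : 0 < s < 1 -> 0 < t < 1 -> s != t ->
    (forall x, 0 <= g x <= 1) -> (forall x y, `|g x - g y| <= L * enorm (x - y)) ->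
  (\int[mu t]_y (g y)%:E = \int[mu s]_(x in Xi s) (g (T s t x) * q s t x ^+ 2)%:E)%E.
Proof.
move=> s01 t01 st g01 gL; have /andP[s0 s1] := s01; have /andP[t0 t1] := t01.
have s1' : 0 < 1 - s by rewrite subr_gt0.
have t1' : 0 < 1 - t by rewrite subr_gt0.
have s01' : 0 <= s <= 1 by rewrite !ltW.
have t01' : 0 <= t <= 1 by rewrite !ltW.
have mXi := Xi_measurable lsc0 usc1 s01.
have mT := transport_measurable lsc0 usc1 phi1E t s01.
have mq := growth_measurable lsc0 usc1 phi1E t s01.
have full := contact_full geo pot s01.
have HK2 := geodesic_HKsq geo s01' t01'.
have contactX x : Xi s x -> contact a b s x by move/(XiE lsc0 usc1 x s01).
have U_s := integral_hopf_lax0 geo pot s01; have V_s := integral_hopf_lax1 geo pot s01.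
have U_t := integral_hopf_lax0 geo pot t01; have V_t := integral_hopf_lax1 geo pot t01.
have HE := dual_value pot.
move: st; rewrite neq_lt => /orP[st|ts].
  apply: (hopf_lax_stationarity a0 b0 ab s0 st t1 HK2 _ mXi full) => //.
  - rewrite U_s V_t HE.
    move: (fine _) (fine _) (fine _) (fine _) (fine _) (fine _) => m0 m1 i0 i1 ms mt.
    by field; rewrite !gt_eqF.
  - by move=> x cx; have [+ _] := grad_expands lsc0 usc1 phi1E s01 cx; apply.
  - by move=> x cx; exact: (transportE lsc0 usc1).
  - by move=> x cx; exact: (growth_sqr lsc0 usc1).
(* For [t < s] the roles of [a] and [b] are exchanged and time is reversed; the gradient changes
   sign. *)
have e u : 1 - (1 - u) = u :> R by ring.
have ts' : 1 - s < 1 - t by rewrite ltrD2l ltrN2.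
have t0' : 1 - t < 1 by rewrite ltrBlDr ltrDl.
apply: (hopf_lax_stationarity b0 a0 (dual_pair_sym ab) s1' ts' t0' HK2 _ mXi full
  (p := fun x => - p s x)) => //.
- rewrite !e V_s U_t HE.
  move: (fine _) (fine _) (fine _) (fine _) (fine _) (fine _) => m0 m1 i0 i1 ms mt.
  by field; rewrite !gt_eqF.
- by move=> x cx; apply: contact_sym; exact: contactX.
- by move=> x cx; have [_] := grad_expands lsc0 usc1 phi1E s01 cx; apply.
- by move=> x cx; rewrite e cone_pt_sym; exact: (transportE lsc0 usc1).
- by move=> x cx; rewrite e cone_dot_sym; exact: (growth_sqr lsc0 usc1).
Qed.

Lemma geodesic_action s t : 0 < s < 1 -> 0 < t < 1 ->
  forall A : set (Rd R d), measurable A ->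
  mu t A = (\int[mu s]_(x in Xi s `&` T s t @^-1` A) (q s t x ^+ 2)%:E)%E.
Proof.
move=> s01 t01 A mA; have [st|st] := eqVneq s t.
  (* Equal times are outside the reach of stationarity: there the map is the identity with growth 1
     on the contact set, which has full measure. *)
  rewrite -st.
  have TE x : Xi s x -> T s s x = x.
    move=> cx; rewrite (transportE lsc0 usc1)// /cone_pt subrr mul0r scale0r.
    by rewrite /vatan scaler0 addr0 if_same.
  have qE x : Xi s x -> q s s x ^+ 2 = 1.
    move=> cx; have /(XiE lsc0 usc1 x s01) cx' := cx.
    rewrite (growth_sqr lsc0 usc1)// /cone_dot (cone_re_at_s cx').
    by rewrite subrr !mul0r addr0 mul1r.
  have -> : Xi s `&` T s s @^-1` A = Xi s `&` A.
    by apply/seteqP; split=> x/= [cx]; rewrite TE.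
  rewrite (@eq_integral _ _ _ _ _ (fun=> 1%E)); last first.
    by move=> x; rewrite inE => -[cx _]; rewrite qE.
  have mXi := Xi_measurable lsc0 usc1 s01.
  rewrite integral_cst ?mul1e; last exact: measurableI.
  rewrite setIC; apply: (eq_trans (measureDI (mu s) mA mXi)).
  rewrite -[RHS]add0e; congr (_ + _)%E.
  apply: (subset_measure0 (measurableD mA mXi) (measurableC mXi) _ (contact_full geo pot s01)).
  by move=> x [].
have t01' : 0 <= t <= 1 by case/andP: t01 => ? ?; rewrite !ltW.
have [nu nuE] := exists_action lsc0 usc1 phi1E (mu s) s01 t01'.
rewrite -nuE//; apply: finite_measure_unique_lipschitz => // g L g01 gL.
rewrite (test_equality s01 t01 st g01 gL).
rewrite (integral_action lsc0 usc1 phi1E s01 nuE)//.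
- by apply/measurable_EFinP; apply: rV_continuousT_measurable; exact: (enorm_lipschitz_continuous gL).
- by move=> y; rewrite lee_fin; case/andP: (g01 y).
Qed.

End geodesic_action.
(** * Geodesics generated by the potentials *)

(** With densities [w / Q1], [w / Q2] and [cos2 = w^2 / (Q1 Q2)] all logarithms cancel; what is left
    is the squared distance of two cone vectors with inner product [w]. *)
Lemma entropy_transport_cost {R : realType} {d : nat} (Q1 Q2 w r1 r2 : R) (z : 'rV[R]_d) :
    0 <= Q1 -> 0 <= Q2 -> 0 <= w -> 0 <= r1 -> 0 <= r2 -> r1 * Q1 = w -> r2 * Q2 = w ->
    (0 < w -> enorm z < pi / 2 /\ cos2 z = w ^+ 2 / (Q1 * Q2)) ->
  ((F r1)%:E * Q1%:E + (F r2)%:E * Q2%:E + 2%:E * L1 z * w%:E = (Q1 + Q2 - 2 * w)%:E)%E.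
Proof.
move=> Q10 Q20 w0 r10 r20 r1E r2E zE.
have F_deg r Q : r * Q = 0 -> F r * Q = Q.
  move=> /eqP; rewrite mulf_eq0 => /orP[]/eqP->; last by rewrite mulr0.
  by rewrite /F mul0r subrr add0r mul1r.
(* Without coupling mass the cost [L1] may be [+oo], but [+oo * 0 = 0]; mass without a partner costs
   [F 0 = 1] per unit. *)
have [w_eq0|w_neq0] := eqVneq w 0.
  rewrite w_eq0 in r1E r2E *.
  by rewrite mule0 adde0 -!EFinM -EFinD !F_deg// mulr0 subr0.
have w_gt0 : 0 < w by rewrite lt_def w_neq0.
have [z2 cz] := zE w_gt0.
have Q1_gt0 : 0 < Q1.
  by rewrite lt_def Q10 andbT; apply: contra_neq w_neq0 => Q1_0; rewrite -r1E Q1_0 mulr0.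
have Q2_gt0 : 0 < Q2.
  by rewrite lt_def Q20 andbT; apply: contra_neq w_neq0 => Q2_0; rewrite -r2E Q2_0 mulr0.
have r1E' : r1 = w / Q1 by rewrite -r1E mulfK ?gt_eqF.
have r2E' : r2 = w / Q2 by rewrite -r2E mulfK ?gt_eqF.
have lnc : 2 * ln (cos (enorm z)) = 2 * ln w - ln Q1 - ln Q2.
  have cz0 : 0 < cos (enorm z).
    by rewrite cos_gt0_pihalf// z2 andbT (lt_le_trans _ (enorm_ge0 z))// oppr_lt0 divr_gt0 ?pi_gt0.
  rewrite cos2_near// in cz.
  have := congr1 (@ln R) cz.
  rewrite lnXn// ln_div ?posrE ?exprn_gt0 ?mulr_gt0// lnXn// lnM ?posrE//.
  by rewrite !mulr2n; lra.
rewrite /L1 z2 -!EFinM -!EFinD; congr (_%:E).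
rewrite /F r1E' r2E' !ln_div ?posrE//.
move: (ln w) (ln Q1) (ln Q2) (ln (cos _)) lnc => lw l1 l2 lc lnc.
have -> : lc = (2 * lw - l1 - l2) / 2 by lra.
by field; rewrite !gt_eqF.
Qed.

(** * The Hellinger-Kantorovich distance between two images of one measure *)

Section weighted_images.
Context {R : realType} {d : nat}.
Variables (m : fmeas R d) (D : set 'rV[R]_d).
Hypothesis mD : measurable (D : set (Rd R d)).

Lemma weighted_image_density (nu : fmeas R d) (T : 'rV[R]_d -> 'rV[R]_d) (Q w r : 'rV[R]_d -> R) :
    measurable_fun (D : set (Rd R d)) (T : Rd R d -> Rd R d) ->
    measurable_fun (D : set (Rd R d)) Q -> (forall x, D x -> 0 <= Q x) ->
    (forall E : set (Rd R d), measurable E ->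
      nu E = (\int[m]_(x in D `&` T @^-1` E) (Q x)%:E)%E) ->
    measurable_fun [set: Rd R d] r -> (forall x, 0 <= r x) ->
    (forall x, D x -> r (T x) * Q x = w x) ->
  forall E : set (Rd R d), measurable E ->
  (\int[m]_(x in D `&` T @^-1` E) (w x)%:E = \int[nu]_(x in E) (r x)%:E)%E.
Proof.
move=> mT mQ Q0 nuE mr r0 rw E mE.
rewrite integral_mkcondr [RHS]integral_mkcond.
have mrE : measurable_fun [set: Rd R d] ((EFin \o r) \_ E).
  by apply/(measurable_restrictT _ _).1 => //; apply/measurable_EFinP; exact: measurable_funTS.
rewrite (@integral_weighted_image _ _ (Rd R d) (Rd R d) R m D T (EFin \o Q) mD mT _ _ nu _ nuE)//.
- apply: eq_integral => x; rewrite inE => Dx; rewrite /patch.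
  have -> : (x \in T @^-1` E) = (T x \in E) by apply/idP/idP; rewrite !inE.
  by case: ifPn => _; rewrite ?mul0e//= -EFinM rw.
- exact/measurable_EFinP.
- by move=> y; rewrite patchE; case: ifPn => // _; rewrite lee_fin.
Qed.

(** The dual pair [A, B] gives the lower bound and the image of [w m] under [(T1, T2)] the upper
    bound. They agree because [A] and [B] are themselves the marginal densities of that plan. *)
Lemma HKsq_weighted_images (nu1 nu2 : fmeas R d) (T1 T2 : 'rV[R]_d -> 'rV[R]_d)
    (Q1 Q2 w : 'rV[R]_d -> R) (A B : 'rV[R]_d -> \bar R) (M : R) :
    measurable_fun [set: Rd R d] (T1 : Rd R d -> Rd R d) ->
    measurable_fun [set: Rd R d] (T2 : Rd R d -> Rd R d) ->
    measurable_fun (D : set (Rd R d)) Q1 -> measurable_fun (D : set (Rd R d)) Q2 ->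
    measurable_fun (D : set (Rd R d)) w ->
    (forall x, D x -> 0 <= Q1 x <= M) -> (forall x, D x -> 0 <= Q2 x <= M) ->
    (forall x, D x -> 0 <= w x <= M) ->
    (forall E : set (Rd R d), measurable E ->
      nu1 E = (\int[m]_(x in D `&` T1 @^-1` E) (Q1 x)%:E)%E) ->
    (forall E : set (Rd R d), measurable E ->
      nu2 E = (\int[m]_(x in D `&` T2 @^-1` E) (Q2 x)%:E)%E) ->
    measurable_fun [set: Rd R d] A -> measurable_fun [set: Rd R d] B ->
    (forall x, 0 <= A x)%E -> (forall x, 0 <= B x)%E ->
    (forall x y, A x = +oo \/ B y = +oo \/ (cos2 (x - y))%:E <= A x * B y)%E ->
    (forall x, D x -> A (T1 x) * (Q1 x)%:E = (w x)%:E)%E ->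
    (forall x, D x -> B (T2 x) * (Q2 x)%:E = (w x)%:E)%E ->
    (forall x, D x -> 0 < w x -> enorm (T1 x - T2 x) < pi / 2 /\
      cos2 (T1 x - T2 x) = w x ^+ 2 / (Q1 x * Q2 x)) ->
  HKsq nu1 nu2 = (Rintegral m D (fun x => Q1 x + Q2 x - 2 * w x))%:E.
Proof.
move=> mT1 mT2 mQ1 mQ2 mw Q1M Q2M wM nu1E nu2E mA mB A0 B0 AB AQ BQ angleE.
have boundE (f : 'rV[R]_d -> R) : measurable_fun (D : set (Rd R d)) f ->
    (forall x, D x -> 0 <= f x <= M) ->
    (\int[m]_(x in D) (f x)%:E = (Rintegral m D f)%:E)%E /\
    m.-integrable (D : set (Rd R d)) (EFin \o f).
  move=> mf fM; split.
    apply: (@bounded_integral_fin _ _ m D f M) => // x Dx.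
    by case/andP: (fM x Dx) => f0 ?; rewrite ger0_norm.
  apply: (@bounded_integrable _ _ m D f M) => // x Dx.
  by case/andP: (fM x Dx) => f0 ?; rewrite ger0_norm.
have [Q1E iQ1] := boundE _ mQ1 Q1M; have [Q2E iQ2] := boundE _ mQ2 Q2M.
have [wE iw] := boundE _ mw wM.
have i2w : m.-integrable (D : set (Rd R d)) (EFin \o (fun x => 2 * w x)).
  exact: (integrableZl _ 2 iw).
have iQ12 : m.-integrable (D : set (Rd R d)) (EFin \o (fun x => Q1 x + Q2 x)).
  exact: (integrableD _ iQ1 iQ2).
have costE : Rintegral m D (fun x => Q1 x + Q2 x - 2 * w x) =
    Rintegral m D Q1 + Rintegral m D Q2 - 2 * Rintegral m D w.
  by rewrite RintegralB// RintegralD// RintegralZl.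
have Q1_0 x : D x -> 0 <= Q1 x by move/Q1M => /andP[].
have Q2_0 x : D x -> 0 <= Q2 x by move/Q2M => /andP[].
have w_0 x : D x -> 0 <= w x by move/wM => /andP[].
have mT1D : measurable_fun (D : set (Rd R d)) (T1 : Rd R d -> Rd R d) by exact: measurable_funTS.
have mT2D : measurable_fun (D : set (Rd R d)) (T2 : Rd R d -> Rd R d) by exact: measurable_funTS.
have int1 (f : 'rV[R]_d -> \bar R) : measurable_fun [set: Rd R d] f -> (forall x, 0 <= f x)%E ->
    (\int[nu1]_y f y = \int[m]_(x in D) (f (T1 x) * (Q1 x)%:E))%E.
  move=> mf f0.
  apply: (@integral_weighted_image _ _ (Rd R d) (Rd R d) R m D T1 (EFin \o Q1)) => //.
  exact/measurable_EFinP.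
have int2 (f : 'rV[R]_d -> \bar R) : measurable_fun [set: Rd R d] f -> (forall x, 0 <= f x)%E ->
    (\int[nu2]_y f y = \int[m]_(x in D) (f (T2 x) * (Q2 x)%:E))%E.
  move=> mf f0.
  apply: (@integral_weighted_image _ _ (Rd R d) (Rd R d) R m D T2 (EFin \o Q2)) => //.
  exact/measurable_EFinP.
have lower : ((Rintegral m D (fun x => Q1 x + Q2 x - 2 * w x))%:E <= HKsq nu1 nu2)%E.
  have := weak_duality nu1 nu2 mA mB A0 B0 AB.
  rewrite -HK_sqr int1// int2// nu1E// nu2E// !preimage_setT !setIT Q1E Q2E.
  have -> : (\int[m]_(x in D) (A (T1 x) * (Q1 x)%:E) = (Rintegral m D w)%:E)%E.
    by rewrite -wE; apply: eq_integral => x; rewrite inE => /AQ.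
  have -> : (\int[m]_(x in D) (B (T2 x) * (Q2 x)%:E) = (Rintegral m D w)%:E)%E.
    by rewrite -wE; apply: eq_integral => x; rewrite inE => /BQ.
  by rewrite costE -!EFinD !lee_fin; lra.
apply/eqP; rewrite eq_le lower andbT => {lower}.
have mT12 : measurable_fun [set: Rd R d] (fun x => (T1 x, T2 x) : (Rd R d * Rd R d)%type).
  exact: measurable_fun_pair.
have mT12D : measurable_fun (D : set (Rd R d)) (fun x => (T1 x, T2 x) : (Rd R d * Rd R d)%type).
  exact: measurable_funTS.
have [|||eta etaE] := @exists_weighted_image _ _ (Rd R d) (Rd R d * Rd R d)%type R m D
    (fun x => (T1 x, T2 x)) (EFin \o w) mD mT12D; rewrite ?wE ?ltry//.
  exact/measurable_EFinP.
have etaI (f : (Rd R d * Rd R d)%type -> \bar R) : measurable_fun setT f ->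
    (forall z, 0 <= f z)%E ->
    (\int[eta]_z f z = \int[m]_(x in D) (f (T1 x, T2 x) * (w x)%:E))%E.
  move=> mf f0.
  apply: (@integral_weighted_image _ _ (Rd R d) (Rd R d * Rd R d)%type R m D
    (fun x => (T1 x, T2 x)) (EFin \o w)) => //.
  exact/measurable_EFinP.
(* Plans need real densities. Along the images an infinite value of [A] or [B] forces zero mass and
   zero [w], so [fine] changes nothing there. *)
pose r1 x := fine (A x); pose r2 x := fine (B x).
have r1_0 x : 0 <= r1 x by exact: fine_ge0.
have r2_0 x : 0 <= r2 x by exact: fine_ge0.
have mr1 : measurable_fun [set: Rd R d] r1 by exact: measurableT_comp.
have mr2 : measurable_fun [set: Rd R d] r2 by exact: measurableT_comp.
have fineQ (c : \bar R) (Q v : R) : (c * Q%:E = v%:E)%E -> fine c * Q = v.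
  case: c => [c [<-]//||]; have [->|Q0] := eqVneq Q 0.
  - by rewrite mule0 mulr0 => -[].
  - by rewrite mulyr; case: sgrP Q0 => // _ _; rewrite ?mul1e ?mulN1e.
  - by rewrite mule0 mulr0 => -[].
  - by rewrite mulNyr; case: sgrP Q0 => // _ _; rewrite ?mul1e ?mulN1e.
have r1w x : D x -> r1 (T1 x) * Q1 x = w x by move=> Dx; apply: fineQ; exact: AQ.
have r2w x : D x -> r2 (T2 x) * Q2 x = w x by move=> Dx; apply: fineQ; exact: BQ.
have adm : admissible nu1 nu2 eta r1 r2.
  split; split=> // E mE.
    rewrite etaE; last exact: measurableX.
    have -> : D `&` (fun x => (T1 x, T2 x)) @^-1` (E `*` setT) = D `&` T1 @^-1` E.
      by apply/seteqP; split=> x/= [Dx]; [case|split].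
    exact: (weighted_image_density mT1D mQ1 Q1_0 nu1E).
  rewrite etaE; last exact: measurableX.
  have -> : D `&` (fun x => (T1 x, T2 x)) @^-1` (setT `*` E) = D `&` T2 @^-1` E.
    by apply/seteqP; split=> x/= [Dx]; [case|split].
  exact: (weighted_image_density mT2D mQ2 Q2_0 nu2E).
apply: le_trans (HKsq_le adm) _; rewrite /plan_cost.
have mF (r : 'rV[R]_d -> R) : measurable_fun [set: Rd R d] r -> measurable_fun [set: Rd R d] (fun x => (F (r x))%:E).
  by move=> mr; apply/measurable_EFinP; apply: measurableT_comp => //; exact: measurable_F.
have F0 (r : 'rV[R]_d -> R) (x : 'rV[R]_d) : (forall x, 0 <= r x) -> (0 <= (F (r x))%:E)%E.
  by move=> r0; rewrite lee_fin F_ge0.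
have mFQ (r : 'rV[R]_d -> R) (T : 'rV[R]_d -> 'rV[R]_d) (Q : 'rV[R]_d -> R) : measurable_fun [set: Rd R d] r ->
    measurable_fun [set: Rd R d] (T : Rd R d -> Rd R d) -> measurable_fun (D : set (Rd R d)) Q ->
    measurable_fun (D : set (Rd R d)) (fun x => ((F (r (T x)))%:E * (Q x)%:E)%E).
  move=> mr mT mQ; apply: emeasurable_funM; last exact/measurable_EFinP.
  by apply: measurable_funTS; apply: (measurableT_comp (mF _ mr)); exact: mT.
have mL : measurable_fun setT (fun z : (Rd R d * Rd R d)%type => (2%:E * L1 (z.1 - z.2)%R)%E).
  apply: emeasurable_funM => //.
  exact: (measurable_L1B (measurable_fst) (measurable_snd)).
rewrite int1 ?int2 ?etaI//=; last 5 first.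
- by move=> z; rewrite mule_ge0// L1_ge0.
- exact: mF.
- by move=> x; exact: F0.
- exact: mF.
- by move=> x; exact: F0.
rewrite -ge0_integralD//; last 4 first.
- by move=> x Dx; rewrite mule_ge0 ?F0// lee_fin Q1_0.
- exact: mFQ.
- by move=> x Dx; rewrite mule_ge0 ?F0// lee_fin Q2_0.
- exact: mFQ.
rewrite -ge0_integralD//; last 4 first.
- by move=> x Dx; rewrite adde_ge0 ?mule_ge0 ?F0// lee_fin ?Q1_0 ?Q2_0.
- by apply: emeasurable_funD; exact: mFQ.
- by move=> x Dx; rewrite mule_ge0 ?mule_ge0 ?L1_ge0// lee_fin w_0.
- apply: emeasurable_funM; last exact/measurable_EFinP.
  apply: measurable_funTS; apply: emeasurable_funM => //; exact: (measurable_L1B mT1 mT2).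
rewrite -(@bounded_integral_fin _ _ m D _ (M + M + 2 * M))//.
- rewrite le_eqVlt; apply/orP; left; apply/eqP; apply: eq_integral => x; rewrite inE => Dx.
  by apply: entropy_transport_cost; rewrite ?Q1_0 ?Q2_0 ?w_0 ?r1w ?r2w//; exact: angleE.
- by apply: measurable_funB; [exact: measurable_funD|exact: measurable_funM].
- move=> x Dx; have /andP[? ?] := Q1M x Dx; have /andP[? ?] := Q2M x Dx.
  by have /andP[? ?] := wM x Dx; rewrite ler_norml; apply/andP; split; lra.
Qed.

End weighted_images.

(** * Angles between transported points *)

Section cone_angle.
Context {R : realType} {d : nat}.
Variables (a b : 'rV[R]_d -> \bar R) (s : R) (x p : 'rV[R]_d) (C : R).
Hypotheses (a0 : forall x, (0 <= a x)%E) (b0 : forall x, (0 <= b x)%E).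
Hypothesis lsca : lower_semicontinuous a.
Hypotheses (s01 : 0 < s < 1) (cx : contact a b s x).
Hypothesis pa : expands (hl_potential a s) x p C.

Local Notation U := (hopf_lax a s x).
Local Notation V := (hopf_lax b (1 - s) x).
Local Notation A := (cone_re U V).
Local Notation w := (cone_dot U V s p).
Local Notation X := (cone_pt U V s x p).

(** Only an end time could be degenerate; there [U V = 0] together with [0 <= w 0 1] forces [p = 0],
    and the inner product would vanish. *)
Lemma cone_re_pos_of_dot r t : 0 <= r <= 1 -> 0 < w r t -> 0 < A r.
Proof.
move=> /andP[r0 r1] w0; have /andP[s0 s1] := s01.
have := cone_dot01_ge0 a0 lsca s01 cx pa; rewrite /cone_dot cone_re0 cone_re1 => w01.
have ss : 0 < s * (1 - s) by rewrite mulr_gt0// subr_gt0.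
have p0 : U * V = 0 -> enorm p ^+ 2 = 0.
  move=> UV0; rewrite UV0 add0r sub0r mulNr mulNr in w01.
  apply/eqP; rewrite eq_le sqr_ge0 andbT.
  by rewrite -(pmulr_rle0 _ ss); lra.
have [r_gt0|r_le0] := ltP 0 r.
  have [r_lt1|r_ge1] := ltP r 1; first by apply: (cone_re_gt0 a0 b0 s01 cx); rewrite r_gt0.
  have r1E : r = 1 by lra.
  rewrite r1E cone_re1 lt_def hopf_lax_ge0 ?andbT//; last by apply/andP; split; lra.
  apply: contraTneq w0 => V0.
  by rewrite r1E /cone_dot cone_re1 V0 mul0r p0 ?V0 ?mulr0// add0r ltxx.
have r0E : r = 0 by lra.
rewrite r0E cone_re0 lt_def hopf_lax_ge0 ?andbT//.
apply: contraTneq w0 => U0.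
by rewrite r0E /cone_dot cone_re0 U0 mul0r p0 ?U0 ?mul0r// mulr0 add0r ltxx.
Qed.

Lemma cone_pt_angle r t : 0 <= r <= 1 -> 0 <= t <= 1 -> 0 < w r t ->
  enorm (X r - X t) < pi / 2 /\ cos2 (X r - X t) = w r t ^+ 2 / (w r r * w t t).
Proof.
move=> r01 t01 w0.
have Ar := cone_re_pos_of_dot r01 w0.
have At : 0 < A t by apply: (@cone_re_pos_of_dot t r) => //; rewrite cone_dotC.
have -> : X r - X t = vatan (((r - s) / A r) *: p) - vatan (((t - s) / A t) *: p).
  rewrite /cone_pt Ar At; move: (vatan _) (vatan _) => u v.
  by rewrite opprD addrACA subrr add0r.
have wrr : 0 < w r r.
  by rewrite /cone_dot -!expr2 ltr_wpDr ?exprn_gt0// mulr_ge0// sqr_ge0.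
have wtt : 0 < w t t.
  by rewrite /cone_dot -!expr2 ltr_wpDr ?exprn_gt0// mulr_ge0// sqr_ge0.
have klE : 1 + (r - s) / A r * ((t - s) / A t) * enorm p ^+ 2 = w r t / (A r * A t).
  by rewrite /cone_dot; field; rewrite !gt_eqF.
have rE : 1 + ((r - s) / A r) ^+ 2 * enorm p ^+ 2 = w r r / A r ^+ 2.
  by rewrite /cone_dot; field; rewrite !gt_eqF.
have tE : 1 + ((t - s) / A t) ^+ 2 * enorm p ^+ 2 = w t t / A t ^+ 2.
  by rewrite /cone_dot; field; rewrite !gt_eqF.
have [|h1 h2 _] := @vatanB_geometry _ _ ((r - s) / A r) ((t - s) / A t) p.
  by rewrite klE divr_gt0// mulr_gt0.
split=> //; rewrite h2 klE rE tE.
move: (w r t) (w r r) (w t t) (A r) (A t) wrr wtt Ar At => u v z k l v0 z0 k0 l0.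
by field; rewrite ?exprMn !gt_eqF.
Qed.

End cone_angle.

(** * Every measure on the contact set generates a geodesic *)

Section action_geodesic.
Context {R : realType} {d : nat}.
Variables (phi0 phi1 : 'rV[R]_d -> \bar R).
Hypotheses (lsc0 : lower_semicontinuous phi0) (usc1 : upper_semicontinuous phi1).
Hypothesis phi1E : forall x1, phi1 x1 =
  ereal_inf [set phi0 x0 + L1 (x1 - x0)%R | x0 in eball x1 (pi / 2)]%E.

Local Notation a := (exp2 phi0).
Local Notation b := (expN2 phi1).
Local Notation Xi := (Xi phi0 phi1).
Local Notation T := (transport phi0).
Local Notation q := (growth phi0).

Variables (s : R) (m : fmeas R d) (nu : R -> fmeas R d).
Hypothesis s01 : 0 < s < 1.
Hypothesis nuE : forall t, 0 <= t <= 1 -> forall E : set (Rd R d), measurable E ->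
  nu t E = (\int[m]_(x in Xi s `&` T s t @^-1` E) (q s t x ^+ 2)%:E)%E.

Local Notation U x := (hopf_lax a s x).
Local Notation V x := (hopf_lax b (1 - s) x).
Local Notation p x := (grad (xir phi0 s) x).
Local Notation w r t x := (cone_dot (U x) (V x) s (p x) r t).

Let a0 := exp2_ge0 phi0.
Let b0 := expN2_ge0 phi1.
Let lsca := lsc_exp2 lsc0.
Let lscb := lsc_expN2 usc1.
Let ab := tight_dual_pair phi1E.
Let mXi := Xi_measurable lsc0 usc1 s01.
Let s01' : 0 < 1 - s < 1.
Proof. by case/andP: s01 => s0 s1; rewrite subr_gt0 s1/= ltrBlDr ltrDl. Qed.

(** The transport map is controlled only on the contact set; the identity outside makes it
    measurable everywhere. *)
Let ext (f : 'rV[R]_d -> 'rV[R]_d) x := if x \in Xi s then f x else x.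

Let extE f x : Xi s x -> ext f x = f x.
Proof. by move=> cx; rewrite /ext mem_set. Qed.

Let ext_measurable t : measurable_fun [set: Rd R d] (ext (T s t) : Rd R d -> Rd R d).
Proof.
apply: (@measurable_fun_if _ _ (Rd R d) (Rd R d) (T s t) id setT measurableT (mem (Xi s))) => //.
  by apply: (measurable_fun_bool true); rewrite setTI preimage_mem_true.
rewrite preimage_mem_true setTI.
exact: (transport_measurable lsc0 usc1 phi1E t s01).
Qed.

Let speed x := (V x - U x) ^+ 2 + enorm (p x) ^+ 2.

(** The parallelogram identity expresses the inner products by squared lengths, whose measurability
    is known from the growth maps. *)
Let w_growth r t x : w r t x = 2 * w ((r + t) / 2) ((r + t) / 2) x - (w r r x + w t t x) / 2.
Proof. by rewrite /cone_dot /cone_re; field. Qed.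

Let speedE r t x : w r r x + w t t x - 2 * w r t x = (t - r) ^+ 2 * speed x.
Proof. by rewrite /cone_dot /cone_re /speed; ring. Qed.

Let growth_measurable_dot t : measurable_fun (Xi s : set (Rd R d)) (fun x => w t t x).
Proof.
have mq : measurable_fun (Xi s : set (Rd R d)) (fun x => q s t x ^+ 2).
  by apply: measurable_funX; exact: (growth_measurable lsc0 usc1 phi1E t s01).
by apply: eq_measurable_fun mq => x; rewrite inE => cx; rewrite (growth_sqr lsc0 usc1).
Qed.

Let dot_measurable r t : measurable_fun (Xi s : set (Rd R d)) (fun x => w r t x).
Proof.
under eq_fun do rewrite w_growth.
apply: measurable_funB; first exact: measurable_funM.
by apply: measurable_funM => //; exact: measurable_funD.
Qed.

Let nu_ext t : 0 <= t <= 1 -> forall E : set (Rd R d), measurable E ->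
  nu t E = (\int[m]_(x in Xi s `&` ext (T s t) @^-1` E) (w t t x)%:E)%E.
Proof.
move=> t01 E mE; rewrite nuE//.
have -> : Xi s `&` ext (T s t) @^-1` E = Xi s `&` T s t @^-1` E.
  by apply/seteqP; split=> x/= [cx]; rewrite extE.
by apply: eq_integral => x; rewrite inE => -[cx _]; rewrite (growth_sqr lsc0 usc1).
Qed.

Let dot_bounded r t : 0 <= r <= 1 -> 0 <= t <= 1 -> exists M, forall x, Xi s x ->
  [/\ 0 <= w r r x <= M, 0 <= w t t x <= M & 0 <= w r t x <= M].
Proof.
move=> r01 t01.
have [M1 q1] := growth_bounded lsc0 usc1 phi1E s01 r01.
have [M2 q2] := growth_bounded lsc0 usc1 phi1E s01 t01.
exists (Num.max M1 M2) => x cx; have /(XiE lsc0 usc1 x s01) cx' := cx.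
have [pa _] := grad_expands lsc0 usc1 phi1E s01 cx.
have dot_ge0 := cone_dot_ge0 a0 lsca s01 cx' pa.
have wr : w r r x <= Num.max M1 M2 by rewrite le_max -(growth_sqr lsc0 usc1)// q1.
have wt : w t t x <= Num.max M1 M2 by rewrite le_max -(growth_sqr lsc0 usc1 t s01)// q2// orbT.
have : 0 <= w r r x + w t t x - 2 * w r t x.
  by rewrite speedE mulr_ge0 ?sqr_ge0// addr_ge0 ?sqr_ge0.
by move=> h; rewrite !dot_ge0//= wr wt; split=> //; lra.
Qed.

(** The cost density is the squared distance of two points on a line traversed at constant speed.
    Each order of the two measures is computed from its own dual pair and plan. *)
Let action_HKsq_lt r t : 0 <= r -> r < t -> t <= 1 ->
  HKsq (nu r) (nu t) = (Rintegral m (Xi s) (fun x => (t - r) ^+ 2 * speed x))%:E /\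
  HKsq (nu t) (nu r) = (Rintegral m (Xi s) (fun x => (t - r) ^+ 2 * speed x))%:E.
Proof.
move=> r0 rt t1.
have r01 : 0 <= r <= 1 by apply/andP; split; lra.
have t01 : 0 <= t <= 1 by apply/andP; split; lra.
have r01' : 0 <= r < 1 by apply/andP; split; lra.
have t01' : 0 <= 1 - t < 1 by apply/andP; split; lra.
have tr : 1 - t < 1 - r by lra.
have r1 : 1 - r <= 1 by lra.
have [M bM] := dot_bounded r01 t01.
have contactE x : Xi s x -> contact a b s x by move/(XiE lsc0 usc1 x s01).
have angleE x : Xi s x -> 0 < w r t x ->
    enorm (ext (T s r) x - ext (T s t) x) < pi / 2 /\
    cos2 (ext (T s r) x - ext (T s t) x) = w r t x ^+ 2 / (w r r x * w t t x).
  move=> cx w0; have [pa _] := grad_expands lsc0 usc1 phi1E s01 cx.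
  rewrite !extE// !(transportE lsc0 usc1 _ s01 cx).
  exact: (cone_pt_angle a0 b0 lsca s01 (contactE x cx) pa).
pose Asf := source_factor a r t; pose Bsf := source_factor b (1 - t) (1 - r).
have mA : measurable_fun [set: Rd R d] Asf by exact: source_factor_measurable.
have mB : measurable_fun [set: Rd R d] Bsf by exact: source_factor_measurable.
have A0 x : (0 <= Asf x)%E by exact: source_factor_ge0.
have B0 x : (0 <= Bsf x)%E by apply: source_factor_ge0 => //; lra.
have AQ x : Xi s x -> (Asf (ext (T s r) x) * (w r r x)%:E = (w r t x)%:E)%E.
  move=> cx; have [pa pb] := grad_expands lsc0 usc1 phi1E s01 cx.
  rewrite extE// (transportE lsc0 usc1 r s01 cx).
  exact: (source_factor_along a0 b0 lsca lscb ab s01 (contactE x cx) pa pb).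
have BQ x : Xi s x -> (Bsf (ext (T s t) x) * (w t t x)%:E = (w r t x)%:E)%E.
  move=> cx; have [pa pb] := grad_expands lsc0 usc1 phi1E s01 cx.
  have e : 1 - (1 - s) = s by ring.
  (* The factor at the later time is the source factor of the reversed problem, whose gradient is
     [- p]. *)
  have pa' : expands (hl_potential a (1 - (1 - s))) x (- - p x) (2 / (s * (1 - s))).
    by rewrite e opprK.
  have := source_factor_along b0 a0 lscb lsca (dual_pair_sym ab) s01' (contact_sym (contactE x cx))
    pb pa' (1 - r) t01'.
  rewrite e cone_pt_sym (cone_dot_sym _ _ _ _ t t) (cone_dot_sym _ _ _ _ r t).
  by rewrite /Bsf (extE _ cx) (transportE lsc0 usc1 t s01 cx).
have AB x y : (Asf x = +oo \/ Bsf y = +oo \/ (cos2 (x - y))%:E <= Asf x * Bsf y)%E.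
  exact: source_factor_constraint.
have intE : Rintegral m (Xi s) (fun x => (t - r) ^+ 2 * speed x) =
    Rintegral m (Xi s) (fun x => w r r x + w t t x - 2 * w r t x).
  by apply: eq_Rintegral => x _; rewrite speedE.
split; rewrite intE.
  apply: (@HKsq_weighted_images _ _ m (Xi s) mXi (nu r) (nu t) (ext (T s r)) (ext (T s t))
    _ _ _ Asf Bsf M) => //; try exact: nu_ext.
  - by move=> x /bM[].
  - by move=> x /bM[].
  - by move=> x /bM[].
rewrite (_ : (fun x => w r r x + w t t x - 2 * w r t x) =
  (fun x => w t t x + w r r x - 2 * w r t x)); last by apply/funext => x; rewrite (addrC (w r r x)).
apply: (@HKsq_weighted_images _ _ m (Xi s) mXi (nu t) (nu r) (ext (T s t)) (ext (T s r))
  _ _ _ Bsf Asf M) => //; try exact: nu_ext.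
- by move=> x /bM[].
- by move=> x /bM[].
- by move=> x /bM[].
- by move=> x y; rewrite cos2BC muleC; case: (AB y x) => [->|[->|->]];
    [right; left|left|right; right].
- move=> x cx w0; have [e1 e2] := angleE x cx w0.
  by rewrite cos2BC e2 -enormN opprB e1 (mulrC (w r r x)).
Qed.

(** Here no time lies strictly before the other; the constant pair 1, 1 and the diagonal plan are
    optimal. *)
Let action_HKsq_diag t : 0 <= t <= 1 -> HKsq (nu t) (nu t) = 0%E.
Proof.
move=> t01; have [M bM] := dot_bounded t01 t01.
rewrite (@HKsq_weighted_images _ _ m (Xi s) mXi (nu t) (nu t) (ext (T s t)) (ext (T s t))
  (fun x => w t t x) (fun x => w t t x) (fun x => w t t x) (fun=> 1%E) (fun=> 1%E) M) => //;
  try exact: nu_ext; try by move=> x /bM[].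
- have -> : (fun x => w t t x + w t t x - 2 * w t t x) = fun=> 0.
    by apply/funext => x; move: (w t t x) => u; ring.
  by rewrite Rintegral_cst// mul0r.
- by move=> x y; right; right; rewrite mul1e lee_fin cos2_le1.
- by move=> x cx; rewrite mul1e.
- by move=> x cx; rewrite mul1e.
- move=> x cx w0; rewrite subrr enorm0 divr_gt0 ?pi_gt0//; split=> //.
  by rewrite cos2_near enorm0 ?divr_gt0 ?pi_gt0// cos0 expr1n expr2 divff// mulf_neq0// gt_eqF.
Qed.

Lemma action_geodesic : HK_geodesic nu.
Proof.
have z01 : 0 <= (0 : R) <= 1 by rewrite lexx ler01.
have o01 : 0 <= (1 : R) <= 1 by rewrite lexx ler01.
have [M bM] := dot_bounded z01 o01.
have ispeed : m.-integrable (Xi s : set (Rd R d)) (EFin \o speed).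
  have E x : speed x = w 0 0 x + w 1 1 x - 2 * w 0 1 x by rewrite speedE subr0 expr1n mul1r.
  apply: (@bounded_integrable _ _ m (Xi s) speed (M + M)) => //.
    rewrite (funext E).
    by apply: measurable_funB; [exact: measurable_funD|exact: measurable_funM].
  move=> x /bM[] /andP[? ?] /andP[? ?] /andP[? ?].
  rewrite ger0_norm; last by rewrite addr_ge0 ?sqr_ge0.
  by rewrite E; lra.
have key r t : 0 <= r <= 1 -> 0 <= t <= 1 ->
    HKsq (nu r) (nu t) = ((t - r) ^+ 2 * Rintegral m (Xi s) speed)%:E.
  move=> /andP[r0 r1] /andP[t0 t1]; rewrite -RintegralZl//.
  have [rt|tr|->] := ltgtP r t.
  - by have [] := action_HKsq_lt r0 rt t1.
  - have [_ ->] := action_HKsq_lt t0 tr r1; congr (_%:E).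
    by apply: eq_Rintegral => x _; rewrite -sqrrN opprB.
  - rewrite action_HKsq_diag ?t0//.
    by under eq_Rintegral do rewrite subrr expr0n/= mul0r; rewrite Rintegral_cst// mul0r.
move=> r t r01 t01; rewrite /HK !key//= subr0 expr1n mul1r.
by rewrite sqrtrM ?sqr_ge0// sqrtr_sqr distrC.
Qed.

End action_geodesic.

(** * Measurability of the support *)

Section support.
Context {R : realType} {d : nat}.

Lemma supp_measurable (m : fmeas R d) : measurable (supp m : set (Rd R d)).
Proof.
apply: rV_closed_measurable; rewrite -[supp m]setCK; apply: open_closedC.
have -> : ~` supp m = \bigcup_(O in [set O : set 'rV[R]_d | open O /\ m O = 0%E]) O.
  apply/seteqP; split=> [x /existsNP[G /not_implyP[G_open /not_implyP[Gx mG]]]|x [G [G_open mG] Gx] mx].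
    exists G => //; split=> //; apply/eqP; rewrite eq_le measure_ge0 andbT.
    by rewrite leNgt; exact/negP.
  by have := mx G G_open Gx; rewrite mG ltxx.
by apply: bigcup_open => G [].
Qed.

End support.

(** * Transport of supports and densities *)

Section transported_density.
Context {R : realType} {d : nat}.
Variables (mu : R -> fmeas R d) (phi0 phi1 : 'rV[R]_d -> \bar R).
Hypotheses (geo : HK_geodesic mu) (pot : tight_optimal_pair (mu 0) (mu 1) phi0 phi1).

Local Notation a := (exp2 phi0).
Local Notation b := (expN2 phi1).
Local Notation Xi := (Xi phi0 phi1).
Local Notation T := (transport phi0).
Local Notation q := (growth phi0).

Let a0 := exp2_ge0 phi0.
Let b0 := expN2_ge0 phi1.
Let lsc0 : lower_semicontinuous phi0. Proof. by case: pot => -[]. Qed.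
Let usc1 : upper_semicontinuous phi1. Proof. by case: pot => -[]. Qed.
Let phi1E : forall x1, phi1 x1 =
  ereal_inf [set phi0 x0 + L1 (x1 - x0)%R | x0 in eball x1 (pi / 2)]%E.
Proof. by case: pot. Qed.

Lemma transport_continuous s t : 0 < s < 1 -> 0 < t < 1 ->
  {within Xi s, continuous (T s t)}.
Proof.
move=> s01 t01; have := transport_continuous_pos lsc0 usc1 phi1E (t := t) s01.
rewrite setIidl// => x cX /=.
have /(XiE lsc0 usc1 x s01) cx := cX; rewrite (transport_factorE lsc0 usc1)//.
exact: (cone_re_gt0 a0 b0 s01 cx t01).
Qed.

(** If an open [O] around [T s t x] were null for [mu t], a neighborhood of [x] in the contact set
    would be sent into [O]. Its [mu s] mass is an integral over points [y] of [O], since [T s t]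
    inverts [T t s], so it would be null too. *)
Lemma supp_transport s t x : 0 < s < 1 -> 0 < t < 1 ->
  supp (mu s) x -> supp (mu t) (T s t x).
Proof.
move=> s01 t01 xs O oO OTx; rewrite lt0e measure_ge0 andbT; apply/eqP => O0.
have cx := supp_contact geo pot s01 xs.
have mXi := Xi_measurable lsc0 usc1 s01.
have near_x : within (Xi s) (nbhs x) (T s t @^-1` O).
  rewrite nbhs_subspace_in//.
  exact: (transport_continuous s01 t01 (x := x) (open_nbhs_nbhs (conj oO OTx))).
move: near_x; rewrite /within/= nbhsE => -[G + GO] => -[oG Gx].
have := xs G oG Gx; suff -> : mu s G = 0%E by rewrite ltxx.
have mG := rV_open_measurable oG.
apply: (eq_trans (measureDI (mu s) mG mXi)).
rewrite -[RHS]add0e; congr (_ + _)%E.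
  apply: (subset_measure0 (measurableD mG mXi) (measurableC mXi) _ (contact_full geo pot s01)).
  by move=> z [].
apply: (eq_trans (geodesic_action geo pot t01 s01 (measurableI _ _ mG mXi))).
have mTts := transport_measurable lsc0 usc1 phi1E s t01.
have mE : measurable (Xi t `&` T t s @^-1` (G `&` Xi s) : set (Rd R d)).
  by apply: mTts; [exact: Xi_measurable|exact: measurableI].
apply: null_set_integral => //.
  apply/measurable_EFinP; apply: measurable_funX.
  apply: measurable_funS (growth_measurable lsc0 usc1 phi1E s t01) => //.
  exact: Xi_measurable.
apply: (subset_measure0 mE (rV_open_measurable oO) _ O0) => y [cy [Gy cTy]].
by have := GO _ Gy cTy; rewrite (transport_back lsc0 usc1 phi1E t01 s01 cy).
Qed.

(** Both measures are pulled back to integrals against [mu s]; the integrands agree because [T t s]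
    inverts [T s t] and supports correspond to each other. *)
Lemma transported_density s t (nus nut : fmeas R d) (rho : 'rV[R]_d -> \bar R) :
    0 < s < 1 -> 0 < t < 1 ->
    (forall E : set (Rd R d), measurable E ->
      nut E = (\int[nus]_(x in Xi s `&` T s t @^-1` E) (q s t x ^+ 2)%:E)%E) ->
  is_density (mu s) rho nus -> is_density (mu t) (fun y => rho (T t s y)) nut.
Proof.
move=> s01 t01 nutE [mrho rho0 nusE].
have mXis := Xi_measurable lsc0 usc1 s01.
have mXit := Xi_measurable lsc0 usc1 t01.
have mS := supp_measurable (mu s); have mSt := supp_measurable (mu t).
have mTst := transport_measurable lsc0 usc1 phi1E t s01.
have mTts : measurable_fun (supp (mu t) : set (Rd R d)) (T t s : Rd R d -> Rd R d).
  apply: measurable_funS (transport_measurable lsc0 usc1 phi1E s t01) => //.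
  exact: (supp_contact geo pot t01).
have mrhoT : measurable_fun (supp (mu t) : set (Rd R d)) (fun y => rho (T t s y)).
  apply: (@measurable_comp _ _ _ (Rd R d) (Rd R d) _ (supp (mu s)) rho (supp (mu t)) (T t s)) => //.
  by move=> _ [y yt <-]; exact: supp_transport yt.
have suppE x : Xi s x -> supp (mu t) (T s t x) <-> supp (mu s) x.
  move=> cx; split; last exact: supp_transport.
  by move=> /(supp_transport t01 s01); rewrite (transport_back lsc0 usc1 phi1E s01 t01 cx).
split=> // [y yt|E mE]; first by apply: rho0; exact: supp_transport yt.
have mq : measurable_fun (Xi s : set (Rd R d)) (fun x => (q s t x ^+ 2)%:E).
  apply/measurable_EFinP; apply: measurable_funX.
  exact: (growth_measurable lsc0 usc1 phi1E t s01).
have mD : measurable (Xi s `&` T s t @^-1` E : set (Rd R d)) by exact: mTst.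
rewrite nutE// integral_mkcond.
(* Having the density [rho] means being the image of [mu s] under the identity with weight [rho],
   possibly infinite. *)
rewrite (@integral_weighted_image _ _ (Rd R d) (Rd R d) R (mu s) (supp (mu s)) id rho mS _ _ _ nus _)//.
rewrite [RHS]integral_mkcond (integral_action lsc0 usc1 phi1E s01 (geodesic_action geo pot s01 t01)).
- rewrite [LHS]integral_mkcond [RHS]integral_mkcond; apply: eq_integral => x _.
  rewrite !patchE.
  rewrite -[point]/(0%E : \bar R).
  have inI (B1 B2 : set 'rV[R]_d) y : (y \in B1 `&` B2) = (y \in B1) && (y \in B2).
    by apply/idP/andP; rewrite !inE.
  rewrite !inI; have [cX|cX] := boolP (x \in Xi s); last by rewrite /= mul0e if_same.
  have -> : (T s t x \in supp (mu t)) = (x \in supp (mu s)).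
    by apply/idP/idP; rewrite !inE => /(suppE x (set_mem cX)).
  have -> : (x \in T s t @^-1` E) = (T s t x \in E) by apply/idP/idP; rewrite !inE.
  case: (x \in supp _); rewrite /= ?mul0e//.
  case: (_ \in E); rewrite ?mul0e// muleC.
  by rewrite (transport_back lsc0 usc1 phi1E s01 t01 (set_mem cX)).
- by apply/(measurable_restrictT _ _).1; [exact: measurableI|exact: measurable_funS mrhoT].
- apply: erestrict_ge0 => y [yt _]; apply: rho0; exact: supp_transport yt.
- by apply/(measurable_restrictT _ _).1 => //; apply: measurable_funS mq.
- by apply: erestrict_ge0 => y _; rewrite lee_fin sqr_ge0.
Qed.

End transported_density.
Theorem theorem5p4 (R : realType) (d : nat) (mu : R -> fmeas R d)
  (phi0 phi1 : 'rV[R]_d -> \bar R) (s : R) (nus : fmeas R d)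
  (Hgeo : HK_geodesic mu)
  (Hpot : tight_optimal_pair (mu 0) (mu 1) phi0 phi1)
  (Hs : 0 < s < 1)
  (Hsupp : supp nus `<=` supp (mu s)) :
  exists nu : R -> fmeas R d,
    [/\ forall t, 0 <= t <= 1 ->
          is_action (Xi phi0 phi1 s) (transport phi0 s t) (growth phi0 s t)
            nus (nu t),
        HK_geodesic nu &
        forall rhos : 'rV[R]_d -> \bar R,
          is_density (mu s) rhos nus ->
          forall t, 0 < t < 1 ->
            is_density (mu t) (fun y => rhos (transport phi0 t s y)) (nu t)].
Proof.
have [[lsc0 usc1] _ phi1E _ _] := Hpot.
have /choice[nu nuE] : forall t, exists n : fmeas R d, 0 <= t <= 1 ->
    forall A : set (Rd R d), measurable A ->
    n A = (\int[nus]_(x in Xi phi0 phi1 s `&` transport phi0 s t @^-1` A)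
             (growth phi0 s t x ^+ 2)%:E)%E.
  (* Outside the unit interval the curve may take any value; [nus] is at hand. *)
  move=> t; have [t01|_] := boolP (0 <= t <= 1); last by exists nus.
  by have [n nE] := exists_action lsc0 usc1 phi1E nus Hs t01; exists n.
exists nu; split.
- move=> t t01; split; last exact: nuE.
    exact: (transport_measurable lsc0 usc1 phi1E t Hs).
  exact: (growth_measurable lsc0 usc1 phi1E t Hs).
- exact: (action_geodesic lsc0 usc1 phi1E Hs nuE).
- move=> rhos rhoE t t01.
  apply: (transported_density Hgeo Hpot Hs t01 (nuE t _) rhoE).
  by case/andP: t01 => ? ?; rewrite !ltW.
Qed.
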